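(* Let $n>0$ be an integer. (i) The category $\mathsf{FHS}_n$ of formal Hodge structures of level $\le n$ is an abelian category. (ii) The forgetful functor $(H,V)\mapsto H$ (resp. $(H,V)\mapsto V$) is an exact functor from $\mathsf{FHS}_n$ to the category of formal groups (resp. to the category $\mathsf{Vec}_n$). (iii) There exists a full and thick embedding $\mathsf{MHS}_n\to\mathsf{FHS}_n$ induced by $(H_{\rm et},F,W)\mapsto(H_{\rm et},V)$ with $V_i=H_{\mathbb{C}}/F^i$. (iv) There exists a full and thick embedding $\mathsf{Vec}_n\to\mathsf{FHS}_n$ induced by $V\mapsto(0,V)$.
   Context: A formal group is a commutative group $H=H^o\times H_{\rm et}$ with $H_{\rm et}$ a finitely generated abelian group and $H^o$ a finite-dimensional $\mathbb{C}$-vector space; morphisms are pairs $(f^o,f_{\rm et})$ with $f^o$ $\mathbb{C}$-linear and $f_{\rm et}$ $\mathbb{Z}$-linear. $\mathsf{MHS}_n$ is the category of mixed Hodge structures (on finitely generated abelian groups) of level $\le n$, i.e. with all Hodge types $(p,q)$ satisfying $0\le p,q\le n$. $\mathsf{Vec}_n$ is the category of diagrams $V=(V_n\xrightarrow{v_n}V_{n-1}\to\cdots\to V_1)$ of finite-dimensional $\mathbb{C}$-vector spaces, with morphisms the families of linear maps $f_i:V_i\to V_i'$ commuting with the arrows. For $n>0$, a formal Hodge structure of level $\le n$, written $(H,V)$, consists of: a formal group $H$ with a mixed Hodge structure of level $\le n$ on $H_{\rm et}$ (put $H_{\mathbb{C}}=H_{\rm et}\otimes\mathbb{C}$); an object $V$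 of $\mathsf{Vec}_n$; $\mathbb{C}$-linear maps $\pi_i:V_i\to H_{\mathbb{C}}/F^i$ ($1\le i\le n$) commuting with the $v_i$ and the projections $H_{\mathbb{C}}/F^i\to H_{\mathbb{C}}/F^{i-1}$; and an augmentation $h=(h^o,h_{\rm et}):H\to V_n$ with $h^o:H^o\to V_n$ $\mathbb{C}$-linear, $h_{\rm et}:H_{\rm et}\to V_n$ a group homomorphism and $\pi_n\circ h_{\rm et}$ equal to the canonical map $c:H_{\rm et}\to H_{\mathbb{C}}/F^n$. (No condition relates $h^o$ and $\pi_n$.) A morphism $(f,\phi):(H,V)\to(H',V')$ is a morphism of formal groups $f$ with $f_{\rm et}$ a morphism of mixed Hodge structures, together with a morphism $\phi:V\to V'$ in $\mathsf{Vec}_n$, such that $\phi$ commutes with the $\pi_i$ and the maps $H_{\mathbb{C}}/F^i\to H'_{\mathbb{C}}/F^i$ induced by $f_{\rm et}$, and $\phi_n\circ h=h'\circ f$. This category is $\mathsf{FHS}_n$. In (iii), the object has $H^o=0$, $\pi_i=\mathrm{id}$ and augmentation the canonical map $H_{\rm et}\to H_{\mathbb{C}}/F^n$. A full embedding is thick if its essential image is closed under kernels, cokernels and extensions. *)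

(* Defs.v *)
From HB Require Import structures.
From mathcomp Require Import all_boot all_order all_algebra complex.
From mathcomp Require Import boolp reals.

Set Implicit Arguments.
Unset Strict Implicit.
Unset Printing Implicit Defensive.

Import Order.TTheory GRing.Theory Num.Theory.
Local Open Scope ring_scope.
Local Open Scope quotient_scope.

Record preadditive := Preadditive {
  ob :> Type;
  hom : ob -> ob -> zmodType;
  idm : forall A, hom A A;
  comp : forall A B C, hom B C -> hom A B -> hom A C;
  compA : forall A B C D (h : hom C D) (g : hom B C) (f : hom A B),
    comp h (comp g f) = comp (comp h g) f;
  comp1m : forall A B (f : hom A B), comp (idm B) f = f;
  compm1 : forall A B (f : hom A B), comp f (idm A) = f;
  compDl : forall A B C (g g' : hom B C) (f : hom A B),
    comp (g + g') f = comp g f + comp g' f;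
  compDr : forall A B C (g : hom B C) (f f' : hom A B),
    comp g (f + f') = comp g f + comp g f' }.

Arguments idm {_} A.

Notation "g \c f" := (comp g f) (at level 40, left associativity).

Section CategoryNotions.
Variable C : preadditive.
Implicit Types A B K Q X Z : C.

Definition is_iso A B (f : hom A B) :=
  exists g : hom B A, g \c f = idm A /\ f \c g = idm B.

Definition isomorphic A B := exists f : hom A B, is_iso f.

Definition mono A B (f : hom A B) :=
  forall X (g h : hom X A), f \c g = f \c h -> g = h.

Definition epi A B (f : hom A B) :=
  forall X (g h : hom B X), g \c f = h \c f -> g = h.

Definition zero_object Z :=
  (forall X (f : hom X Z), f = 0) /\ (forall X (f : hom Z X), f = 0).

Definition is_biproduct A B P (p1 : hom P A) (p2 : hom P B)
    (i1 : hom A P) (i2 : hom B P) :=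
  [/\ p1 \c i1 = idm A, p2 \c i2 = idm B & i1 \c p1 + i2 \c p2 = idm P].

Definition is_kernel A B K (k : hom K A) (f : hom A B) :=
  f \c k = 0 /\
  forall X (g : hom X A), f \c g = 0 -> exists! u : hom X K, k \c u = g.

Definition is_cokernel A B Q (q : hom B Q) (f : hom A B) :=
  q \c f = 0 /\
  forall X (g : hom B X), g \c f = 0 -> exists! u : hom Q X, u \c q = g.

Definition abelian_category :=
  [/\ exists Z, zero_object Z,
      forall A B, exists P (p1 : hom P A) (p2 : hom P B) (i1 : hom A P)
        (i2 : hom B P), is_biproduct p1 p2 i1 i2,
      forall A B (f : hom A B),
        (exists K (k : hom K A), is_kernel k f) /\
        (exists Q (q : hom B Q), is_cokernel q f),
      forall A B (f : hom A B), mono f ->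
        exists X (g : hom B X), is_kernel f g
    & forall A B (f : hom A B), epi f ->
        exists X (g : hom X A), is_cokernel f g].

Definition short_exact A B Q (f : hom A B) (g : hom B Q) :=
  is_kernel f g /\ is_cokernel g f.

End CategoryNotions.

Record functor (C D : preadditive) := Functor {
  fob :> C -> D;
  fmap : forall A B : C, hom A B -> hom (fob A) (fob B);
  fmap_id : forall A : C, fmap (idm A) = idm (fob A);
  fmap_comp : forall (A B X : C) (g : hom B X) (f : hom A B),
    fmap (g \c f) = fmap g \c fmap f }.

Section FunctorNotions.
Variables (C D : preadditive) (T : functor C D).

Definition additive_functor :=
  forall (A B : C) (f g : hom A B), fmap T (f + g) = fmap T f + fmap T g.

Definition exact_functor :=
  additive_functor /\
  forall (A B Q : C) (f : hom A B) (g : hom B Q),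
    short_exact f g -> short_exact (fmap T f) (fmap T g).

Definition faithful :=
  forall A B : C, injective (@fmap C D T A B).

Definition full :=
  forall (A B : C) (g : hom (T A) (T B)), exists f : hom A B, fmap T f = g.

Definition essential_image (X : D) := exists A : C, isomorphic (T A) X.

Definition thick :=
  [/\ forall (A B K : D) (k : hom K A) (f : hom A B),
        essential_image A -> essential_image B -> is_kernel k f ->
        essential_image K,
      forall (A B Q : D) (q : hom B Q) (f : hom A B),
        essential_image A -> essential_image B -> is_cokernel q f ->
        essential_image Q
    & forall (A B Q : D) (f : hom A B) (g : hom B Q),
        essential_image A -> essential_image Q -> short_exact f g ->
        essential_image B].

Definition full_thick_embedding := [/\ full, faithful & thick].

End FunctorNotions.

Definition spans (K : fieldType) (V : lmodType K) m (g : 'I_m -> V) :=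
  forall v, exists a : 'I_m -> K, v = \sum_i a i *: g i.

Lemma spans_vector_axiom (K : fieldType) (V : lmodType K) :
  (exists m (g : 'I_m -> V), spans g) -> {m : nat & Vector.axiom m V}.
Proof.
move=> exg.
pose P m := `[< exists g : 'I_m -> V, spans g >].
have exP : exists m, P m by case: exg => m [g sg]; exists m; apply/asboolP; exists g.
case: (ex_minnP exP) => m /asboolP/cid[g sg] mmin.
exists m.
have free (a : 'I_m -> K) : \sum_i a i *: g i = 0 -> forall i, a i = 0.
  move=> a0 j; apply/eqP/negP => /negP aj0.
  case: m g sg a a0 j aj0 mmin => [|m] g sg a a0 j aj0 mmin; first by case: j aj0.
  suff /mmin : P m by rewrite ltnn.
  apply/asboolP; exists (fun i => g (lift j i)) => v.
  have [b ->] := sg v.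
  have gj : g j = \sum_i (- (a j)^-1 * a (lift j i)) *: g (lift j i).
    have : a j *: g j = - \sum_i a (lift j i) *: g (lift j i).
      apply/eqP; rewrite -addr_eq0; apply/eqP; rewrite -[RHS]a0.
      by rewrite (bigD1_ord j).
    move=> /(congr1 (fun x => (a j)^-1 *: x)).
    rewrite scalerA mulVf // scale1r => ->.
    rewrite scalerN scaler_sumr -sumrN.
    by apply: eq_bigr => i _; rewrite scalerA mulNr scaleNr.
  exists (fun i => b (lift j i) + b j * (- (a j)^-1 * a (lift j i))).
  rewrite (bigD1_ord j) //= {1}gj scaler_sumr -big_split /=.
  by apply: eq_bigr => i _; rewrite scalerA addrC scalerDl.
pose co v := projT1 (cid (sg v)).
have coE v : v = \sum_i co v i *: g i := projT2 (cid (sg v)).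
have uniq_co v (a : 'I_m -> K) : v = \sum_i a i *: g i -> forall i, co v i = a i.
  move=> va i; apply/eqP; rewrite -subr_eq0; apply/eqP.
  apply: (free (fun i => co v i - a i)).
  under eq_bigr do rewrite scalerBl.
  by rewrite sumrB -coE -va subrr.
exists (fun v => \row_i co v i).
  move=> k u v; apply/rowP => i; rewrite !mxE.
  apply: (uniq_co _ (fun i => k * co u i + co v i)).
  under eq_bigr do rewrite scalerDl -scalerA.
  by rewrite big_split /= -scaler_sumr -!coE.
exists (fun r : 'rV_m => \sum_i r 0 i *: g i).
  by move=> v; rewrite {2}[v]coE; apply: eq_bigr => i _; rewrite mxE.
by move=> r; apply/rowP => i; rewrite mxE; apply: uniq_co.
Qed.

Section VectorQuotient.
Variables (K : fieldType) (V : vectType K) (U : {vspace V}).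

Definition vquot := Quotient.quot (pred_of_vspace U).
HB.instance Definition _ := Choice.on vquot.
HB.instance Definition _ := GRing.Zmodule.on vquot.

Let pr (v : V) : vquot := \pi_(Quotient.quot (pred_of_vspace U)) v.

Let pr_eq u v : (pr u = pr v) <-> (u - v \in U).
Proof.
rewrite -[_ \in U]/(_ \in pred_of_vspace U) Quotient.idealrBE.
by split=> [/eqP|/eqP].
Qed.

Let prD u v : pr (u + v) = pr u + pr v.
Proof. exact: raddfD. Qed.

Let prK (x : vquot) : pr (repr x) = x.
Proof. exact: reprK. Qed.

Definition vquot_scale (a : K) (x : vquot) : vquot := pr (a *: repr x).

Let pr_scale a v : vquot_scale a (pr v) = pr (a *: v).
Proof.
apply/pr_eq; rewrite -scalerBr; apply: memvZ.
by apply/pr_eq; rewrite prK.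
Qed.

Fact vquot_scaleA a b x :
  vquot_scale a (vquot_scale b x) = vquot_scale (a * b) x.
Proof. by rewrite -[x]prK !pr_scale scalerA. Qed.
Fact vquot_scale1 : left_id 1 vquot_scale.
Proof. by move=> x; rewrite -[x]prK !pr_scale scale1r. Qed.
Fact vquot_scaleDr : right_distributive vquot_scale +%R.
Proof. by move=> a x y; rewrite -[x]prK -[y]prK -prD !pr_scale scalerDr prD. Qed.
Fact vquot_scaleDl x : {morph vquot_scale^~ x : a b / a + b}.
Proof. by move=> a b; rewrite -[x]prK !pr_scale scalerDl prD. Qed.
HB.instance Definition _ := GRing.Zmodule_isLmodule.Build K vquot
  vquot_scaleA vquot_scale1 vquot_scaleDr vquot_scaleDl.

Fact vproj_linear : linear pr.
Proof. by move=> a u v; rewrite prD -pr_scale. Qed.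

Fact vquot_spans : exists m (g : 'I_m -> vquot), spans g.
Proof.
exists (\dim {:V}), (fun i => pr (vbasis {:V})`_i) => x.
exists (fun i => coord (vbasis {:V}) i (repr x)).
rewrite -{1}[x]prK {1}(coord_vbasis (memvf (repr x))).
elim/big_rec2: _ => [|i y z _ <-]; first exact: (raddf0 \pi_(vquot)).
by rewrite prD -pr_scale.
Qed.
HB.instance Definition _ := Lmodule_hasFinDim.Build K vquot
  (projT2 (spans_vector_axiom vquot_spans)).

HB.instance Definition _ := GRing.isLinear.Build K V vquot _ pr vproj_linear.
Definition vproj : 'Hom(V, vquot) := linfun pr.

Lemma vproj_eq0 v : (vproj v == 0) = (v \in U).
Proof.
rewrite lfunE /= -[v in RHS]subr0; apply/eqP/idP; last first.
  by move=> /pr_eq ->; exact: (raddf0 pr).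
by move=> e; apply/pr_eq; rewrite e; apply/esym/(raddf0 pr).
Qed.

Lemma vproj_surj (x : vquot) : exists v, vproj v = x.
Proof. by exists (repr x); rewrite lfunE /= prK. Qed.

End VectorQuotient.
Arguments vproj {K V} U.

(* Induced map V / U -> V' / U'.  The value is the expected one as soon as f
   sends U into U' (vquot_mapE); _^-1 is a linear section of vproj U. *)
Definition vquot_map (K : fieldType) (V V' : vectType K) (f : 'Hom(V, V'))
    (U : {vspace V}) (U' : {vspace V'}) : 'Hom(vquot U, vquot U') :=
  (vproj U' \o f \o (vproj U)^-1)%VF.

Lemma vquot_mapE (K : fieldType) (V V' : vectType K) (f : 'Hom(V, V'))
    (U : {vspace V}) (U' : {vspace V'}) :
  (f @: U <= U')%VS -> forall v, vquot_map f U U' (vproj U v) = vproj U' (f v).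
Proof.
move=> fU v; rewrite !comp_lfunE; apply/eqP.
rewrite -subr_eq0 -!linearB vproj_eq0 /=.
apply: (subvP fU); apply: memv_img; rewrite -vproj_eq0 linearB /=.
rewrite limg_lfunVK ?subrr //.
exact: memv_img (memvf v).
Qed.

Definition finitely_generated (H : zmodType) :=
  exists m (g : 'I_m -> H), forall x, exists a : 'I_m -> int,
    x = \sum_i g i *~ a i.

HB.mixin Record isFinGen H of GRing.Zmodule H := {
  fingenP : finitely_generated H
}.
#[short(type="fgZmodType")]
HB.structure Definition FgZmodule := {H of GRing.Zmodule H & isFinGen H}.

HB.instance Definition _ (A B : zmodType) :=
  gen_eqMixin {additive A -> B}.
HB.instance Definition _ (A B : zmodType) :=
  gen_choiceMixin {additive A -> B}.

Section AdditiveZmod.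
Variables A B : zmodType.
Implicit Types f g h : {additive A -> B}.

Lemma additiveP f g : f =1 g -> f = g.
Proof.
case: f g => [f [[mf]]] [g [[mg]]] /= fg.
have {}fg : f = g by apply: funext.
by move: mf mg; rewrite fg => mf mg; rewrite (Prop_irrelevance mf mg).
Qed.

Definition add_addf f g : {additive A -> B} := f \+ g.
Definition add_oppf f : {additive A -> B} := \- f.
Definition add_zerof : {additive A -> B} := \0.

Fact add_addfA : associative add_addf.
Proof. by move=> f g h; apply: additiveP => x /=; rewrite addrA. Qed.
Fact add_addfC : commutative add_addf.
Proof. by move=> f g; apply: additiveP => x /=; rewrite addrC. Qed.
Fact add_add0f : left_id add_zerof add_addf.
Proof. by move=> f; apply: additiveP => x /=; rewrite add0r. Qed.
Fact add_addNf : left_inverse add_zerof add_oppf add_addf.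
Proof. by move=> f; apply: additiveP => x /=; rewrite addNr. Qed.
HB.instance Definition _ := GRing.isZmodule.Build {additive A -> B}
  add_addfA add_addfC add_add0f add_addNf.

End AdditiveZmod.

(* The tensor product K (x)_Z H: the abelian group generated by the symbols
   a (x) x, modulo biadditivity.  A formal sum of symbols is a list, and
   tens_eq is the congruence generated by the relations. *)

Section Tensor.
Variables (K : fieldType) (H : fgZmodType).

Inductive tens_eq : seq (K * H) -> seq (K * H) -> Prop :=
| tens_refl s : tens_eq s s
| tens_sym s t : tens_eq s t -> tens_eq t s
| tens_trans s t u : tens_eq s t -> tens_eq t u -> tens_eq s u
| tens_cat s s' t t' :
    tens_eq s s' -> tens_eq t t' -> tens_eq (s ++ t) (s' ++ t')
| tens_comm s t : tens_eq (s ++ t) (t ++ s)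
| tens_zero x : tens_eq [:: (0, x)] [::]
| tens_addl a b x : tens_eq [:: (a + b, x)] [:: (a, x); (b, x)]
| tens_addr a x y : tens_eq [:: (a, x + y)] [:: (a, x); (a, y)].

Definition tens_rel s t := `[< tens_eq s t >].

Fact tens_rel_equiv : equiv_class_of tens_rel.
Proof.
split=> [s|s t|t s u].
- exact/asboolP/tens_refl.
- by apply/asboolP/asboolP; exact: tens_sym.
- by move=> /asboolP st /asboolP tu; apply/asboolP/(tens_trans st tu).
Qed.
Canonical tens_rel_equiv_rel := EquivRelPack tens_rel_equiv.

Definition tens := {eq_quot tens_rel}.
HB.instance Definition _ := Choice.on tens.

Definition tsum (s : seq (K * H)) : tens := \pi_({eq_quot tens_rel}) s.
Definition tpure (a : K) (x : H) : tens := tsum [:: (a, x)].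

Lemma tsum_eq s t : (tsum s = tsum t) <-> tens_eq s t.
Proof. by split=> [/eqquotP/asboolP|st]; last exact/eqquotP/asboolP. Qed.

Lemma tsum_repr (x : tens) : tsum (repr x) = x.
Proof. exact: reprK. Qed.

Let rep s : tens_eq (repr (tsum s)) s.
Proof. by apply/tsum_eq; rewrite tsum_repr. Qed.

Definition tscale_seq (a : K) (s : seq (K * H)) :=
  [seq (a * p.1, p.2) | p <- s].

Let scale_eq a s t : tens_eq s t -> tens_eq (tscale_seq a s) (tscale_seq a t).
Proof.
elim=> {s t} [s|s t _|s t u _ st _|s s' t t' _ IHs _ IHt|s t|x|b c x|b x y].
- exact: tens_refl.
- exact: tens_sym.
- exact: tens_trans.
- by rewrite /tscale_seq !map_cat; apply: tens_cat.
- by rewrite /tscale_seq !map_cat; apply: tens_comm.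
- by rewrite /tscale_seq /= mulr0; apply: tens_zero.
- by rewrite /tscale_seq /= mulrDr; apply: tens_addl.
- exact: tens_addr.
Qed.

Definition tzero : tens := tsum [::].
Definition tadd (x y : tens) : tens := tsum (repr x ++ repr y).
Definition tscale a (x : tens) : tens := tsum (tscale_seq a (repr x)).
Definition topp (x : tens) : tens := tscale (-1) x.

Let taddE s t : tadd (tsum s) (tsum t) = tsum (s ++ t).
Proof. by apply/tsum_eq/tens_cat; exact: rep. Qed.

Let tscaleE a s : tscale a (tsum s) = tsum (tscale_seq a s).
Proof. exact/tsum_eq/scale_eq/rep. Qed.

Fact taddA : associative tadd.
Proof.
by move=> x y z; rewrite -[x]tsum_repr -[y]tsum_repr -[z]tsum_repr !taddE catA.
Qed.
Fact taddC : commutative tadd.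
Proof.
by move=> x y; rewrite -[x]tsum_repr -[y]tsum_repr !taddE; exact/tsum_eq/tens_comm.
Qed.
Fact tadd0 : left_id tzero tadd.
Proof. by move=> x; rewrite -[x]tsum_repr taddE. Qed.

Let tscaleDl a b x : tscale (a + b) x = tadd (tscale a x) (tscale b x).
Proof.
rewrite -[x]tsum_repr !tscaleE taddE; apply/tsum_eq.
elim: (repr x) => [|[c y] s IHs] /=; first exact: tens_refl.
rewrite -cat1s mulrDl.
apply: (tens_trans (tens_cat (tens_addl _ _ _) IHs)).
apply: (@tens_cat [:: _] [:: _]); first exact: tens_refl.
rewrite -cat1s catA -[X in tens_eq _ (_ ++ X)]cat1s catA.
apply: tens_cat (tens_refl _); exact: tens_comm.
Qed.
Let tscale0 x : tscale 0 x = tzero.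
Proof.
rewrite -[x]tsum_repr !tscaleE; apply/tsum_eq.
elim: (repr x) => [|[c y] s IHs] /=; first exact: tens_refl.
by rewrite mul0r; apply: (@tens_cat [:: _] [::]) IHs; exact: tens_zero.
Qed.

Let tscale1 : left_id 1 tscale.
Proof.
move=> x; rewrite -[x]tsum_repr tscaleE; congr tsum.
by rewrite -[RHS]map_id; apply: eq_map => -[a y]; rewrite mul1r.
Qed.

Fact taddN : left_inverse tzero topp tadd.
Proof. by move=> x; rewrite -{2}[x]tscale1 -tscaleDl addNr tscale0. Qed.
HB.instance Definition _ := GRing.isZmodule.Build tens taddA taddC tadd0 taddN.

Fact tscaleA a b x : tscale a (tscale b x) = tscale (a * b) x.
Proof.
rewrite -[x]tsum_repr !tscaleE /tscale_seq -map_comp; congr tsum.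
by apply: eq_map => -[c y] /=; rewrite mulrA.
Qed.
Fact tscaleDr : right_distributive tscale +%R.
Proof.
move=> a x y; rewrite -[x]tsum_repr -[y]tsum_repr [X in tscale _ X]taddE.
by rewrite !tscaleE [RHS]taddE /tscale_seq map_cat.
Qed.
HB.instance Definition _ := GRing.Zmodule_isLmodule.Build K tens
  tscaleA tscale1 tscaleDr (fun x a b => tscaleDl a b x).

Lemma tsum_cat s t : tsum (s ++ t) = tsum s + tsum t.
Proof. by rewrite [RHS]taddE. Qed.

Lemma tsumE s : tsum s = \sum_(p <- s) tpure p.1 p.2.
Proof.
elim: s => [|[a x] s IHs]; first by rewrite big_nil.
by rewrite big_cons -IHs -cat1s tsum_cat.
Qed.

Lemma tpureDl a b x : tpure (a + b) x = tpure a x + tpure b x.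
Proof. by rewrite -tsum_cat; exact/tsum_eq/tens_addl. Qed.

Lemma tpureDr a x y : tpure a (x + y) = tpure a x + tpure a y.
Proof. by rewrite -tsum_cat; exact/tsum_eq/tens_addr. Qed.

Lemma tpureZ a b x : a *: tpure b x = tpure (a * b) x.
Proof. by rewrite [LHS]tscaleE. Qed.

Lemma tpureB a x y : tpure a (x - y) = tpure a x - tpure a y.
Proof. by apply/eqP; rewrite -subr_eq opprK -tpureDr subrK. Qed.

Definition tcan (x : H) : tens := tpure 1 x.
Fact tcan_zmod_morphism : zmod_morphism tcan.
Proof. by move=> x y; rewrite /tcan tpureB. Qed.
HB.instance Definition _ :=
  GRing.isZmodMorphism.Build H tens tcan tcan_zmod_morphism.

Fact tens_spans : exists m (g : 'I_m -> tens), spans g.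
Proof.
have [m [g gH]] := @fingenP H.
exists m, (fun i => tcan (g i)) => x; rewrite -[x]tsum_repr.
elim: (repr x) => [|[a y] s [b bE]].
  by exists (fun=> 0); rewrite big1 // => i _; rewrite scale0r.
have [c yE] := gH y.
exists (fun i => a * (c i)%:~R + b i).
rewrite -cat1s tsum_cat bE; under [RHS]eq_bigr do rewrite scalerDl.
rewrite big_split; congr (_ + _).
rewrite -/(tpure a y) -[a]mulr1 -tpureZ -/(tcan y) yE raddf_sum scaler_sumr.
apply: eq_bigr => i _; rewrite raddfMz mulr1.
by rewrite -scalerA scaler_int.
Qed.
HB.instance Definition _ := Lmodule_hasFinDim.Build K tens
  (projT2 (spans_vector_axiom tens_spans)).

Definition tlift (M : zmodType) (b : K -> H -> M) (x : tens) : M :=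
  \sum_(p <- repr x) b p.1 p.2.

Lemma tliftE (M : zmodType) (b : K -> H -> M) :
  (forall a a' x, b (a + a') x = b a x + b a' x) ->
  (forall a x y, b a (x + y) = b a x + b a y) ->
  forall s, tlift b (tsum s) = \sum_(p <- s) b p.1 p.2.
Proof.
move=> bDl bDr s; rewrite /tlift.
have b0 x : b 0 x = 0.
  by apply: (addrI (b 0 x)); rewrite -bDl !addr0.
suff eq_sum t u : tens_eq t u ->
    \sum_(p <- t) b p.1 p.2 = \sum_(p <- u) b p.1 p.2 by exact/eq_sum/rep.
elim=> {t u} [t|t u _ ->|t u v _ -> _ ->|t t' u u' _ IHt _ IHu|t u|x|a a' x|a x y] //.
- by rewrite !big_cat IHt IHu.
- by rewrite !big_cat /= addrC.
- by rewrite big_seq1 big_nil b0.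
- by rewrite big_seq1 big_cons big_seq1 bDl.
- by rewrite big_seq1 big_cons big_seq1 bDr.
Qed.

End Tensor.

Section TensorMap.
Variables (K : fieldType) (H H' : fgZmodType) (f : {additive H -> H'}).

Definition tmap_fun : tens K H -> tens K H' :=
  tlift (fun a x => tpure a (f x)).

Lemma tmap_funE s :
  tmap_fun (tsum s) = \sum_(p <- s) tpure p.1 (f p.2).
Proof.
by apply: tliftE => [a a' x|a x y]; rewrite (tpureDl, raddfD) ?tpureDr.
Qed.

Fact tmap_linear : linear tmap_fun.
Proof.
move=> a x y; rewrite -[x]tsum_repr -[y]tsum_repr.
have -> : a *: tsum (repr x) = tsum (tscale_seq a (repr x)).
  rewrite !tsumE scaler_sumr big_map; apply: eq_bigr => p _.
  by rewrite tpureZ.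
rewrite -tsum_cat !tmap_funE big_cat big_map scaler_sumr; congr (_ + _).
by apply: eq_bigr => p _; rewrite tpureZ.
Qed.
HB.instance Definition _ := GRing.isLinear.Build K (tens K H) (tens K H') _
  tmap_fun tmap_linear.

Definition tmap : 'Hom(tens K H, tens K H') := linfun tmap_fun.

Lemma tmapE a x : tmap (tpure a x) = tpure a (f x).
Proof. by rewrite lfunE /= /tpure tmap_funE big_seq1. Qed.

Lemma tmap_can x : tmap (tcan K x) = tcan K (f x).
Proof. exact: tmapE. Qed.

End TensorMap.
Arguments tmap K {H H'} f.

Lemma tens_lfunP (K : fieldType) (H : fgZmodType) (V : vectType K)
    (f g : 'Hom(tens K H, V)) : (forall x, f (tcan K x) = g (tcan K x)) -> f = g.
Proof.
move=> fg; apply/lfunP => x; rewrite -[x]tsum_repr tsumE !linear_sum.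
apply: eq_bigr => -[a y] _ /=.
by rewrite -[a]mulr1 -tpureZ !linearZ /= fg.
Qed.

Section TensorMapTheory.
Variables (K : fieldType) (H H' H'' : fgZmodType).
Implicit Types f g : {additive H -> H'}.

Lemma tmap_id : tmap K (idfun : {additive H -> H}) = \1%VF.
Proof. by apply: tens_lfunP => x; rewrite tmap_can lfunE. Qed.

Lemma tmap_comp (g : {additive H' -> H''}) f :
  tmap K (g \o f : {additive H -> H''}) = (tmap K g \o tmap K f)%VF.
Proof. by apply: tens_lfunP => x; rewrite comp_lfunE !tmap_can. Qed.

Lemma tmap0 : tmap K (0 : {additive H -> H'}) = 0.
Proof.
by apply: tens_lfunP => x; rewrite tmap_can zero_lfunE raddf0.
Qed.

Lemma tmapN f : tmap K (- f) = - tmap K f.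
Proof. by apply: tens_lfunP => x; rewrite opp_lfunE !tmap_can raddfN. Qed.

Lemma tmapD f g : tmap K (f + g) = tmap K f + tmap K g.
Proof. by apply: tens_lfunP => x; rewrite add_lfunE !tmap_can raddfD. Qed.

End TensorMapTheory.

(* s (x) id : K (x) H -> L (x) H, for a field embedding s *)
Definition tcoef (K L : fieldType) (s : {rmorphism K -> L}) (H : fgZmodType) :
  tens K H -> tens L H := tlift (fun a x => tpure (s a) x).

Lemma tcoefE (K L : fieldType) (s : {rmorphism K -> L}) (H : fgZmodType) a x :
  tcoef s (tpure a x) = tpure (s a) x :> tens L H.
Proof.
rewrite /tcoef tliftE ?big_seq1 // => [b c y|b y z].
  by rewrite rmorphD tpureDl.
by rewrite tpureDr.
Qed.

(* The L-span of the image of U under s (x) id. *)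
Definition vcoef (K L : fieldType) (s : {rmorphism K -> L}) (H : fgZmodType)
    (U : {vspace tens K H}) : {vspace tens L H} :=
  <<[seq tcoef s u | u <- vbasis U]>>%VS.

#[local] Obligation Tactic := idtac.

Definition Cplx (R : realType) : numClosedFieldType := R[i].

Section MixedHodge.
Variable R : realType.
Local Notation C := (Cplx R).

Record filtered := Filtered {
  fil_ab :> fgZmodType;
  fil_W : int -> {vspace tens rat fil_ab};
  fil_F : int -> {vspace tens C fil_ab} }.

Section Filtered.
Variable H : filtered.
Local Notation HC := (tens C H).

Definition WC (k : int) : {vspace HC} := vcoef ratr (fil_W H k).
(* Complex conjugation acts on H_C = C (x) H through the first factor. *)
Definition Fbar (p : int) : {vspace HC} := vcoef Num.conj (fil_F H p).

(* Gr^W_k of H_C and the filtrations induced on it by F and Fbar, as subspaces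
   of H_C / W_(k-1). *)
Definition gr (k : int) (U : {vspace HC}) : {vspace vquot (WC (k - 1))} :=
  (vproj (WC (k - 1)) @: (U :&: WC k))%VS.
Definition GrW (k : int) := gr k fullv.
Definition GrF (p k : int) := gr k (fil_F H p).
Definition GrFbar (q k : int) := gr k (Fbar q).

Definition hodge_comp (p q : int) := (GrF p (p + q) :&: GrFbar q (p + q))%VS.

Definition hodge_type (p q : int) := hodge_comp p q != 0%VS.

(* mhs_pure: F induces on Gr^W_k a pure Hodge structure of weight k, that is,
   Gr^W_k is the direct sum of F^p and of the conjugate of F^(k+1-p). *)
Record is_mhs : Prop := IsMhs {
  mhs_Wincr : forall k l : int, k <= l -> (fil_W H k <= fil_W H l)%VS;
  mhs_W0 : exists k, fil_W H k = 0%VS;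
  mhs_WT : exists k, fil_W H k = fullv;
  mhs_Fdecr : forall p q : int, p <= q -> (fil_F H q <= fil_F H p)%VS;
  mhs_FT : exists p, fil_F H p = fullv;
  mhs_F0 : exists p, fil_F H p = 0%VS;
  mhs_pure : forall k p : int,
    (GrF p k + GrFbar (k + 1 - p) k)%VS = GrW k /\
    (GrF p k :&: GrFbar (k + 1 - p) k)%VS = 0%VS }.

Definition level_le (n : nat) :=
  forall p q : int, hodge_type p q -> 0 <= p <= n%:Z /\ 0 <= q <= n%:Z.

End Filtered.

Record mhs (n : nat) := Mhs {
  mhs_fil :> filtered;
  mhsP : is_mhs mhs_fil;
  mhs_level : level_le mhs_fil n }.

Section MhsCategory.
Variable n : nat.
Implicit Types X Y Z : mhs n.

Definition mhs_compat X Y (f : {additive X -> Y}) :=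
  (forall (k : int) x, x \in fil_W X k -> tmap rat f x \in fil_W Y k) /\
  (forall (p : int) x, x \in fil_F X p -> tmap C f x \in fil_F Y p).

Record mhs_hom X Y := MhsHom {
  mhs_add :> {additive X -> Y};
  mhs_addP : mhs_compat mhs_add }.

Lemma mhs_homP X Y (f g : mhs_hom X Y) : mhs_add f = mhs_add g -> f = g.
Proof.
by case: f g => [f fP] [g gP] /= fg; rewrite -fg in gP *; congr MhsHom; exact: Prop_irrelevance.
Qed.

HB.instance Definition _ X Y := gen_eqMixin (mhs_hom X Y).
HB.instance Definition _ X Y := gen_choiceMixin (mhs_hom X Y).

Fact mhs_compat0 X Y : mhs_compat (0 : {additive X -> Y}).
Proof. by split=> k x _; rewrite tmap0 lfunE mem0v. Qed.
Fact mhs_compatN X Y (f : mhs_hom X Y) : mhs_compat (- mhs_add f).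
Proof.
case: f => f [fW fF].
by split=> k x xk; rewrite tmapN lfunE /= memvN; [exact: fW|exact: fF].
Qed.
Fact mhs_compatD X Y (f g : mhs_hom X Y) :
  mhs_compat (mhs_add f + mhs_add g).
Proof.
case: f g => f [fW fF] [g [gW gF]].
by split=> k x xk; rewrite tmapD lfunE /=; apply: memvD;
  [exact: fW|exact: gW|exact: fF|exact: gF].
Qed.
Fact mhs_compat_id X : mhs_compat (idfun : {additive X -> X}).
Proof. by split=> k x; rewrite tmap_id lfunE. Qed.
Fact mhs_compat_comp X Y Z (g : mhs_hom Y Z) (f : mhs_hom X Y) :
  mhs_compat (mhs_add g \o mhs_add f : {additive X -> Z}).
Proof.
case: g f => g [gW gF] [f [fW fF]].
by split=> k x xk; rewrite tmap_comp lfunE /=;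
  [exact/gW/fW|exact/gF/fF].
Qed.

Definition mhs_plus X Y (f g : mhs_hom X Y) := MhsHom (mhs_compatD f g).
Definition mhs_opp X Y (f : mhs_hom X Y) := MhsHom (mhs_compatN f).
Definition mhs_zero X Y := MhsHom (mhs_compat0 X Y).

Fact mhs_plusA X Y : associative (@mhs_plus X Y).
Proof. by move=> f g h; apply: mhs_homP; exact: addrA. Qed.
Fact mhs_plusC X Y : commutative (@mhs_plus X Y).
Proof. by move=> f g; apply: mhs_homP; exact: addrC. Qed.
Fact mhs_plus0 X Y : left_id (mhs_zero X Y) (@mhs_plus X Y).
Proof. by move=> f; apply: mhs_homP; exact: add0r. Qed.
Fact mhs_plusN X Y : left_inverse (mhs_zero X Y) (@mhs_opp X Y) (@mhs_plus X Y).
Proof. by move=> f; apply: mhs_homP; exact: addNr. Qed.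
HB.instance Definition _ X Y := GRing.isZmodule.Build (mhs_hom X Y)
  (@mhs_plusA X Y) (@mhs_plusC X Y) (@mhs_plus0 X Y) (@mhs_plusN X Y).

Definition mhs_id X : mhs_hom X X := MhsHom (mhs_compat_id X).
Definition mhs_comp X Y Z (g : mhs_hom Y Z) (f : mhs_hom X Y) : mhs_hom X Z :=
  MhsHom (mhs_compat_comp g f).

Program Definition MHS : preadditive :=
  @Preadditive (mhs n) (fun X Y => mhs_hom X Y) mhs_id mhs_comp _ _ _ _ _.
Next Obligation. by move=> *; apply/mhs_homP/additiveP. Qed.
Next Obligation. by move=> *; apply/mhs_homP/additiveP. Qed.
Next Obligation. by move=> *; apply/mhs_homP/additiveP. Qed.
Next Obligation. by move=> *; apply/mhs_homP/additiveP. Qed.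
Next Obligation.
by move=> *; apply/mhs_homP/additiveP => x /=; rewrite raddfD.
Qed.

End MhsCategory.

Section FormalGroups.

Record formal_group := FormalGroup {
  fg_o : vectType C;
  fg_et : fgZmodType }.

Definition fg_hom (X Y : formal_group) : zmodType :=
  ('Hom(fg_o X, fg_o Y) * {additive fg_et X -> fg_et Y})%type.

Program Definition FormalGroups : preadditive :=
  @Preadditive formal_group fg_hom
    (fun X => (\1%VF, idfun : {additive fg_et X -> fg_et X}))
    (fun X Y Z g f =>
       ((g.1 \o f.1)%VF, g.2 \o f.2 : {additive fg_et X -> fg_et Z}))
    _ _ _ _ _.
Next Obligation.
by move=> *; congr pair; [exact: comp_lfunA|exact: additiveP].
Qed.
Next Obligation.
by move=> A B [f g]; congr pair; [exact: comp_lfun1l|exact: additiveP].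
Qed.
Next Obligation.
by move=> A B [f g]; congr pair; [exact: comp_lfun1r|exact: additiveP].
Qed.
Next Obligation.
by move=> *; congr pair; [exact: comp_lfunDl|exact: additiveP].
Qed.
Next Obligation.
move=> *; congr pair; first exact: comp_lfunDr.
by apply: additiveP => x /=; rewrite raddfD.
Qed.

End FormalGroups.

Section FormalHodge.
Variable n : nat.

Record idx := Idx { idx_val :> nat; idxP : (0 < idx_val <= n)%N }.

Record vec := Vec {
  vec_sp :> idx -> vectType C;
  vec_map : forall i j : idx, j = i.+1 :> nat -> 'Hom(vec_sp j, vec_sp i) }.

Section VecCategory.
Implicit Types V W : vec.

Record vec_hom V W := VecHom {
  vec_lin :> forall i, 'Hom(V i, W i);
  vec_linP : forall (i j : idx) (e : j = i.+1 :> nat),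
    (vec_lin i \o vec_map V e = vec_map W e \o vec_lin j)%VF }.

Lemma vec_homP V W (f g : vec_hom V W) : (forall i, f i = g i) -> f = g.
Proof.
case: f g => [f fP] [g gP] /= fg.
have {}fg : f = g by exact: functional_extensionality_dep.
by rewrite -fg in gP *; congr VecHom; exact: Prop_irrelevance.
Qed.

HB.instance Definition _ V W := gen_eqMixin (vec_hom V W).
HB.instance Definition _ V W := gen_choiceMixin (vec_hom V W).

Program Definition vec_plus V W (f g : vec_hom V W) :=
  @VecHom V W (fun i => f i + g i) _.
Next Obligation.
by move=> V W f g i j e; rewrite comp_lfunDl comp_lfunDr !vec_linP.
Qed.
Program Definition vec_opp V W (f : vec_hom V W) :=
  @VecHom V W (fun i => - f i) _.
Next Obligation.
by move=> V W f i j e; rewrite comp_lfunNl comp_lfunNr vec_linP.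
Qed.
Program Definition vec_zero V W := @VecHom V W (fun i => 0) _.
Next Obligation.
by move=> V W i j e; rewrite comp_lfun0l comp_lfun0r.
Qed.

Fact vec_plusA V W : associative (@vec_plus V W).
Proof. by move=> f g h; apply: vec_homP => i; exact: addrA. Qed.
Fact vec_plusC V W : commutative (@vec_plus V W).
Proof. by move=> f g; apply: vec_homP => i; exact: addrC. Qed.
Fact vec_plus0 V W : left_id (vec_zero V W) (@vec_plus V W).
Proof. by move=> f; apply: vec_homP => i; exact: add0r. Qed.
Fact vec_plusN V W : left_inverse (vec_zero V W) (@vec_opp V W) (@vec_plus V W).
Proof. by move=> f; apply: vec_homP => i; exact: addNr. Qed.
HB.instance Definition _ V W := GRing.isZmodule.Build (vec_hom V W)
  (@vec_plusA V W) (@vec_plusC V W) (@vec_plus0 V W) (@vec_plusN V W).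

Program Definition vec_id V := @VecHom V V (fun i => \1%VF) _.
Next Obligation. by move=> V i j e; rewrite comp_lfun1l comp_lfun1r. Qed.
Program Definition vec_comp U V W (g : vec_hom V W) (f : vec_hom U V) :=
  @VecHom U W (fun i => g i \o f i)%VF _.
Next Obligation.
move=> U V W g f i j e.
by rewrite -comp_lfunA vec_linP comp_lfunA vec_linP comp_lfunA.
Qed.

Program Definition VecCat : preadditive :=
  @Preadditive vec (fun V W => vec_hom V W) vec_id vec_comp _ _ _ _ _.
Next Obligation. by move=> *; apply: vec_homP => i; exact: comp_lfunA. Qed.
Next Obligation. by move=> *; apply: vec_homP => i; exact: comp_lfun1l. Qed.
Next Obligation. by move=> *; apply: vec_homP => i; exact: comp_lfun1r. Qed.
Next Obligation. by move=> *; apply: vec_homP => i; exact: comp_lfunDl. Qed.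
Next Obligation. by move=> *; apply: vec_homP => i; exact: comp_lfunDr. Qed.

End VecCategory.

Hypothesis n_gt0 : (0 < n)%N.

Fact top_idx_subproof : (0 < n <= n)%N.
Proof. by rewrite n_gt0 leqnn. Qed.
Definition top_idx : idx := Idx top_idx_subproof.

Definition quoF (X : mhs n) (i : int) : vectType C := vquot (fil_F X i).

(* The canonical projection when i <= j; not meaningful otherwise. *)
Definition quoF_proj (X : mhs n) (i j : int) : 'Hom(quoF X j, quoF X i) :=
  vquot_map \1%VF (fil_F X j) (fil_F X i).

Definition quoF_map (X Y : mhs n) (f : mhs_hom X Y) (i : int) :
    'Hom(quoF X i, quoF Y i) :=
  vquot_map (tmap C f) (fil_F X i) (fil_F Y i).

Definition quoF_can (X : mhs n) (i : int) (x : X) : quoF X i :=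
  vproj (fil_F X i) (tcan C x).

(* The augmentation H -> V_n is (fhs_ho, fhs_het); no condition relates fhs_ho
   and fhs_pi. *)
Record fhs := Fhs {
  fhs_o : vectType C;
  fhs_et : mhs n;
  fhs_vec : vec;
  fhs_pi : forall i : idx, 'Hom(fhs_vec i, quoF fhs_et i);
  fhs_piP : forall (i j : idx) (e : j = i.+1 :> nat),
    (fhs_pi i \o vec_map fhs_vec e = quoF_proj fhs_et i j \o fhs_pi j)%VF;
  fhs_ho : 'Hom(fhs_o, fhs_vec top_idx);
  fhs_het : {additive fhs_et -> fhs_vec top_idx};
  fhs_hetP : forall x, fhs_pi top_idx (fhs_het x) = quoF_can n x }.

Implicit Types X Y Z : fhs.

Record fhs_hom X Y := FhsHom {
  fhs_fo : 'Hom(fhs_o X, fhs_o Y);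
  fhs_fet : mhs_hom (fhs_et X) (fhs_et Y);
  fhs_phi : vec_hom (fhs_vec X) (fhs_vec Y);
  fhs_phi_pi : forall i : idx,
    (fhs_pi Y i \o fhs_phi i = quoF_map fhs_fet i \o fhs_pi X i)%VF;
  fhs_phi_ho : (fhs_phi top_idx \o fhs_ho X = fhs_ho Y \o fhs_fo)%VF;
  fhs_phi_het : forall x, fhs_phi top_idx (fhs_het X x) = fhs_het Y (fhs_fet x) }.

Lemma fhs_homP X Y (f g : fhs_hom X Y) :
  fhs_fo f = fhs_fo g -> fhs_fet f = fhs_fet g -> fhs_phi f = fhs_phi g -> f = g.
Proof.
case: f g => [f1 f2 f3 fP fQ fS] [g1 g2 g3 gP gQ gS] /= e1 e2 e3.
by subst g1 g2 g3; congr FhsHom; exact: Prop_irrelevance.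
Qed.

HB.instance Definition _ X Y := gen_eqMixin (fhs_hom X Y).
HB.instance Definition _ X Y := gen_choiceMixin (fhs_hom X Y).

Lemma quoF_mapE (X Y : mhs n) (f : mhs_hom X Y) i v :
  quoF_map f i (vproj (fil_F X i) v) = vproj (fil_F Y i) (tmap C f v).
Proof.
apply: vquot_mapE; apply/subvP => _ /memv_imgP[x xF ->].
by case: f => f [fW fF]; exact: fF.
Qed.

Lemma vquot_lfunP (K : fieldType) (V W : vectType K) (U : {vspace V})
    (f g : 'Hom(vquot U, W)) :
  (forall v, f (vproj U v) = g (vproj U v)) -> f = g.
Proof.
by move=> fg; apply/lfunP => x; have [v <-] := vproj_surj x.
Qed.

Lemma quoF_projE (X : mhs n) (i j : int) v : i <= j ->
  quoF_proj X i j (vproj (fil_F X j) v) = vproj (fil_F X i) v.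
Proof.
move=> ij; rewrite /quoF_proj vquot_mapE ?id_lfunE // lim1g.
exact: (mhs_Fdecr (mhsP X)).
Qed.

Lemma quoF_map0 (X Y : mhs n) i : quoF_map (0 : mhs_hom X Y) i = 0.
Proof.
by apply: vquot_lfunP => v; rewrite quoF_mapE tmap0 !zero_lfunE linear0.
Qed.
Lemma quoF_mapN (X Y : mhs n) (f : mhs_hom X Y) i :
  quoF_map (- f) i = - quoF_map f i.
Proof.
apply: vquot_lfunP => v.
by rewrite quoF_mapE tmapN !opp_lfunE quoF_mapE linearN.
Qed.
Lemma quoF_mapD (X Y : mhs n) (f g : mhs_hom X Y) i :
  quoF_map (f + g) i = quoF_map f i + quoF_map g i.
Proof.
apply: vquot_lfunP => v.
by rewrite quoF_mapE tmapD !add_lfunE !quoF_mapE linearD.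
Qed.
Lemma quoF_map_id (X : mhs n) i : quoF_map (mhs_id X) i = \1%VF.
Proof.
by apply: vquot_lfunP => v; rewrite quoF_mapE tmap_id !id_lfunE.
Qed.
Lemma quoF_map_comp (X Y Z : mhs n) (g : mhs_hom Y Z) (f : mhs_hom X Y) i :
  quoF_map (mhs_comp g f) i = (quoF_map g i \o quoF_map f i)%VF.
Proof.
apply: vquot_lfunP => v.
by rewrite [RHS]comp_lfunE !quoF_mapE tmap_comp [X in vproj _ X]comp_lfunE.
Qed.

Program Definition fhs_plus X Y (f g : fhs_hom X Y) : fhs_hom X Y :=
  @FhsHom X Y (fhs_fo f + fhs_fo g) (fhs_fet f + fhs_fet g)
    (fhs_phi f + fhs_phi g) _ _ _.
Next Obligation.
by move=> X Y f g i; rewrite quoF_mapD comp_lfunDl comp_lfunDr !fhs_phi_pi.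
Qed.
Next Obligation.
by move=> X Y f g; rewrite comp_lfunDl comp_lfunDr !fhs_phi_ho.
Qed.
Next Obligation.
by move=> X Y f g x; rewrite lfunE /= !fhs_phi_het raddfD.
Qed.

Program Definition fhs_opp X Y (f : fhs_hom X Y) : fhs_hom X Y :=
  @FhsHom X Y (- fhs_fo f) (- fhs_fet f) (- fhs_phi f) _ _ _.
Next Obligation.
by move=> X Y f i; rewrite quoF_mapN comp_lfunNl comp_lfunNr fhs_phi_pi.
Qed.
Next Obligation.
by move=> X Y f; rewrite comp_lfunNl comp_lfunNr fhs_phi_ho.
Qed.
Next Obligation.
by move=> X Y f x; rewrite lfunE /= fhs_phi_het raddfN.
Qed.

Program Definition fhs_zero X Y : fhs_hom X Y := @FhsHom X Y 0 0 0 _ _ _.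
Next Obligation.
by move=> X Y i; rewrite quoF_map0 comp_lfun0l comp_lfun0r.
Qed.
Next Obligation.
by move=> X Y; rewrite comp_lfun0l comp_lfun0r.
Qed.
Next Obligation.
by move=> X Y x; rewrite lfunE /= raddf0.
Qed.

Fact fhs_plusA X Y : associative (@fhs_plus X Y).
Proof. by move=> f g h; apply: fhs_homP; exact: addrA. Qed.
Fact fhs_plusC X Y : commutative (@fhs_plus X Y).
Proof. by move=> f g; apply: fhs_homP; exact: addrC. Qed.
Fact fhs_plus0 X Y : left_id (fhs_zero X Y) (@fhs_plus X Y).
Proof. by move=> f; apply: fhs_homP; exact: add0r. Qed.
Fact fhs_plusN X Y : left_inverse (fhs_zero X Y) (@fhs_opp X Y) (@fhs_plus X Y).
Proof. by move=> f; apply: fhs_homP; exact: addNr. Qed.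
HB.instance Definition _ X Y := GRing.isZmodule.Build (fhs_hom X Y)
  (@fhs_plusA X Y) (@fhs_plusC X Y) (@fhs_plus0 X Y) (@fhs_plusN X Y).

Program Definition fhs_id X : fhs_hom X X :=
  @FhsHom X X \1%VF (mhs_id _) (vec_id _) _ _ _.
Next Obligation. by move=> X i; rewrite quoF_map_id comp_lfun1l comp_lfun1r. Qed.
Next Obligation. by move=> X; rewrite comp_lfun1l comp_lfun1r. Qed.
Next Obligation. by move=> X x; rewrite lfunE. Qed.

Program Definition fhs_comp X Y Z (g : fhs_hom Y Z) (f : fhs_hom X Y) :
    fhs_hom X Z :=
  @FhsHom X Z (fhs_fo g \o fhs_fo f)%VF (mhs_comp (fhs_fet g) (fhs_fet f))
    (vec_comp (fhs_phi g) (fhs_phi f)) _ _ _.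
Next Obligation.
move=> X Y Z g f i.
by rewrite quoF_map_comp /= [LHS]comp_lfunA fhs_phi_pi -[LHS]comp_lfunA fhs_phi_pi
  [LHS]comp_lfunA.
Qed.
Next Obligation.
move=> X Y Z g f.
by rewrite /= -comp_lfunA fhs_phi_ho !comp_lfunA fhs_phi_ho.
Qed.
Next Obligation.
by move=> X Y Z g f x; rewrite /= comp_lfunE !fhs_phi_het.
Qed.

Program Definition FHS : preadditive :=
  @Preadditive fhs (fun X Y => fhs_hom X Y) fhs_id fhs_comp _ _ _ _ _.
Next Obligation.
move=> A B D E h g f; apply: fhs_homP => /=.
- exact: comp_lfunA.
- exact/mhs_homP/additiveP.
- by apply: vec_homP => i; exact: comp_lfunA.
Qed.
Next Obligation.
move=> A B f; apply: fhs_homP => /=.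
- exact: comp_lfun1l.
- exact/mhs_homP/additiveP.
- by apply: vec_homP => i; exact: comp_lfun1l.
Qed.
Next Obligation.
move=> A B f; apply: fhs_homP => /=.
- exact: comp_lfun1r.
- exact/mhs_homP/additiveP.
- by apply: vec_homP => i; exact: comp_lfun1r.
Qed.
Next Obligation.
move=> A B D g g' f; apply: fhs_homP => /=.
- exact: comp_lfunDl.
- exact/mhs_homP/additiveP.
- by apply: vec_homP => i; exact: comp_lfunDl.
Qed.
Next Obligation.
move=> A B D g f f'; apply: fhs_homP => /=.
- exact: comp_lfunDr.
- by apply/mhs_homP/additiveP => x /=; rewrite raddfD.
- by apply: vec_homP => i; exact: comp_lfunDr.
Qed.

Program Definition forget_group : functor FHS FormalGroups :=
  @Functor FHS FormalGroups
    (fun X => FormalGroup (fhs_o X) (fhs_et X))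
    (fun X Y f => (fhs_fo f, mhs_add (fhs_fet f))) _ _.
Next Obligation. by []. Qed.
Next Obligation. by []. Qed.

Program Definition forget_vec : functor FHS VecCat :=
  @Functor FHS VecCat fhs_vec (fun X Y f => fhs_phi f) _ _.
Next Obligation. by []. Qed.
Next Obligation. by []. Qed.

Section MhsEmbedding.

Definition mhs_vec (H : mhs n) : vec :=
  @Vec (fun i => quoF H i) (fun i j _ => quoF_proj H i j).

Fact quoF_can_zmod_morphism (H : mhs n) (i : int) :
  zmod_morphism (@quoF_can H i).
Proof. by move=> x y; rewrite /quoF_can !raddfB. Qed.
HB.instance Definition _ (H : mhs n) (i : int) :=
  GRing.isZmodMorphism.Build H (quoF H i) (@quoF_can H i)
    (@quoF_can_zmod_morphism H i).

Program Definition mhs_fhs (H : mhs n) : fhs :=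
  @Fhs 'rV[C]_0 H (mhs_vec H) (fun i => \1%VF) _ 0
    (@quoF_can H (top_idx : nat)) _.
Next Obligation. by move=> H i j e; rewrite comp_lfun1l comp_lfun1r. Qed.
Next Obligation. by move=> H x; rewrite lfunE. Qed.

Program Definition mhs_vec_hom (X Y : mhs n) (f : mhs_hom X Y) :
    vec_hom (mhs_vec X) (mhs_vec Y) :=
  @VecHom (mhs_vec X) (mhs_vec Y) (fun i => quoF_map f i) _.
Next Obligation.
move=> X Y f i j e /=.
have ij : (i : int) <= j by rewrite e lez_nat.
apply: vquot_lfunP => v; rewrite [LHS]comp_lfunE [RHS]comp_lfunE.
by rewrite quoF_mapE !quoF_projE // quoF_mapE.
Qed.

Program Definition mhs_fhs_hom (X Y : mhs n) (f : mhs_hom X Y) :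
    fhs_hom (mhs_fhs X) (mhs_fhs Y) :=
  @FhsHom (mhs_fhs X) (mhs_fhs Y) 0 f (mhs_vec_hom f) _ _ _.
Next Obligation. by move=> X Y f i; rewrite comp_lfun1l comp_lfun1r. Qed.
Next Obligation. by move=> X Y f; rewrite comp_lfun0l comp_lfun0r. Qed.
Next Obligation.
by move=> X Y f x; rewrite /= quoF_mapE tmap_can.
Qed.

Lemma rV0_lfunP (K : fieldType) (V : vectType K) (f g : 'Hom('rV[K]_0, V)) :
  f = g.
Proof. by apply/lfunP => x; rewrite [x]thinmx0 !linear0. Qed.

Program Definition mhs_embedding : functor (MHS n) FHS :=
  @Functor (MHS n) FHS mhs_fhs mhs_fhs_hom _ _.
Next Obligation.
move=> X; apply: fhs_homP => //=; first exact: rV0_lfunP.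
by apply: vec_homP => i; exact: quoF_map_id.
Qed.
Next Obligation.
move=> X Y Z g f; apply: fhs_homP => //=; first exact: rV0_lfunP.
by apply: vec_homP => i; exact: quoF_map_comp.
Qed.

End MhsEmbedding.

Section VecEmbedding.

Fact rV0_fingen : finitely_generated 'rV[int]_0.
Proof. by exists 0%N, (fun=> 0) => x; exists (fun=> 0); rewrite big_ord0 [x]thinmx0. Qed.
HB.instance Definition _ := isFinGen.Build 'rV[int]_0 rV0_fingen.

Lemma tens_rV0 (K : fieldType) (x : tens K 'rV[int]_0) : x = 0.
Proof.
rewrite -[x]tsum_repr tsumE big1 // => -[a y] _ /=.
by rewrite [y]thinmx0 -[a]mulr1 -tpureZ -/(tcan K _) raddf0 scaler0.
Qed.

Lemma vspace_rV0 (K : fieldType) (U U' : {vspace tens K 'rV[int]_0}) : U = U'.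
Proof. by apply/vspaceP => x; rewrite (tens_rV0 x) !mem0v. Qed.

Definition fil0 := @Filtered 'rV[int]_0 (fun=> 0%VS) (fun=> 0%VS).

Lemma gr0 k (U : {vspace tens C fil0}) : gr k U = 0%VS.
Proof. by rewrite /gr (vspace_rV0 (U :&: _)%VS 0%VS) limg0. Qed.

Fact fil0_mhs : is_mhs fil0.
Proof.
split=> [k l _|||p q _|||k p]; rewrite ?subvv //.
- by exists 0.
- by exists 0; exact: vspace_rV0.
- by exists 0; exact: vspace_rV0.
- by exists 0.
- by rewrite /GrF /GrFbar /GrW !gr0 addv0 cap0v.
Qed.

Fact fil0_level : level_le fil0 n.
Proof.
by move=> p q; rewrite /hodge_type /hodge_comp /GrF /GrFbar !gr0 cap0v eqxx.
Qed.

Definition mhs0 : mhs n := Mhs fil0_mhs fil0_level.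

Program Definition vec_fhs (V : vec) : fhs :=
  @Fhs 'rV[C]_0 mhs0 V (fun=> 0) _ 0 (0 : {additive mhs0 -> V top_idx}) _.
Next Obligation. by move=> V i j e; rewrite comp_lfun0l comp_lfun0r. Qed.
Next Obligation.
by move=> V x; rewrite lfunE /= [x]thinmx0 -[quoF_can n]/(quoF_can _) raddf0.
Qed.

Program Definition vec_fhs_hom (V W : vec) (f : vec_hom V W) :
    fhs_hom (vec_fhs V) (vec_fhs W) :=
  @FhsHom (vec_fhs V) (vec_fhs W) 0 0 f _ _ _.
Next Obligation. by move=> V W f i; rewrite comp_lfun0l comp_lfun0r. Qed.
Next Obligation. by move=> V W f; rewrite comp_lfun0l comp_lfun0r. Qed.
Next Obligation. by move=> V W f x; rewrite /= linear0. Qed.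

Lemma mhs0_homP (f g : mhs_hom mhs0 mhs0) : f = g.
Proof. by apply/mhs_homP/additiveP => x; rewrite [x]thinmx0 !raddf0. Qed.

Program Definition vec_embedding : functor VecCat FHS :=
  @Functor VecCat FHS vec_fhs vec_fhs_hom _ _.
Next Obligation.
move=> V; apply: fhs_homP => //=; [exact: rV0_lfunP|exact: mhs0_homP].
Qed.
Next Obligation.
move=> U V W g f; apply: fhs_homP => //=; [exact: rV0_lfunP|exact: mhs0_homP].
Qed.

End VecEmbedding.

End FormalHodge.
End MixedHodge.

(* Main.v *)
Require Import Defs.
From HB Require Import structures.
From mathcomp Require Import all_boot all_order all_algebra.
From mathcomp Require Import boolp reals.
From mathcomp Require Import zify.

(* The crux is that mixed Hodge structures form an abelian category whose
   morphisms are strict.  Write W, F, G for the weight filtration, the Hodge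
   filtration and its conjugate on H_C, and let U^b_l be the sum over i >= 0 of
   the G^(b-i) :&: W_(l-i).  Then W_l is the direct sum of F^a :&: W_l and U^b_l
   whenever a + b = l + 1, and both summands are functorial, which gives
   strictness for F at once and for W by descending induction on the Hodge index.
   Hence kernels and cokernels with the induced filtrations are mixed Hodge
   structures of the same level, and H |-> H_C / F^i is exact.

   Tensor products enter through two facts: K (x) - is exact in characteristic 0,
   because additive maps to a K-vector space extend along maps of finitely
   generated groups, and extension of scalars commutes with preimages.

   A formal Hodge structure is then treated componentwise (the groups H^o, H_et
   and the spaces V_i): a morphism is a kernel or cokernel iff it is one on each
   component.  The essential images are cut out by the conditions that H^o = 0
   and all pi_i are bijective, respectively that H = 0; both pass to
   kernels, cokernels and extensions by diagram chasing. *)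

Set Implicit Arguments.
Unset Strict Implicit.
Unset Printing Implicit Defensive.

Import Order.TTheory GRing.Theory Num.Theory.
Local Open Scope ring_scope.

(** * Finitely generated abelian groups *)

(** Purity is a condition on the quotients Gr^W_k, whereas kernels and cokernels are built on H_C
    itself. The obstacle is that a decomposition into F^p and its opposite holds only modulo
    W_(k-1), and the summands it gives for an element of ker f need not lie in ker f. The
    complements U^b_l turn opposedness modulo lower weights into an honest direct sum. They favour F
    over G, so an argument that needs both sides is run twice, with F and G exchanged. For this
    reason the linear algebra forgets the rational structure and conjugation. It concerns one
    increasing and two decreasing filtrations; the arithmetic re-enters only because base change
    commutes with images and preimages. The level is carried along as the vanishing of F^p and G^q
    against each other in Gr_(p+q), for (p,q) outside the square. Strictness is also what makes the
    pi_i of a kernel exist: the quotient by F^i of the kernel has to be the kernel of the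
    quotients. *)

Lemma additive_of (A B : zmodType) (u : A -> B) :
  zmod_morphism u -> exists v : {additive A -> B}, v =1 u.
Proof.
move=> uP; pose v : {additive A -> B} := HB.pack u (GRing.isZmodMorphism.Build A B u uP).
by exists v.
Qed.

Lemma additive_factor_inj (A B X : zmodType) (i : {additive A -> B}) (g : {additive X -> B}) :
  injective i -> (forall x, exists y, i y = g x) ->
  exists u : {additive X -> A}, forall x, i (u x) = g x.
Proof.
move=> inj ex; pose u x := projT1 (cid (ex x)).
have uE x : i (u x) = g x := projT2 (cid (ex x)).
have [x y|v vE] := @additive_of _ _ u; first by apply: inj; rewrite raddfB !uE raddfB.
by exists v => x; rewrite vE.
Qed.

Lemma additive_factor_surj (A B X : zmodType) (q : {additive A -> B}) (g : {additive A -> X}) :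
  (forall y, exists x, q x = y) -> (forall x, q x = 0 -> g x = 0) ->
  exists u : {additive B -> X}, forall x, u (q x) = g x.
Proof.
move=> sur qg; pose s y := projT1 (cid (sur y)).
have sE y : q (s y) = y := projT2 (cid (sur y)).
have gs x : g (s (q x)) = g x.
  by apply/eqP; rewrite -subr_eq0 -raddfB qg // raddfB sE subrr.
have [x y|v vE] := @additive_of _ _ (g \o s).
  by rewrite /= -raddfB -[RHS]gs raddfB !sE.
by exists v => x; rewrite vE /= gs.
Qed.

(** Recursion on the list suits the inductions on the number of generators below, both for subgroups
    and for extending additive maps. *)
Fixpoint zspan (A : zmodType) (s : seq A) (x : A) : Prop :=
  if s is g :: s' then exists a y, zspan s' y /\ x = g *~ a + y else x = 0.

Lemma zspanB (A : zmodType) (s : seq A) x y :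
  zspan s x -> zspan s y -> zspan s (x - y).
Proof.
elim: s x y => [|g s IHs] x y /=; first by move=> -> ->; rewrite subr0.
move=> [a [x' [xs ->]]] [b [y' [ys ->]]].
exists (a - b), (x' - y'); split; first exact: IHs.
by rewrite mulrzBr opprD addrACA.
Qed.

Lemma zspan0 (A : zmodType) (s : seq A) : zspan s 0.
Proof. by elim: s => //= g s IHs; exists 0, 0; rewrite mulr0z addr0. Qed.

Lemma zspanMz (A : zmodType) (s : seq A) x (k : int) : zspan s x -> zspan s (x *~ k).
Proof.
elim: s x => [|g s IHs] x /=; first by move=> ->; rewrite mul0rz.
move=> [a [y [ys ->]]]; exists (a * k), (y *~ k); split; first exact: IHs.
by rewrite mulrzDl mulrzA.
Qed.

Lemma finitely_generatedP (A : zmodType) :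
  finitely_generated A <-> exists s : seq A, forall x, zspan s x.
Proof.
split=> [[m [g gA]]|[s sA]].
  exists [seq g i | i <- index_enum 'I_m] => x; have [a ->] := gA x.
  elim: (index_enum _) => [|i r IHr] /=; first by rewrite big_nil.
  by rewrite big_cons; exists (a i), (\sum_(j <- r) g j *~ a j).
exists (size s), (fun i => s`_i) => x; have := sA x; move: x {sA}.
elim: s => [|g s IHs] x /=; first by move=> ->; exists (fun=> 0); rewrite big_ord0.
move=> [b [y [/IHs[a ->] ->]]].
exists (fun i => if unlift ord0 i is Some j then a j else b).
rewrite big_ord_recl unlift_none; congr (_ + _).
by apply: eq_bigr => i _; rewrite liftK.
Qed.

(** The integers a such that g a + y lies in [P] for some y in the span of [s] form an ideal. An
    element [w] of [P] realising the generator of this ideal, together with generators of the part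
    of [P] inside the span of [s], generates [P]. *)
Lemma subgroup_zspan (A : zmodType) (s : seq A) (P : A -> Prop) :
    P 0 -> (forall x y, P x -> P y -> P (x - y)) -> (forall x, P x -> zspan s x) ->
  exists h : seq A, (forall x, x \in h -> P x) /\ forall x, P x -> zspan h x.
Proof.
elim: s P => [|g s IHs] P P0 PB Ps.
  by exists [::]; split=> // x /Ps.
have PN x : P x -> P (- x) by move=> Px; rewrite -sub0r; apply: PB.
have PD x y : P x -> P y -> P (x + y).
  by move=> Px Py; rewrite -[y]opprK; apply: PB => //; apply: PN.
have PMn x (k : nat) : P x -> P (x *+ k).
  by move=> Px; elim: k => [|k IHk] //; rewrite mulrS; apply: PD.
have PMz x (k : int) : P x -> P (x *~ k).
  move=> Px; case: k => k; first exact: PMn.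
  by rewrite NegzE mulrNz; apply/PN/PMn.
have [||x []//|h [hP hs]] := IHs (fun x => P x /\ zspan s x).
- by split=> //; exact: zspan0.
- by move=> x y [Px xs] [Py ys]; split; [exact: PB | exact: zspanB].
have {}hP x : x \in h -> P x by move=> /hP[].
pose I (a : nat) := (0 < a)%N && `[< exists2 y, zspan s y & P (g *+ a + y) >].
case: (pselect (exists a, I a)) => [exI|nI]; last first.
  exists h; split=> // x Px.
  have [a [y [ys xE]]] := Ps _ Px; suff a0 : a = 0.
    by apply: hs; split=> //; rewrite xE a0 mulr0z add0r.
  apply: contrapT => /eqP a0; apply: nI; exists `|a|%N.
  rewrite /I absz_gt0 a0 /=; apply/asboolP.
  case: (lerP 0 a) => sa.
    by exists y => //; rewrite pmulrn gez0_abs // -xE.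
  exists (- y); first by rewrite -sub0r; apply: zspanB => //; apply: zspan0.
  by rewrite pmulrn ltz0_abs // mulrNz -opprD -xE; apply: PN.
case: (ex_minnP exI) => d /andP[d0 /asboolP[y0 y0s Pw]] dmin.
set w := _ + y0 in Pw.
exists (w :: h); split=> [x|x Px /=].
  by rewrite inE => /predU1P[->|/hP].
have [a [y [ys xE]]] := Ps _ Px.
exists (a %/ d)%Z, (x - w *~ (a %/ d)%Z); split; last by rewrite addrC subrK.
apply: hs; split; first by apply/PB/PMz.
(* Subtracting a multiple of [w] reduces the coefficient of g to its remainder modulo d, which the
   minimality of d forces to be zero. *)
have rE : x - w *~ (a %/ d)%Z = g *~ (a %% d)%Z + (y - y0 *~ (a %/ d)%Z).
  rewrite xE {1}(divz_eq a d) mulrzDr [X in g *~ X]mulrC mulrzA mulrzDl.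
  by rewrite -pmulrn opprD addrACA [X in X - _]addrC addrK.
have rs : zspan s (y - y0 *~ (a %/ d)%Z) by apply/zspanB/zspanMz.
have Pr : P (x - w *~ (a %/ d)%Z) by apply/PB/PMz.
suff r0 : (a %% d)%Z = 0 by rewrite rE r0 mulr0z add0r.
apply: contrapT => /eqP r0.
have dn0 : (d : int) != 0 by lia.
have r_ge := modz_ge0 a dn0.
have r_lt : (a %% d)%Z < d by apply: ltz_pmod; lia.
have : I `|(a %% d)%Z|%N.
  rewrite /I absz_gt0 r0; apply/asboolP; exists (y - y0 *~ (a %/ d)%Z) => //.
  by rewrite pmulrn gez0_abs // -rE.
by move=> /dmin; lia.
Qed.

Lemma finitely_generated_sub (A B : zmodType) (i : {additive A -> B}) :
  injective i -> finitely_generated B -> finitely_generated A.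
Proof.
move=> inj /finitely_generatedP[s sB]; apply/finitely_generatedP.
have [|x y [a <-] [b <-]|//|h [hi hs]] := @subgroup_zspan _ s (fun y => exists x, i x = y).
- by exists 0; rewrite raddf0.
- by exists (a - b); rewrite raddfB.
have [t ht] : exists t, h = map i t.
  elim: h hi {hs} => [|y h IHh] hi; first by exists [::].
  have [x xy] := hi y (mem_head _ _).
  have [z zh|t ->] := IHh; first by apply: hi; rewrite inE zh orbT.
  by exists (x :: t); rewrite /= xy.
exists t => x; have := hs (i x); rewrite ht => /(_ (ex_intro _ x erefl)).
elim: t x {hi hs ht} => [|g t IHt] x /=.
  by move=> x0; apply: inj; rewrite x0 raddf0.
move=> [a [y [yt xE]]]; exists a, (x - g *~ a).
split; last by rewrite addrC subrK.
apply: IHt.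
by rewrite raddfB raddfMz xE addrC addKr.
Qed.

Lemma finitely_generated_quo (A B : zmodType) (q : {additive A -> B}) :
  (forall y, exists x, q x = y) -> finitely_generated A -> finitely_generated B.
Proof.
move=> sur [m [g gA]]; exists m, (fun i => q (g i)) => y.
have [x <-] := sur y; have [a ->] := gA x; exists a.
by rewrite raddf_sum; apply: eq_bigr => i _; rewrite raddfMz.
Qed.

Lemma finitely_generated_prod (A B : zmodType) :
  finitely_generated A -> finitely_generated B -> finitely_generated (A * B)%type.
Proof.
move=> [m [g gA]] [k [h hB]].
exists (m + k)%N, (fun i => match split i with inl j => (g j, 0) | inr j => (0, h j) end) => -[x y].
have [a ->] := gA x; have [b ->] := hB y.
exists (fun i => match split i with inl j => a j | inr j => b j end).
rewrite big_split_ord /=.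
under [X in _ = X + _]eq_bigr => i _ do rewrite (unsplitK (inl i)).
under [X in _ = _ + X]eq_bigr => i _ do rewrite (unsplitK (inr i)).
have fstMz (u : A * B) (z : int) : (u *~ z).1 = u.1 *~ z by rewrite (raddfMz fst).
have sndMz (u : A * B) (z : int) : (u *~ z).2 = u.2 *~ z by rewrite (raddfMz snd).
congr pair.
  rewrite [RHS](raddfD fst) !(raddf_sum fst) /=.
  under [X in _ = X + _]eq_bigr do rewrite fstMz.
  under [X in _ + X]eq_bigr do rewrite fstMz mul0rz.
  by rewrite sumr_const mul0rn addr0.
rewrite [RHS](raddfD snd) !(raddf_sum snd) /=.
under [X in X + _]eq_bigr do rewrite sndMz mul0rz.
rewrite sumr_const mul0rn add0r; by apply: eq_bigr => j _; rewrite sndMz.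
Qed.

Section KernelGroup.
Variables (A B : zmodType) (f : {additive A -> B}).

Definition kerp : {pred A} := fun x => f x == 0.

Fact kerp_zmod_closed : zmod_closed kerp.
Proof.
split=> [|x y]; rewrite !unfold_in ?raddf0 // => /eqP xE /eqP yE.
by rewrite raddfB xE yE subrr.
Qed.
HB.instance Definition _ := GRing.isZmodClosed.Build A kerp kerp_zmod_closed.

Record kert := Kert { kerv : A; _ : kerv \in kerp }.
HB.instance Definition _ := [isSub for kerv].
HB.instance Definition _ := [Choice of kert by <:].
HB.instance Definition _ := [SubChoice_isSubZmodule of kert by <:].

Definition imp : {pred B} := fun y => `[< exists x, f x = y >].

Fact imp_zmod_closed : zmod_closed imp.
Proof.
split=> [|x y]; rewrite !unfold_in; first by apply/asboolP; exists 0; rewrite raddf0.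
move=> /asboolP[a <-] /asboolP[b <-]; apply/asboolP.
by exists (a - b); rewrite raddfB.
Qed.
HB.instance Definition _ := GRing.isZmodClosed.Build B imp imp_zmod_closed.

Definition cokert := Quotient.quot imp.
HB.instance Definition _ := Choice.on cokert.
HB.instance Definition _ := GRing.Zmodule.on cokert.

Definition cokerq (y : B) : cokert := (\pi_(Quotient.quot imp) y)%qT.

Fact cokerq_zmod_morphism : zmod_morphism cokerq.
Proof.
move=> x y; by rewrite /cokerq !piE.
Qed.
HB.instance Definition _ :=
  GRing.isZmodMorphism.Build B cokert cokerq cokerq_zmod_morphism.

Lemma cokerq_surj y : exists x, cokerq x = y.
Proof. by exists (repr y); exact: reprK. Qed.

Lemma cokerq_eq0 y : cokerq y = 0 <-> exists x, f x = y.
Proof.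
rewrite -[0](raddf0 cokerq).
transitivity (y \in imp); last by rewrite unfold_in; split=> /asboolP.
by rewrite -[X in X \in _]subr0 Quotient.idealrBE; split=> /eqP.
Qed.

End KernelGroup.

Lemma kernel_group (A B : fgZmodType) (f : {additive A -> B}) :
  exists (K : fgZmodType) (k : {additive K -> A}),
    injective k /\ forall x, f x = 0 <-> exists y, k y = x.
Proof.
pose k : {additive kert f -> A} := val.
have inj : injective k by apply: val_inj.
pose K : fgZmodType := HB.pack (kert f)
  (isFinGen.Build (kert f) (finitely_generated_sub inj (@fingenP A))).
exists K, k; split=> // x; split=> [/eqP fx|[[y yK] <-]]; first by exists (Kert fx).
exact/eqP/yK.
Qed.

Lemma cokernel_group (A B : fgZmodType) (f : {additive A -> B}) :
  exists (Q : fgZmodType) (q : {additive B -> Q}),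
    (forall y, exists x, q x = y) /\ forall y, q y = 0 <-> exists x, f x = y.
Proof.
pose Q : fgZmodType := HB.pack (cokert f)
  (isFinGen.Build (cokert f) (finitely_generated_quo (@cokerq_surj _ _ f) (@fingenP B))).
exists Q, (cokerq f); split; [exact: cokerq_surj | exact: cokerq_eq0].
Qed.

(** * Exactness of the tensor product and extension of scalars *)

Section AdditiveExtension.
Variables (K : fieldType) (M : lmodType K).
Hypothesis K_char0 : forall m : int, m != 0 -> m%:~R != 0 :> K.

(** The new source is A x Z, with (0, 1) sent to g, and only the value c of [l'] at (0, 1) has to be
    chosen. If f x0 = N g with N nonzero, then c is forced to be l x0 / N, which exists since N is
    invertible in K. If no nonzero multiple of g is in the image of f, the kernel of [f'] lies in A
    x 0 and c = 0 will do. *)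
Lemma additive_extend_step (A B : zmodType) (f : {additive A -> B})
    (l : {additive A -> M}) (g : B) :
  (forall x, f x = 0 -> l x = 0) ->
  exists (A' : zmodType) (f' : {additive A' -> B}) (l' : {additive A' -> M})
    (i : {additive A -> A'}),
  [/\ forall x, f' x = 0 -> l' x = 0, forall x, f' (i x) = f x,
      forall x, l' (i x) = l x & exists x, f' x = g].
Proof.
move=> fl.
have [c cP] : exists c : M, forall x (a : int), f x + g *~ a = 0 -> l x + c *~ a = 0.
  case: (pselect (exists (N : int) x0, N != 0 /\ f x0 = g *~ N)) => [[N [x0 [N0 x0E]]]|nN].
    exists ((N%:~R : K)^-1 *: l x0) => x a xa.
    have : l (x *~ N + x0 *~ a) = 0.
      by apply: fl; rewrite raddfD !raddfMz x0E -mulrzA mulrC mulrzA -mulrzDl xa mul0rz.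
    rewrite raddfD !raddfMz => /(congr1 (GRing.scale (N%:~R : K)^-1)).
    rewrite scalerDr scaler0 -[l x *~ N]scaler_int scalerA mulVf ?K_char0 // scale1r.
    by rewrite -[l x0 *~ a]scaler_int scalerA mulrC -scalerA scaler_int.
  exists 0 => x a xa; rewrite mul0rz addr0; apply: fl.
  suff a0 : a = 0 by rewrite a0 mulr0z addr0 in xa.
  apply: contrapT => /eqP a0; apply: nN; exists (- a), x; rewrite oppr_eq0 a0.
  by split=> //; rewrite mulrNz; apply/eqP; rewrite -addr_eq0 xa.
have [x y|f' f'E] := @additive_of (A * int)%type B (fun x => f x.1 + g *~ x.2).
  by rewrite /= raddfB mulrzBr opprD addrACA.
have [x y|l' l'E] := @additive_of (A * int)%type M (fun x => l x.1 + c *~ x.2).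
  by rewrite /= raddfB mulrzBr opprD addrACA.
have [x y|i iE] := @additive_of A (A * int)%type (fun x => (x, 0)).
  by congr pair; rewrite /= subr0.
exists (A * int)%type, f', l', i; split=> [x|x|x|].
- by rewrite f'E l'E; exact: cP.
- by rewrite iE f'E mulr0z addr0.
- by rewrite iE l'E mulr0z addr0.
- by exists (0, 1); rewrite f'E raddf0 add0r.
Qed.

(* The target is divisible and torsion-free, and the source is extended by one
   generator of B at a time, so no Zorn argument is needed. *)
Lemma additive_extend (A : zmodType) (B : fgZmodType)
    (f : {additive A -> B}) (l : {additive A -> M}) :
  (forall x, f x = 0 -> l x = 0) ->
  exists h : {additive B -> M}, forall x, h (f x) = l x.
Proof.
have /finitely_generatedP[s sB] := @fingenP B.
(* Invariant of the induction: the image of f and the generators still to be added together generate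
   B. When none is left, f is onto and l factors through it. *)
have {sB} : forall y, exists x, zspan s (y - f x).
  by move=> y; exists 0; rewrite raddf0 subr0.
elim: s A f l => [|g s IHs] A f l /= fB fl.
  apply: additive_factor_surj => // y; have [x /eqP] := fB y.
  by rewrite subr_eq0 => /eqP ->; exists x.
have [A' [f' [l' [i [fl' fi li [x0 x0E]]]]]] := additive_extend_step g fl.
have [y|//|h hE] := IHs A' f' l'; last by exists h => x; rewrite -fi hE.
have [x [a [z [zs yE]]]] := fB y.
exists (i x + x0 *~ a); rewrite raddfD raddfMz fi x0E.
by rewrite opprD addrA yE addrAC subrr add0r.
Qed.

End AdditiveExtension.

Section TensorExtension.
Variables (K : fieldType) (H : fgZmodType) (M : vectType K) (l : {additive H -> M}).

Lemma tens_extension :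
  exists h : 'Hom(tens K H, M), forall x, h (tcan K x) = l x.
Proof.
pose b a x := a *: l x.
have bDl a a' x : b (a + a') x = b a x + b a' x by rewrite /b scalerDl.
have bDr a x y : b a (x + y) = b a x + b a y by rewrite /b raddfD scalerDr.
have hlin : linear (tlift b).
  move=> a x y; rewrite -[x]tsum_repr -[y]tsum_repr.
  have -> : a *: tsum (repr x) = tsum (tscale_seq a (repr x)).
    rewrite !tsumE scaler_sumr big_map; apply: eq_bigr => p _.
    by rewrite tpureZ.
  rewrite -tsum_cat !tliftE // big_cat big_map scaler_sumr; congr (_ + _).
  by apply: eq_bigr => p _; rewrite /b scalerA.
pose h : {linear tens K H -> M} := HB.pack (tlift b)
  (GRing.isLinear.Build K (tens K H) M _ (tlift b) hlin).
exists (linfun h) => x; rewrite lfunE /= /tcan /tpure tliftE // big_seq1.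
exact: scale1r.
Qed.

End TensorExtension.

Section TensorExact.
Variable K : fieldType.
Hypothesis K_char0 : forall m : int, m != 0 -> m%:~R != 0 :> K.

(** The map sending y to the class of 1 (x) y modulo the image of [tmap K f] kills ker g, so it
    extends along g to all of D. The projection modulo this image then factors through [tmap K g],
    whose kernel is therefore contained in it. Since g may be far from surjective, flatness is
    included. *)
Lemma tmap_exact (A B D : fgZmodType) (f : {additive A -> B}) (g : {additive B -> D}) :
  (forall y, g y = 0 -> exists x, f x = y) ->
  (lker (tmap K g) <= limg (tmap K f))%VS.
Proof.
move=> fg; pose U := limg (tmap K f).
pose l : {additive B -> vquot U} := (vproj U : _ -> _) \o @tcan K B.
have [y /fg[x <-]|h hE] := @additive_extend K _ K_char0 _ _ g l.
  by apply/eqP; rewrite /= vproj_eq0 -tmap_can; exact: memv_img (memvf _).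
have [h' h'E] := tens_extension h.
have hh : (h' \o tmap K g = vproj U)%VF.
  by apply: tens_lfunP => x; rewrite comp_lfunE tmap_can h'E hE.
apply/subvP => v; rewrite memv_ker => /eqP gv.
by rewrite -vproj_eq0 -hh comp_lfunE gv linear0.
Qed.

Lemma tmap_inj (A B : fgZmodType) (f : {additive A -> B}) :
  injective f -> injective (tmap K f).
Proof.
move=> inj; suff f0 v : tmap K f v = 0 -> v = 0.
  by move=> u v uv; apply/eqP; rewrite -subr_eq0; apply/eqP/f0; rewrite linearB /= uv subrr.
move=> /eqP; rewrite -memv_ker => vK.
(* Exactness at the middle term of A -> A -> B, with first map 0 and second map f. *)
have := @tmap_exact A A B 0 f; rewrite tmap0 => /(_ _)/subvP/(_ _ vK).
rewrite lim0g memv0 => vv; apply/eqP/vv => y y0.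
by exists 0; rewrite -(raddf0 f) in y0; rewrite (inj _ _ y0).
Qed.

End TensorExact.

Lemma tmap_surj (K : fieldType) (A B : fgZmodType) (f : {additive A -> B}) :
  (forall y, exists x, f x = y) -> forall v, exists u, tmap K f u = v.
Proof.
move=> sur v; rewrite -[v]tsum_repr.
elim: (repr v) => [|[a y] s [u uE]]; first by exists 0; rewrite linear0 tsumE big_nil.
have [x <-] := sur y; exists (tpure a x + u).
by rewrite linearD /= tmapE uE -cat1s tsum_cat.
Qed.

Lemma tens_memP (K : fieldType) (A : fgZmodType) (V : vectType K)
    (h : 'Hom(tens K A, V)) (U : {vspace V}) :
  (forall x, h (tcan K x) \in U) -> forall v, h v \in U.
Proof.
move=> hU v; have h0 : (vproj U \o h = 0)%VF.
  by apply: tens_lfunP => x; rewrite comp_lfunE zero_lfunE; apply/eqP; rewrite vproj_eq0.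
by rewrite -vproj_eq0 -comp_lfunE h0 zero_lfunE.
Qed.

Section Coefficients.
Variables (K L : fieldType) (s : {rmorphism K -> L}).

Section Tcoef.
Variable A : fgZmodType.
Implicit Types (u v : tens K A) (U V : {vspace tens K A}).

Lemma tcoef_tsum t :
  tcoef s (tsum t : tens K A) = \sum_(p <- t) tpure (s p.1) p.2.
Proof.
by apply: tliftE => [a b x|a x y]; rewrite ?tpureDr // rmorphD tpureDl.
Qed.

Lemma tcoefD u v : tcoef s (u + v) = tcoef s u + tcoef s v.
Proof.
by rewrite -[u]tsum_repr -[v]tsum_repr -tsum_cat !tcoef_tsum big_cat.
Qed.

Lemma tcoefZ a u : tcoef s (a *: u) = s a *: tcoef s u.
Proof.
rewrite -[u]tsum_repr tsumE scaler_sumr -tsumE.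
under eq_bigr do rewrite tpureZ.
have -> : \sum_(p <- repr u) tpure (a * p.1) p.2 = tsum (tscale_seq a (repr u)).
  by rewrite tsumE big_map.
rewrite !tcoef_tsum big_map scaler_sumr.
by apply: eq_bigr => p _; rewrite tpureZ /= rmorphM.
Qed.

Lemma tcoef0 : tcoef s (0 : tens K A) = 0.
Proof. by rewrite -(scale0r 0) tcoefZ rmorph0 scale0r. Qed.

Lemma tcoefN u : tcoef s (- u) = - tcoef s u.
Proof. by rewrite -scaleN1r tcoefZ rmorphN1 scaleN1r. Qed.

Lemma tcoef_can x : tcoef s (tcan K x : tens K A) = tcan L x.
Proof. by rewrite tcoefE rmorph1. Qed.

Lemma mem_vcoef u U : u \in U -> tcoef s u \in vcoef s U.
Proof.
move=> /coord_vbasis ->.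
elim/big_ind: _ => [|x y xU yU|i _]; first by rewrite tcoef0 mem0v.
  by rewrite tcoefD memvD.
rewrite tcoefZ memvZ // memv_span //; apply/map_f/mem_nth.
by rewrite size_tuple.
Qed.

Lemma vcoef_subP U (V : {vspace tens L A}) :
  (forall u, u \in U -> tcoef s u \in V) -> (vcoef s U <= V)%VS.
Proof.
move=> UV; apply/span_subvP => _ /mapP[u uU ->].
by apply/UV/vbasis_mem.
Qed.

Lemma vcoefS U V : (U <= V)%VS -> (vcoef s U <= vcoef s V)%VS.
Proof. by move=> /subvP UV; apply: vcoef_subP => u /UV; exact: mem_vcoef. Qed.

Lemma vcoef0 : vcoef s (0%VS : {vspace tens K A}) = 0%VS.
Proof.
apply/eqP; rewrite -subv0; apply: vcoef_subP => u.
by rewrite memv0 => /eqP ->; rewrite tcoef0 mem0v.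
Qed.

Lemma vcoefT : vcoef s (fullv : {vspace tens K A}) = fullv.
Proof.
apply/eqP; rewrite eqEsubv subvf /=; apply/subvP => v _; rewrite -[v](id_lfunE v).
by apply: tens_memP => x; rewrite id_lfunE -tcoef_can; exact/mem_vcoef/memvf.
Qed.

Lemma vcoefD U V : vcoef s (U + V) = (vcoef s U + vcoef s V)%VS.
Proof.
apply/eqP; rewrite eqEsubv subv_add !vcoefS ?addvSl ?addvSr // !andbT.
by apply: vcoef_subP => _ /memv_addP[u uU [v vV ->]]; rewrite tcoefD memv_add ?mem_vcoef.
Qed.

(** [tcoef s] is only semilinear, so coordinates are used: each coordinate functional c over K has
    an L-linear counterpart h with h (tcoef s v) = s (c v), and s is injective. *)
Lemma tcoef_eq0 u : tcoef s u = 0 -> u = 0.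
Proof.
move=> u0; rewrite [u](coord_vbasis (memvf u)); apply: big1 => i _.
pose c : {linear tens K A -> K^o} := coord (vbasis {:tens K A}) i.
have [x y|l lE] := @additive_of A L^o (fun x => s (c (tcan K x))).
  by rewrite !raddfB.
have [h hE] := tens_extension l.
suff hc v : h (tcoef s v) = s (c v).
  have := hc u; rewrite u0 linear0 => /esym/eqP; rewrite fmorph_eq0 => /eqP ->.
  by rewrite scale0r.
rewrite -[v]tsum_repr tcoef_tsum tsumE !raddf_sum /=.
apply: eq_bigr => -[a x] _ /=.
rewrite -[s a]mulr1 -[a]mulr1 -!tpureZ !linearZ /= hE lE.
by rewrite mulr1 rmorphM.
Qed.

End Tcoef.

(** Arbitrary linear maps are allowed, because the lemma is applied to projectors and generalised
    inverses, which do not come from group homomorphisms. *)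
Lemma tens_basechange (A B : fgZmodType) (f : 'Hom(tens K A, tens K B)) :
  exists h : 'Hom(tens L A, tens L B), forall u, h (tcoef s u) = tcoef s (f u).
Proof.
have [x y|l lE] := @additive_of A (tens L B) (fun x => tcoef s (f (tcan K x))).
  by rewrite !raddfB tcoefD tcoefN.
have [h hE] := tens_extension l; exists h => u.
rewrite -[u]tsum_repr; elim: (repr u) => [|[a x] t IHt].
  by rewrite [tsum _]tsumE big_nil tcoef0 !linear0 tcoef0.
rewrite -cat1s tsum_cat tcoefD !linearD /= IHt tcoefD; congr (_ + _).
rewrite -/(tpure a x) -[a]mulr1 -tpureZ tcoefZ !linearZ /= tcoefZ.
by rewrite tcoef_can hE lE.
Qed.

(* f' is a generalised inverse of f, so 1 - f' f projects onto ker f; this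
   identity is preserved by base change. *)
Lemma lker_basechange (A B : fgZmodType) (f : 'Hom(tens K A, tens K B))
    (h : 'Hom(tens L A, tens L B)) :
  (forall u, h (tcoef s u) = tcoef s (f u)) -> (lker h <= vcoef s (lker f))%VS.
Proof.
move=> hE; pose f' := (f^-1)%VF; pose e := (\1 - (f' \o f))%VF.
have [h' h'E] := tens_basechange f'; have [d dE] := tens_basechange e.
have eK u : e u \in lker f.
  rewrite memv_ker /e add_lfunE opp_lfunE id_lfunE comp_lfunE linearB /=.
  by rewrite limg_lfunVK ?subrr // memv_img ?memvf.
have dK v : d v \in vcoef s (lker f).
  by apply: tens_memP => x; rewrite -tcoef_can dE; exact: mem_vcoef.
have dh : \1%VF = (d + (h' \o h))%VF.
  apply: tens_lfunP => x; rewrite add_lfunE comp_lfunE id_lfunE -tcoef_can.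
  rewrite dE hE h'E -tcoefD; congr tcoef.
  by rewrite /e add_lfunE opp_lfunE id_lfunE comp_lfunE subrK.
apply/subvP => v; rewrite memv_ker => /eqP hv.
by rewrite -[v](id_lfunE v) dh add_lfunE comp_lfunE hv linear0 addr0.
Qed.

(** Presents any subspace as a kernel, so that statements about the base change of linear maps apply
    to subspaces. *)
Lemma lker_projvC (V : vectType K) (U : {vspace V}) : lker (\1 - projv U)%VF = U.
Proof.
apply/vspaceP => v; rewrite memv_ker add_lfunE opp_lfunE id_lfunE subr_eq0.
apply/eqP/idP => [->|/projv_id -> //]; exact: memv_proj.
Qed.

Lemma tmap_coef (A B : fgZmodType) (f : {additive A -> B}) u :
  tmap L f (tcoef s u) = tcoef s (tmap K f u).
Proof.
have [h hE] := tens_basechange (tmap K f); rewrite -hE.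
suff -> : tmap L f = h by [].
by apply: tens_lfunP => x; rewrite -tcoef_can hE tcoef_can !tmap_can tcoef_can.
Qed.

(** The preimage of U is the kernel of (1 - projv U) composed with f. Base change of 1 - projv U
    kills [vcoef s U], so the preimage over L lies in a kernel to which [lker_basechange]
    applies. *)
Lemma vcoef_preim (A B : fgZmodType) (f : {additive A -> B}) (U : {vspace tens K B}) :
  vcoef s (tmap K f @^-1: U) = (tmap L f @^-1: vcoef s U)%VS.
Proof.
apply/eqP; rewrite eqEsubv; apply/andP; split.
  apply: vcoef_subP => u; rewrite -memv_preim => fu.
  by rewrite -memv_preim tmap_coef mem_vcoef.
have [h hE] := tens_basechange (\1 - projv U)%VF.
have -> : (tmap K f @^-1: U = lker ((\1 - projv U) \o tmap K f)%VF)%VS.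
  by apply/vspaceP => v; rewrite -memv_preim -[in LHS](lker_projvC U) !memv_ker comp_lfunE.
apply: (subv_trans _ (@lker_basechange _ _ _ (h \o tmap L f)%VF _)); last first.
  by move=> u; rewrite !comp_lfunE tmap_coef hE.
apply/subvP => v; rewrite -memv_preim memv_ker comp_lfunE => vU.
rewrite -memv_ker; move: vU; apply/subvP/vcoef_subP => u uU.
by rewrite memv_ker hE; move: uU; rewrite -{1}(lker_projvC U) memv_ker => /eqP ->; rewrite tcoef0.
Qed.

Lemma vcoef_img (A B : fgZmodType) (f : {additive A -> B}) (U : {vspace tens K A}) :
  vcoef s (tmap K f @: U) = (tmap L f @: vcoef s U)%VS.
Proof.
apply/eqP; rewrite eqEsubv; apply/andP; split.
  apply: vcoef_subP => _ /memv_imgP[u uU ->].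
  by rewrite -tmap_coef memv_img ?mem_vcoef.
apply/subvP => _ /memv_imgP[u uU ->]; rewrite memv_preim; move: uU.
apply/subvP/vcoef_subP => v vU.
by rewrite -memv_preim tmap_coef mem_vcoef ?memv_img.
Qed.

(** This faithfulness is what brings facts about W from C back to the rationals. *)
Lemma memv_vcoef (A : fgZmodType) (u : tens K A) U : (tcoef s u \in vcoef s U) = (u \in U).
Proof.
apply/idP/idP; last exact: mem_vcoef.
have [h hE] := tens_basechange (\1 - projv U)%VF.
have Uh : (vcoef s U <= lker h)%VS.
  apply: vcoef_subP => v vU; rewrite memv_ker hE.
  by move: vU; rewrite -{1}(lker_projvC U) memv_ker => /eqP ->; rewrite tcoef0.
move=> /(subvP Uh); rewrite memv_ker hE => /eqP/tcoef_eq0/eqP.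
by rewrite -memv_ker lker_projvC.
Qed.

End Coefficients.

(** * Opposed filtrations and strictness *)

(* For a mixed Hodge structure, tG is the complex conjugate of tF. *)
Record trifil (K : fieldType) (V : vectType K) := Trifil {
  tW : int -> {vspace V};
  tF : int -> {vspace V};
  tG : int -> {vspace V} }.

Definition tswap (K : fieldType) (V : vectType K) (T : trifil V) :=
  Trifil (tW T) (tG T) (tF T).

(* F^p and G^q meet trivially in Gr^W_k. *)
Definition disjoint_type (K : fieldType) (V : vectType K) (T : trifil V) (k p q : int) :=
  forall x y, x \in tF T p -> x \in tW T k -> y \in tG T q -> y \in tW T k ->
    x - y \in tW T (k - 1) -> x \in tW T (k - 1).

(** Monotonicity is left out so that the increasing W and the decreasing F and G share one
    notion. *)
Definition bounded_filtration (K : fieldType) (V : vectType K) (E : int -> {vspace V}) :=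
  (exists k, E k = 0%VS) /\ (exists k, E k = fullv).

(** [op_sum] and [op_cap] are the two halves of purity of Gr_k, phrased with representatives so that
    no quotient space appears. The conditions are symmetric in F and G, as [opposed_swap]
    records. *)
Record opposed (K : fieldType) (V : vectType K) (T : trifil V) : Prop := Opposed {
  opW : forall k l : int, k <= l -> (tW T k <= tW T l)%VS;
  opF : forall k l : int, k <= l -> (tF T l <= tF T k)%VS;
  opG : forall k l : int, k <= l -> (tG T l <= tG T k)%VS;
  opWb : bounded_filtration (tW T);
  opFb : bounded_filtration (tF T);
  opGb : bounded_filtration (tG T);
  op_sum : forall k p q : int, p + q = k + 1 -> forall x, x \in tW T k ->
    exists x1 x2 x3, [/\ x = x1 + x2 + x3, x1 \in tF T p /\ x1 \in tW T k,
      x2 \in tG T q /\ x2 \in tW T k & x3 \in tW T (k - 1)];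
  op_cap : forall k p q : int, p + q = k + 1 -> disjoint_type T k p q }.

Definition tcompat (K : fieldType) (V V' : vectType K) (T : trifil V) (T' : trifil V')
    (f : 'Hom(V, V')) :=
  forall k x, [/\ x \in tW T k -> f x \in tW T' k,
    x \in tF T k -> f x \in tF T' k & x \in tG T k -> f x \in tG T' k].

Lemma disjoint_type_swap (K : fieldType) (V : vectType K) (T : trifil V) k p q :
  disjoint_type T k p q -> disjoint_type (tswap T) k q p.
Proof.
move=> dT x y xG xW yF yW xy; rewrite -[x](subrK y) memvD //.
by apply: (dT y x) => //; rewrite -memvN opprB.
Qed.

Lemma opposed_swap (K : fieldType) (V : vectType K) (T : trifil V) :
  opposed T -> opposed (tswap T).
Proof.
case=> oW oF oG bW bF bG os oc; split=> //= k p q pq; last first.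
  by apply/disjoint_type_swap/oc; rewrite addrC.
move=> x xW; have [|x1 [x2 [x3 [-> ? ? ?]]]] := os k q p _ x xW; first by rewrite addrC.
by exists x2, x1, x3; rewrite [x2 + x1]addrC.
Qed.

Section Opposed.
Variables (K : fieldType) (V : vectType K) (T : trifil V).
Hypothesis oT : opposed T.
Local Notation W := (tW T).
Local Notation F := (tF T).
Local Notation G := (tG T).

Lemma tW_le k l x : k <= l -> x \in W k -> x \in W l.
Proof. by move=> /(opW oT)/subvP; apply. Qed.
Lemma tF_ge k l x : k <= l -> x \in F l -> x \in F k.
Proof. by move=> /(opF oT)/subvP; apply. Qed.
Lemma tG_ge k l x : k <= l -> x \in G l -> x \in G k.
Proof. by move=> /(opG oT)/subvP; apply. Qed.
Lemma tW_pred k x : x \in W (k - 1) -> x \in W k.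
Proof. by apply: tW_le; lia. Qed.

Lemma tW_low : exists lo, forall k, k <= lo -> W k = 0%VS.
Proof.
have [[lo lo0] _] := opWb oT; exists lo => k klo.
by apply/eqP; rewrite -subv0 -lo0; exact: opW.
Qed.

Lemma tW_high : exists hi, forall k x, hi <= k -> x \in W k.
Proof.
have [_ [hi hiT]] := opWb oT; exists hi => k x hik.
by apply: (tW_le hik); rewrite hiT memvf.
Qed.

Lemma tF_high : exists hi, forall k, hi <= k -> F k = 0%VS.
Proof.
have [[hi hi0] _] := opFb oT; exists hi => k hik.
by apply/eqP; rewrite -subv0 -hi0; exact: opF.
Qed.

Lemma tF_low : exists lo, forall k x, k <= lo -> x \in F k.
Proof.
have [_ [lo loT]] := opFb oT; exists lo => k x klo.
by apply: (tF_ge klo); rewrite loT memvf.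
Qed.

End Opposed.

(* tU T m b l is the sum of the G^(b-i) :&: W_(l-i) for 0 <= i < m.  Once
   W_(l-m) = 0 it is a complement of F^a :&: W_l in W_l for a + b = l + 1; as
   it is functorial, this is what forces strictness. *)
Fixpoint tU (K : fieldType) (V : vectType K) (T : trifil V) (m : nat) (b l : int) : {vspace V} :=
  if m is m'.+1 then (tG T b :&: tW T l + tU T m' (b - 1) (l - 1))%VS else 0%VS.

Section Splitting.
Variables (K : fieldType) (V : vectType K) (T : trifil V).
Hypothesis oT : opposed T.
Local Notation W := (tW T).
Local Notation F := (tF T).
Local Notation G := (tG T).

Lemma tU_W m b l x : x \in tU T m b l -> x \in W l.
Proof.
elim: m b l x => [|m IHm] b l x /=; first by rewrite memv0 => /eqP ->; rewrite mem0v.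
move=> /memv_addP[g]; rewrite memv_cap => /andP[_ gW] [u /IHm uW ->].
by rewrite memvD //; exact: (tW_pred oT).
Qed.

(** Iterates [op_sum]. The error term lies in W_(l-1), where the same a is opposed to b - 1; this is
    why both indices of [tU] drop together. *)
Lemma tU_split m a b l x : a + b = l + 1 -> W (l - m%:Z) = 0%VS -> x \in W l ->
  exists x1 x2, [/\ x = x1 + x2, x1 \in F a, x1 \in W l & x2 \in tU T m b l].
Proof.
elim: m a b l x => [|m IHm] a b l x ab W0 xW /=.
  move: xW; rewrite -[l]subr0 W0 memv0 => /eqP ->.
  by exists 0, 0; rewrite addr0 !mem0v.
have [x1 [x2 [x3 [-> [x1F x1W] [x2G x2W] x3W]]]] := op_sum oT ab xW.
have [||y1 [y2 [-> y1F y1W y2U]]] := IHm a (b - 1) (l - 1) _ _ _ x3W; first lia.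
  by rewrite -W0; congr tW; lia.
exists (x1 + y1), (x2 + y2); split; first by rewrite addrACA addrA.
- exact: memvD.
- by rewrite memvD //; exact: (tW_pred oT).
- by rewrite memv_add // memv_cap x2G.
Qed.

(** Write x = g + u with g in G^b and u in W_(l-1). Modulo W_(l-1) the vector x is in F^a and in
    G^b, so it lies in W_(l-1), and hence so does g. As G^b is contained in G^(b-1), g can be
    absorbed into the leading term of u, and the argument repeats one weight lower. *)
Lemma tU_disjoint m a b l x : a + b = l + 1 -> W (l - m%:Z) = 0%VS ->
  x \in F a -> x \in tU T m b l -> x = 0.
Proof.
elim: m a b l x => [|m IHm] a b l x ab W0 xF /=; first by rewrite memv0 => /eqP.
move=> /memv_addP[g]; rewrite memv_cap => /andP[gG gW] [u uU xE].
have uW := tU_W uU.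
have xW : x \in W (l - 1).
  apply: (op_cap oT ab xF _ gG gW); first by rewrite xE memvD //; exact: (tW_pred oT).
  by rewrite xE addrAC subrr add0r.
have gW' : g \in W (l - 1) by rewrite -[g](addrK u) -xE memvB.
have gG' : g \in G (b - 1) by apply: (tG_ge oT) gG; lia.
case: m IHm W0 uU => [|m] IHm W0 uU.
  by move: xW; rewrite W0 memv0 => /eqP.
apply: (IHm a (b - 1) (l - 1)) => //; first lia.
  by rewrite -W0; congr tW; lia.
move: uU => /= /memv_addP[g' g'P [u' u'U uE]].
rewrite xE uE addrA; apply: memv_add u'U.
by rewrite memvD // memv_cap gG'.
Qed.

End Splitting.

Section Strictness.
Variables (K : fieldType) (V V' : vectType K) (T : trifil V) (T' : trifil V').
Variable f : 'Hom(V, V').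
Hypotheses (oT : opposed T) (oT' : opposed T') (fT : tcompat T T' f).

Let fW k x : x \in tW T k -> f x \in tW T' k. Proof. by case: (fT k x). Qed.
Let fF k x : x \in tF T k -> f x \in tF T' k. Proof. by case: (fT k x). Qed.
Let fG k x : x \in tG T k -> f x \in tG T' k. Proof. by case: (fT k x). Qed.

Lemma tcompat_tU m b l x : x \in tU T m b l -> f x \in tU T' m b l.
Proof.
elim: m b l x => [|m IHm] b l x /=.
  by rewrite !memv0 => /eqP ->; rewrite linear0.
move=> /memv_addP[g]; rewrite memv_cap => /andP[gG gW] [u uU ->].
by rewrite linearD /= memv_add ?IHm // memv_cap fG ?fW.
Qed.

Lemma common_low l : exists m : nat, tW T (l - m%:Z) = 0%VS /\ tW T' (l - m%:Z) = 0%VS.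
Proof.
have [lo loP] := tW_low oT; have [lo' loP'] := tW_low oT'.
exists (`|l - lo| + `|l - lo'|)%N; split; [apply: loP | apply: loP']; lia.
Qed.

Lemma common_high : exists l, (forall x, x \in tW T l) /\ (forall x, x \in tW T' l).
Proof.
have [hi hiP] := tW_high oT; have [hi' hiP'] := tW_high oT'.
by exists (Num.max hi hi'); split=> x; [apply: hiP | apply: hiP']; rewrite le_max lexx ?orbT.
Qed.

(** At a weight l where everything is in W_l, f respects both summands of the splitting. If f x is
    in F^a, then the U-component of x has an image in both summands, so that image vanishes. *)
Lemma strictF a x : f x \in tF T' a -> exists2 x', x' \in tF T a & f x' = f x.
Proof.
move=> fxF; have [l [lT lT']] := common_high; have [m [m0 m0']] := common_low l.
have ab : a + (l + 1 - a) = l + 1 by rewrite addrC subrK.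
have [x1 [x2 [xE x1F _ x2U]]] := tU_split oT ab m0 (lT x).
exists x1 => //; rewrite xE linearD /=.
suff -> : f x2 = 0 by rewrite addr0.
apply: (tU_disjoint oT' ab m0'); last exact: tcompat_tU.
by rewrite -[f x2](addKr (f x1)) -linearD -xE memvD // memvN fF.
Qed.

(** The indices p + 1 and l - p are opposed at weight l. Comparing the splittings of x and of f x
    shows that both parts of x have image in W_(l-1). The F^(p+1) part [x1] is kept for the next
    step. The other part [x2] is still in F^p; after correction by an element of F^p and W_(l-1),
    its image also lies in a complement of F^p, hence is zero. *)
Lemma strictW_step l p x : x \in tF T p -> x \in tW T l -> f x \in tW T' (l - 1) ->
  exists x1 x2, [/\ x = x1 + x2, x1 \in tF T (p + 1), x1 \in tW T l,
    f x1 \in tW T' (l - 1) & exists2 y, y \in tW T (l - 1) & f y = f x2].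
Proof.
move=> xF xW fxW.
have [m [m0 m0']] := common_low l; case: m m0 m0' => [|m] m0 m0'.
  move: xW; rewrite -[l]subr0 m0 memv0 => /eqP ->.
  exists 0, 0; rewrite addr0 !mem0v linear0 mem0v; split=> //.
  by exists 0; rewrite ?mem0v ?linear0.
have pq : p + 1 + (l - p) = l + 1 by lia.
have [x1 [x2 [xE x1F x1W x2U]]] := tU_split oT pq m0 xW.
have lm : l - m.+1%:Z = l - 1 - m%:Z by lia.
have pq2 : p + (l - p) = (l - 1) + 1 by lia.
have pq' : p + 1 + (l - 1 - p) = (l - 1) + 1 by lia.
have [y1 [y2 [yE y1F y1W y2U]]] : exists x1 x2, [/\ f x = x1 + x2, x1 \in tF T' (p + 1),
    x1 \in tW T' (l - 1) & x2 \in tU T' m (l - 1 - p) (l - 1)].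
  by apply: tU_split => //; rewrite -lm.
(* The sum defining U^(l-p-1) at weight l - 1 is the tail of the one defining U^(l-p) at weight l,
   so the two splittings of f x can be compared. *)
have y2U' : y2 \in tU T' m.+1 (l - p) l.
  rewrite /= -[y2]add0r memv_add ?mem0v //.
  by rewrite (_ : l - p - 1 = l - 1 - p) //; lia.
have fx1 : f x1 = y1.
  apply/eqP; rewrite -subr_eq0; apply/eqP/(tU_disjoint oT' pq m0').
    by rewrite memvB ?fF.
  have -> : f x1 - y1 = y2 - f x2.
    by apply/eqP; rewrite subr_eq addrAC [y2 + _]addrC -yE xE linearD addrK.
  by rewrite memvB ?tcompat_tU.
have fx2 : f x2 = y2 by apply: (addrI y1); rewrite -yE xE linearD /= fx1.
exists x1, x2; split=> //; first by rewrite fx1.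
have x2F : x2 \in tF T p.
  by rewrite -[x2](addKr x1) -xE addrC memvB // (tF_ge oT _ x1F) // lerDl.
move: x2U => /= /memv_addP[g]; rewrite memv_cap => /andP[gG gW] [u uU x2E].
have uW := tU_W oT uU.
(* A second splitting, with p and l - p opposed at weight l - 1. Its F^p part [u1] is the element of
   W_(l-1) having the same image as [x2]. *)
have [u1 [u2 [uE u1F u1W u2U]]] : exists x1 x2, [/\ u = x1 + x2, x1 \in tF T p,
    x1 \in tW T (l - 1) & x2 \in tU T m (l - p) (l - 1)].
  by apply: tU_split => //; rewrite -lm.
exists u1 => //; apply/eqP; rewrite -subr_eq0 -linearB -oppr_eq0 -linearN opprB; apply/eqP.
have zE : x2 - u1 = g + u2 by rewrite x2E uE [u1 + _]addrC addrA addrK.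
apply: (tU_disjoint oT' (m := m) pq2); first by rewrite -lm.
  by rewrite fF // memvB.
rewrite zE linearD /=.
have fgW : f g \in tW T' (l - 1).
  have -> : g = x2 - u by rewrite x2E addrK.
  by rewrite linearB /= fx2 memvB ?fW // (tU_W oT' y2U).
case: m m0 m0' lm u2U {y2U y2U' uU uE} => [|m] m0 m0' lm u2U.
  move: fgW u2U; rewrite -[l - 1]subr0 -lm m0' !memv0 => /eqP -> /eqP ->.
  by rewrite linear0 addr0.
move: u2U => /= /memv_addP[g']; rewrite memv_cap => /andP[g'G g'W] [u' u'U ->].
rewrite linearD /= addrA memv_add ?tcompat_tU // memv_cap memvD ?fG //=.
by rewrite memvD // fW.
Qed.

(** Each use of [strictW_step] splits off a part whose image comes from W_(l-1) and raises the Hodge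
    index of the rest, until F^hi = 0. *)
Lemma strictW1 l x : x \in tW T l -> f x \in tW T' (l - 1) ->
  exists2 x', x' \in tW T (l - 1) & f x' = f x.
Proof.
have [lo loP] := tF_low oT; have [hi hiP] := tF_high oT.
have [m mlo] : exists m : nat, hi - m%:Z <= lo by exists `|hi - lo|%N; lia.
have : x \in tF T (hi - m%:Z) by exact: loP.
elim: m x {mlo} => [|m IHm] x xF xW fxW.
  exists 0; first exact: mem0v.
  by move: xF; rewrite subr0 hiP // memv0 => /eqP ->.
have [x1 [x2 [-> x1F x1W fx1W [y yW fy]]]] := strictW_step xF xW fxW.
have [|//|//|z zW fz] := IHm x1; first by apply: (tF_ge oT) x1F; lia.
by exists (z + y); rewrite ?memvD // !linearD /= fz fy.
Qed.

Lemma strictW l x : f x \in tW T' l -> exists2 x', x' \in tW T l & f x' = f x.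
Proof.
move=> fxW; have [hi hiP] := tW_high oT.
have [m lm] : exists m : nat, hi <= l + m%:Z by exists `|hi - l|%N; lia.
have: x \in tW T (l + m%:Z) by exact: hiP.
elim: m x fxW {lm} => [|m IHm] x fxW xW; first by exists x; rewrite // -[l]addr0.
have [|y yW fy] := strictW1 xW.
  by apply: (tW_le oT') fxW; lia.
have [|//|z zW fz] := IHm y.
- by rewrite fy.
- by apply: (tW_le oT) yW; lia.
by exists z; rewrite // fz.
Qed.

End Strictness.

(** * Kernels, cokernels and direct sums of opposed filtrations *)

Definition tpreim (K : fieldType) (U V : vectType K) (i : 'Hom(U, V)) (T : trifil V) : trifil U :=
  Trifil (fun k => i @^-1: tW T k)%VS (fun k => i @^-1: tF T k)%VS (fun k => i @^-1: tG T k)%VS.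

Definition timg (K : fieldType) (U V : vectType K) (q : 'Hom(U, V)) (T : trifil U) : trifil V :=
  Trifil (fun k => q @: tW T k)%VS (fun k => q @: tF T k)%VS (fun k => q @: tG T k)%VS.

Lemma bounded_preim (K : fieldType) (U V : vectType K) (i : 'Hom(U, V)) (E : int -> {vspace V}) :
  injective i -> bounded_filtration E -> bounded_filtration (fun k => i @^-1: E k)%VS.
Proof.
move=> inj [[k k0] [l lT]]; split; [exists k | exists l]; apply/vspaceP => x; rewrite -memv_preim.
  by rewrite k0 !memv0 -(inj_eq inj) linear0.
by rewrite lT !memvf.
Qed.

Lemma bounded_img (K : fieldType) (U V : vectType K) (q : 'Hom(U, V)) (E : int -> {vspace U}) :
  (forall y, exists x, q x = y) -> bounded_filtration E ->
  bounded_filtration (fun k => q @: E k)%VS.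
Proof.
move=> sur [[k k0] [l lT]]; split; [exists k | exists l]; first by rewrite k0 limg0.
by apply/vspaceP => y; have [x <-] := sur y; rewrite lT memv_img !memvf.
Qed.

Lemma disjoint_type_preim (K : fieldType) (U V : vectType K) (i : 'Hom(U, V)) (T : trifil V) k p q :
  disjoint_type T k p q -> disjoint_type (tpreim i T) k p q.
Proof.
move=> dT x y /=; rewrite -!memv_preim linearB /=; exact: dT.
Qed.

Section KernelCokernel.
Variables (K : fieldType) (V V' : vectType K) (T : trifil V) (T' : trifil V').
Variable f : 'Hom(V, V').
Hypotheses (oT : opposed T) (oT' : opposed T') (fT : tcompat T T' f).

Let fF k x : x \in tF T k -> f x \in tF T' k. Proof. by case: (fT k x). Qed.

Lemma tU_split_ker k p q x : p + q = k + 1 -> x \in tW T k -> f x = 0 ->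
  exists x1 x2 g, [/\ x = x1 + x2, f x1 = 0, x1 \in tF T p, x1 \in tW T k &
    [/\ g \in tG T q, g \in tW T k & x2 - g \in tW T (k - 1)]].
Proof.
move=> pq xW fx; have [[|m] [m0 m0']] := common_low oT oT' k.
  move: xW; rewrite -[k]subr0 m0 memv0 => /eqP ->.
  by exists 0, 0, 0; rewrite !(addr0, subr0) linear0 !mem0v.
have [x1 [x2 [xE x1F x1W x2U]]] := tU_split oT pq m0 xW.
have fx1 : f x1 = 0.
  apply: (tU_disjoint oT' pq m0'); first exact: fF.
  have -> : f x1 = - f x2 by apply/eqP; rewrite -addr_eq0 -linearD /= -xE fx.
  by rewrite memvN (tcompat_tU fT).
move: x2U => /= /memv_addP[g]; rewrite memv_cap => /andP[gG gW] [u /(tU_W oT) uW x2E].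
exists x1, x2, g; split=> //; split=> //.
by rewrite x2E addrAC subrr add0r.
Qed.

End KernelCokernel.

Lemma tcompat_swap (K : fieldType) (V V' : vectType K) (T : trifil V) (T' : trifil V')
    (f : 'Hom(V, V')) : tcompat T T' f -> tcompat (tswap T) (tswap T') f.
Proof. by move=> fT k x; have [] := fT k x. Qed.

Section Kernel.
Variables (K : fieldType) (U V V' : vectType K) (T : trifil V) (T' : trifil V').
Variables (i : 'Hom(U, V)) (f : 'Hom(V, V')).
Hypotheses (oT : opposed T) (oT' : opposed T') (fT : tcompat T T' f).
Hypotheses (i_inj : injective i) (iK : forall x, f x = 0 <-> exists u, i u = x).

Lemma opposed_ker : opposed (tpreim i T).
Proof.
have preimS (A B : {vspace V}) : (A <= B)%VS -> (i @^-1: A <= i @^-1: B)%VS.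
  by move=> /subvP AB; apply/subvP => x; rewrite -!memv_preim; exact: AB.
split=> /=.
- by move=> k l /(opW oT)/preimS.
- by move=> k l /(opF oT)/preimS.
- by move=> k l /(opG oT)/preimS.
- exact/bounded_preim/(opWb oT).
- exact/bounded_preim/(opFb oT).
- exact/bounded_preim/(opGb oT).
- move=> k p q pq u; rewrite -memv_preim => uW.
  have fu : f (i u) = 0 by apply/iK; exists u.
  have [x1 [x2 [g [xE fx1 x1F x1W [gG gW x2g]]]]] := tU_split_ker oT oT' fT pq uW fu.
  have qp : q + p = k + 1 by rewrite addrC.
  have [y1 [y2 [h [yE fy1 y1G y1W [hF hW y2h]]]]] :=
    tU_split_ker (opposed_swap oT) (opposed_swap oT') (tcompat_swap fT) qp uW fu.
  move: y1G y1W hF hW y2h => /= y1G y1W hF hW y2h.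
  have [u1 u1E] := (iK x1).1 fx1; have [v1 v1E] := (iK y1).1 fy1.
  have y2E : y2 - x1 = x2 - y1.
    by apply/eqP; rewrite subr_eq addrAC -[x2 + x1]addrC -xE yE addrAC subrr add0r.
  (* From x = x1 + x2 = y1 + y2 one gets x - x1 - y1 = x2 - y1 = y2 - x1. Modulo W_(k-1) this
     element is g - y1, in G^q, and also h - x1, in F^p, so it vanishes there. Thus [x1] and [y1],
     both from ker f, are the required summands. *)
  have x2y : h - x1 \in tW T (k - 1).
    apply: (op_cap oT pq (y := g - y1)); try exact: memvB.
    have -> : h - x1 - (g - y1) = (x2 - g) - (y2 - h).
      have -> : x2 = y2 - x1 + y1 by rewrite y2E subrK.
      by rewrite !opprB [RHS](AC (4*2) ((5*2)*(3*4)*(1*6))) /= subrr addr0.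
    exact: memvB.
  exists u1, v1, (u - u1 - v1); rewrite -!memv_preim !linearB /= u1E v1E.
  split=> //; first by rewrite -[u - u1 - v1]addrA -opprD [RHS]addrC subrK.
  have -> : i u - x1 - y1 = (y2 - h) + (h - x1).
    by rewrite addrA subrK y2E xE [x1 + _]addrC addrK.
  exact: memvD.
- by move=> k p q /(op_cap oT); exact: disjoint_type_preim.
Qed.

End Kernel.

(** The [d] new leading summands receive zero. This allows splittings made at different weights to
    be compared. *)
Lemma tU_shift (K : fieldType) (V : vectType K) (T : trifil V) m b l x (d : nat) :
  x \in tU T m b l -> x \in tU T (d + m) (b + d%:Z) (l + d%:Z).
Proof.
elim: d => [|d IHd] xU; first by rewrite !addr0.
rewrite addSn /= -[x]add0r memv_add ?mem0v //.
have -> : b + d.+1%:Z - 1 = b + d%:Z by lia.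
have -> : l + d.+1%:Z - 1 = l + d%:Z by lia.
exact: IHd.
Qed.

Section Cokernel.
Variables (K : fieldType) (V V' Q : vectType K) (T : trifil V) (T' : trifil V').
Variables (f : 'Hom(V, V')) (q : 'Hom(V', Q)).
Hypotheses (oT : opposed T) (oT' : opposed T') (fT : tcompat T T' f).
Hypotheses (qK : forall y, q y = 0 <-> exists x, f x = y).

Let fF k x : x \in tF T k -> f x \in tF T' k. Proof. by case: (fT k x). Qed.

(** On the quotient, being in the images of F^p and of W_k separately must be realised by one
    representative. Split w at weight k, and split z, with f z = a - w, at a weight where W is
    everything. Then a - w1 - f z1 = w2 + f z2 is in F^p and in a complement of it, so it is zero,
    and w1 serves as [b]. *)
Lemma coker_lift p k a w : a \in tF T' p -> w \in tW T' k -> q a = q w ->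
  exists2 b, b \in tF T' p /\ b \in tW T' k & q b = q a.
Proof.
move=> aF wW qaw; have [m [m0 m0']] := common_low oT oT' k.
have [L [LT LT']] := common_high oT oT'.
have [d kd] : exists d : nat, L <= k + d%:Z by exists `|L - k|%N; lia.
have pk : p + (k + 1 - p) = k + 1 by rewrite addrC subrK.
have pd : p + (k + 1 - p + d%:Z) = k + d%:Z + 1 by lia.
have md : k + d%:Z - (d + m)%N%:Z = k - m%:Z by lia.
have [w1 [w2 [wE w1F w1W w2U]]] := tU_split oT' pk m0' wW.
have [z zE] : exists z, f z = a - w by apply/qK; rewrite linearB /= qaw subrr.
have [|z1 [z2 [z12 z1F _ z2U]]] := tU_split (x := z) (m := (d + m)%N) oT pd _ (tW_le oT kd (LT z)).
  by rewrite md.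
suff aE : a - w1 - f z1 = 0.
  exists w1 => //; apply/esym/eqP; rewrite -subr_eq0 -linearB; apply/eqP/qK.
  by exists z1; apply/esym/eqP; rewrite -subr_eq0 aE.
apply: (tU_disjoint (m := (d + m)%N) oT' pd); first by rewrite md.
  by rewrite !memvB ?fF.
have -> : a - w1 - f z1 = w2 + f z2.
  apply/eqP; rewrite subr_eq -addrA -linearD /= [z2 + _]addrC -z12 zE wE.
  by rewrite opprD addrCA [w2 + _]addrC subrK.
by apply: memvD; [exact: tU_shift | exact: (tcompat_tU fT)].
Qed.

End Cokernel.

Section CokernelOpposed.
Variables (K : fieldType) (V V' Q : vectType K) (T : trifil V) (T' : trifil V').
Variables (f : 'Hom(V, V')) (q : 'Hom(V', Q)).
Hypotheses (oT : opposed T) (oT' : opposed T') (fT : tcompat T T' f).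
Hypotheses (q_surj : forall y, exists x, q x = y) (qK : forall y, q y = 0 <-> exists x, f x = y).

Let fW k x : x \in tW T k -> f x \in tW T' k. Proof. by case: (fT k x). Qed.
Let fF k x : x \in tF T k -> f x \in tF T' k. Proof. by case: (fT k x). Qed.
Let fG k x : x \in tG T k -> f x \in tG T' k. Proof. by case: (fT k x). Qed.

(** The lifts a and b agree modulo W_(k-1) only up to some f z. Strictness for W moves z into W_k,
    where it splits as z1 + z2 + z3. Then a - f z1 in F^p is congruent to b + f z2 in G^r, so both
    lie in W_(k-1), and a - f z1 has the same class as a. *)
Lemma disjoint_type_coker k p r : p + r = k + 1 -> disjoint_type (timg q T') k p r.
Proof.
move=> pr _ _ /memv_imgP[a0 a0F ->] /memv_imgP[w0 w0W aE] /memv_imgP[b0 b0G ->]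
  /memv_imgP[w1 w1W bE] /memv_imgP[w wW wE].
have [a [aF aW] qa] := coker_lift oT oT' fT qK a0F w0W aE.
have [b [bG bW] qb] := coker_lift (opposed_swap oT) (opposed_swap oT') (tcompat_swap fT)
  qK b0G w1W bE.
move: bG bW => /= bG bW.
rewrite -qa -qb in wE *.
have [z zE] : exists z, f z = a - b - w by apply/qK; rewrite !linearB /= wE subrr.
have fzW : f z \in tW T' k by rewrite zE !memvB // (tW_pred oT').
have [z' z'W z'E] := strictW oT oT' fT fzW.
have [z1 [z2 [z3 [zz [z1F z1W] [z2G z2W] z3W]]]] := op_sum oT pr z'W.
have aW' : a - f z1 \in tW T' (k - 1).
  apply: (op_cap oT' pr (y := b + f z2));
    try by [apply: memvB => //; apply: fF | apply: memvB => //; apply: fW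
           | apply: memvD => //; apply: fG | apply: memvD => //; apply: fW].
  have -> : a - f z1 - (b + f z2) = w + f z3.
    have -> : a = f z + w + b by rewrite zE subrK subrK.
    rewrite -z'E zz !linearD /=.
    by rewrite (AC (6*2) ((4*3)*(1*6)*(2*8)*(5*7))) /= !subrr !addr0.
  by rewrite memvD ?fW.
apply/memv_imgP; exists (a - f z1) => //.
by rewrite linearB /= (_ : q (f z1) = 0) ?subr0 //; apply/qK; exists z1.
Qed.

Lemma opposed_coker : opposed (timg q T').
Proof.
split=> /=.
- by move=> k l /(opW oT')/limgS.
- by move=> k l /(opF oT')/limgS.
- by move=> k l /(opG oT')/limgS.
- exact/bounded_img/(opWb oT').
- exact/bounded_img/(opFb oT').
- exact/bounded_img/(opGb oT').
- move=> k p r pr _ /memv_imgP[x xW ->].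
  have [x1 [x2 [x3 [-> [? ?] [? ?] ?]]]] := op_sum oT' pr xW.
  by exists (q x1), (q x2), (q x3); rewrite !linearD !memv_img.
- exact: disjoint_type_coker.
Qed.

(** When p + r = k, disjointness says that the Hodge type (p,r) is absent. Split a lift a along
    F^(p+1) and G^r. The difference a - x1 is of type (p,r), hence in W_(k-1), so the class of a may
    be replaced by that of x1 in F^(p+1), and p + 1 and r are opposed in the cokernel. *)
Lemma disjoint_type_coker' k p r : p + r = k -> disjoint_type T' k p r ->
  disjoint_type (timg q T') k p r.
Proof.
move=> pr dT _ y /memv_imgP[a0 a0F ->] /memv_imgP[w0 w0W aE] yG yW xy.
have [a [aF aW] qa] := coker_lift oT oT' fT qK a0F w0W aE.
rewrite -qa in xy *.
have pr1 : (p + 1) + r = k + 1 by rewrite addrAC pr.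
have [x1 [x2 [x3 [aE' [x1F x1W] [x2G x2W] x3W]]]] := op_sum oT' pr1 aW.
have ax : a - x1 \in tW T' (k - 1).
  apply: (dT (a - x1) x2) => //.
  - by apply: memvB => //; apply: (tF_ge oT') x1F; rewrite lerDl.
  - exact: memvB.
  - by rewrite aE' (AC (3*1*1) (3*(1*4)*(2*5))) /= !subrr !addr0.
have qax : q (a - x1) \in (q @: tW T' (k - 1))%VS by exact: memv_img.
rewrite -[a](subrK x1) linearD /= memvD //=.
apply: (op_cap opposed_coker pr1 (y := y)) => //=; rewrite ?memv_img //.
have -> : q x1 - y = (q a - y) - q (a - x1).
  by rewrite linearB /= opprB [RHS](AC (2*2) ((3*2)*(1*4))) /= subrr addr0.
exact: memvB.
Qed.

End CokernelOpposed.

(** A direct sum is described by its maps because a tensor product with a product of groups, or its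
    quotient by F^i, is not literally a product. *)
Record biprod (K : fieldType) (V V' P : vectType K) (p1 : 'Hom(P, V)) (p2 : 'Hom(P, V'))
    (i1 : 'Hom(V, P)) (i2 : 'Hom(V', P)) : Prop := Biprod {
  bp11 : forall x, p1 (i1 x) = x;
  bp22 : forall x, p2 (i2 x) = x;
  bp12 : forall x, p1 (i2 x) = 0;
  bp21 : forall x, p2 (i1 x) = 0;
  bpD : forall x, i1 (p1 x) + i2 (p2 x) = x }.

Section Sum.
Variables (K : fieldType) (V V' P : vectType K).
Variables (p1 : 'Hom(P, V)) (p2 : 'Hom(P, V')) (i1 : 'Hom(V, P)) (i2 : 'Hom(V', P)).
Hypothesis bp : biprod p1 p2 i1 i2.
Variables (T : trifil V) (T' : trifil V').

Definition vsum (A : {vspace V}) (B : {vspace V'}) := (i1 @: A + i2 @: B)%VS.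

Lemma memv_vsum (A : {vspace V}) (B : {vspace V'}) x :
  (x \in vsum A B) = (p1 x \in A) && (p2 x \in B).
Proof.
apply/idP/andP => [/memv_addP[_ /memv_imgP[a aA ->] [_ /memv_imgP[b bB ->] ->]]|[xA xB]].
  by rewrite !linearD /= (bp11 bp) (bp22 bp) (bp12 bp) (bp21 bp) addr0 add0r.
by rewrite -(bpD bp x) memv_add ?memv_img.
Qed.

Definition tsumf := Trifil (fun k => vsum (tW T k) (tW T' k))
  (fun k => vsum (tF T k) (tF T' k)) (fun k => vsum (tG T k) (tG T' k)).

Lemma disjoint_type_sum k p r : disjoint_type T k p r -> disjoint_type T' k p r ->
  disjoint_type tsumf k p r.
Proof.
move=> dT dT' x y /=; rewrite !memv_vsum !linearB /=.
move=> /andP[xF xF'] /andP[xW xW'] /andP[yG yG'] /andP[yW yW'] /andP[xy xy'].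
by rewrite (dT _ _ xF xW yG yW xy) (dT' _ _ xF' xW' yG' yW' xy').
Qed.

Lemma vsumS A A' B B' : (A <= A')%VS -> (B <= B')%VS -> (vsum A B <= vsum A' B')%VS.
Proof.
by move=> /subvP AA /subvP BB; apply/subvP => x; rewrite !memv_vsum => /andP[/AA -> /BB ->].
Qed.

(** The two alternatives serve W and F, G respectively. Monotonicity brings the bounds of the two
    summands to a common index. *)
Lemma bounded_vsum E E' :
  (forall k l : int, k <= l -> (E k <= E l)%VS /\ (E' k <= E' l)%VS) \/
  (forall k l : int, k <= l -> (E l <= E k)%VS /\ (E' l <= E' k)%VS) ->
  bounded_filtration E -> bounded_filtration E' ->
  bounded_filtration (fun k => vsum (E k) (E' k)).
Proof.
move=> mon [[a aE] [b bE]] [[a' aE'] [b' bE']].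
have vsum0 k : (E k <= 0)%VS -> (E' k <= 0)%VS -> vsum (E k) (E' k) = 0%VS.
  by rewrite !subv0 /vsum => /eqP -> /eqP ->; rewrite !limg0 addv0.
have vsumT k : (fullv <= E k)%VS -> (fullv <= E' k)%VS -> vsum (E k) (E' k) = fullv.
  move=> /subvP k1 /subvP k2; apply/vspaceP => x.
  by rewrite memv_vsum k1 ?memvf ?k2 ?memvf.
case: mon => mon; split.
- exists (Num.min a a'); apply: vsum0; rewrite -?aE -?aE'.
    by apply: (mon _ _ _).1; rewrite ge_min lexx.
  by apply: (mon _ _ _).2; rewrite ge_min lexx orbT.
- exists (Num.max b b'); apply: vsumT; rewrite -?bE -?bE'.
    by apply: (mon _ _ _).1; rewrite le_max lexx.
  by apply: (mon _ _ _).2; rewrite le_max lexx orbT.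
- exists (Num.max a a'); apply: vsum0; rewrite -?aE -?aE'.
    by apply: (mon _ _ _).1; rewrite le_max lexx.
  by apply: (mon _ _ _).2; rewrite le_max lexx orbT.
- exists (Num.min b b'); apply: vsumT; rewrite -?bE -?bE'.
    by apply: (mon _ _ _).1; rewrite ge_min lexx.
  by apply: (mon _ _ _).2; rewrite ge_min lexx orbT.
Qed.

Lemma opposed_sum : opposed T -> opposed T' -> opposed tsumf.
Proof.
move=> oT oT'; split=> /=.
- by move=> k l kl; apply: vsumS; [apply: (opW oT) | apply: (opW oT')].
- by move=> k l kl; apply: vsumS; [apply: (opF oT) | apply: (opF oT')].
- by move=> k l kl; apply: vsumS; [apply: (opG oT) | apply: (opG oT')].
- apply: bounded_vsum (opWb oT) (opWb oT'); left=> k l kl.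
  by split; [apply: (opW oT) | apply: (opW oT')].
- apply: bounded_vsum (opFb oT) (opFb oT'); right=> k l kl.
  by split; [apply: (opF oT) | apply: (opF oT')].
- apply: bounded_vsum (opGb oT) (opGb oT'); right=> k l kl.
  by split; [apply: (opG oT) | apply: (opG oT')].
- move=> k p r pr x; rewrite memv_vsum => /andP[xW xW'].
  have [x1 [x2 [x3 [xE [? ?] [? ?] ?]]]] := op_sum oT pr xW.
  have [y1 [y2 [y3 [yE [? ?] [? ?] ?]]]] := op_sum oT' pr xW'.
  have mem (A : {vspace V}) (B : {vspace V'}) a b : a \in A -> b \in B ->
      i1 a + i2 b \in vsum A B.
    by move=> aA bB; rewrite memv_add ?memv_img.
  exists (i1 x1 + i2 y1), (i1 x2 + i2 y2), (i1 x3 + i2 y3).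
  split; [|by split; apply: mem|by split; apply: mem|exact: mem].
  by rewrite -(bpD bp x) xE yE !linearD /= addrACA [X in X + _]addrACA.
- move=> k p r pr; apply: disjoint_type_sum; [exact: op_cap | exact: op_cap].
Qed.

End Sum.

(** * Mixed Hodge structures *)

Lemma numDomain_char0 (K : numDomainType) (m : int) : m != 0 -> m%:~R != 0 :> K.
Proof. by rewrite intr_eq0. Qed.

Lemma tmap_exactP (K : numFieldType) (A B D : fgZmodType) (f : {additive A -> B})
    (g : {additive B -> D}) :
  (forall y, g y = 0 <-> exists x, f x = y) ->
  forall v, tmap K g v = 0 <-> exists u, tmap K f u = v.
Proof.
move=> fg v; split=> [/eqP|[u <-]].
  rewrite -memv_ker => vK; have fg' y : g y = 0 -> exists x, f x = y by move=> /fg.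
  have /subvP/(_ _ vK)/memv_imgP[u _ ->] := tmap_exact (@numDomain_char0 K) fg'.
  by exists u.
rewrite -comp_lfunE -tmap_comp.
suff -> : g \o f = 0 :> {additive A -> D} by rewrite tmap0 zero_lfunE.
by apply: additiveP => x /=; apply/fg; exists x.
Qed.

Lemma biprod_group (A B : fgZmodType) :
  exists (P : fgZmodType) (p1 : {additive P -> A}) (p2 : {additive P -> B})
    (i1 : {additive A -> P}) (i2 : {additive B -> P}),
  [/\ forall x, p1 (i1 x) = x, forall x, p2 (i2 x) = x,
      forall x, p1 (i2 x) = 0, forall x, p2 (i1 x) = 0
    & forall x, i1 (p1 x) + i2 (p2 x) = x].
Proof.
pose P : fgZmodType := HB.pack (A * B)%type
  (isFinGen.Build (A * B)%type (finitely_generated_prod (@fingenP A) (@fingenP B))).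
have [x y|p1 p1E] := @additive_of P A fst; first by [].
have [x y|p2 p2E] := @additive_of P B snd; first by [].
have [x y|i1 i1E] := @additive_of A P (fun x => (x, 0)); first by congr pair; rewrite /= subr0.
have [x y|i2 i2E] := @additive_of B P (fun x => (0, x)); first by congr pair; rewrite /= subr0.
exists P, p1, p2, i1, i2; split=> x; rewrite ?i1E ?i2E ?p1E ?p2E //.
by case: x => x y; congr pair; rewrite /= ?addr0 ?add0r.
Qed.

Lemma biprod_tmap (K : fieldType) (A B P : fgZmodType)
    (p1 : {additive P -> A}) (p2 : {additive P -> B})
    (i1 : {additive A -> P}) (i2 : {additive B -> P}) :
  [/\ forall x, p1 (i1 x) = x, forall x, p2 (i2 x) = x,
      forall x, p1 (i2 x) = 0, forall x, p2 (i1 x) = 0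
    & forall x, i1 (p1 x) + i2 (p2 x) = x] ->
  biprod (tmap K p1) (tmap K p2) (tmap K i1) (tmap K i2).
Proof.
case=> b11 b22 b12 b21 bD; split=> x.
- rewrite -comp_lfunE -tmap_comp -[RHS](id_lfunE x) -tmap_id; congr (tmap K _ x).
  exact: additiveP.
- rewrite -comp_lfunE -tmap_comp -[RHS](id_lfunE x) -tmap_id; congr (tmap K _ x).
  exact: additiveP.
- rewrite -comp_lfunE -tmap_comp -[RHS](zero_lfunE _ x) -tmap0; congr (tmap K _ x).
  exact: additiveP.
- rewrite -comp_lfunE -tmap_comp -[RHS](zero_lfunE _ x) -tmap0; congr (tmap K _ x).
  exact: additiveP.
- rewrite -!comp_lfunE -!tmap_comp -add_lfunE -tmapD -[RHS](id_lfunE x) -tmap_id.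
  congr (tmap K _ x); exact: additiveP.
Qed.

Section MixedHodgeTheory.
Variable R : realType.
Local Notation C := (Cplx R).

Section Trifil.
Variable H : filtered R.

Definition tri : trifil (tens C H) := Trifil (WC H) (fil_F H) (Fbar H).

Lemma memv_gr k (U : {vspace tens C H}) y :
  y \in gr k U -> exists x, [/\ x \in U, x \in WC H k & y = vproj (WC H (k - 1)) x].
Proof. by move=> /memv_imgP[x]; rewrite memv_cap => /andP[xU xW] ->; exists x. Qed.

Lemma gr_mem k (U : {vspace tens C H}) x :
  x \in U -> x \in WC H k -> vproj (WC H (k - 1)) x \in gr k U.
Proof. by move=> xU xW; rewrite memv_img // memv_cap xU. Qed.

Lemma disjoint_typeP k p q :
  disjoint_type tri k p q <-> (GrF H p k :&: GrFbar H q k)%VS = 0%VS.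
Proof.
split=> [dT|d0 x y xF xW yG yW xy].
  apply/eqP; rewrite -subv0; apply/subvP => z; rewrite memv_cap memv0.
  move=> /andP[/memv_gr[x [xF xW ->]] /memv_gr[y [yG yW /eqP]]].
  rewrite -subr_eq0 -linearB !vproj_eq0; exact: dT.
rewrite -[_ \in _]vproj_eq0 -memv0 -d0 memv_cap gr_mem //=.
suff -> : vproj (WC H (k - 1)) x = vproj (WC H (k - 1)) y by exact: gr_mem.
by apply/eqP; rewrite -subr_eq0 -linearB vproj_eq0.
Qed.

(** The contrapositive form is the one that passes to kernels, cokernels and sums, one type at a
    time. *)
Lemma level_leP n : level_le H n <->
  forall p q : int, ~~ ((0 <= p <= n%:Z) && (0 <= q <= n%:Z)) -> disjoint_type tri (p + q) p q.
Proof.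
split=> [lev p q|dis p q].
  move=> pq; apply/disjoint_typeP; apply: contraNeq pq => /lev[-> ->]; by [].
move=> /negP h; apply/andP/negP => /negP/dis/disjoint_typeP; apply/eqP.
by apply/negP.
Qed.

(** The conditions on the rational W follow from those on its complexification because base change
    is faithful; those on the conjugate filtration follow from those on F by base change along
    conjugation. *)
Lemma is_mhsP : is_mhs H <-> opposed tri.
Proof.
split=> [[Wi [k0 W0] [k1 W1] Fd FT F0 pure]|oT].
  split=> //=.
  - move=> k l kl; exact: (vcoefS _ (Wi _ _ kl)).
  - move=> k l kl; exact: (vcoefS _ (Fd _ _ kl)).
  - by split; [exists k0; rewrite /WC W0 vcoef0 | exists k1; rewrite /WC W1 vcoefT].
  - case: F0 FT => [p0 F0] [p1 F1].
    by split; [exists p0; rewrite /Fbar F0 vcoef0 | exists p1; rewrite /Fbar F1 vcoefT].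
  - move=> k p q pq x xW.
    have /memv_addP[_ /memv_gr[x1 [x1F x1W ->]] [_ /memv_gr[x2 [x2G x2W ->]]]] :
        vproj (WC H (k - 1)) x \in (GrF H p k + GrFbar H q k)%VS.
      rewrite (_ : q = k + 1 - p) ?(pure k p).1 ?gr_mem ?memvf //.
      by rewrite -pq addrAC subrr add0r.
    move=> /eqP; rewrite -linearD -subr_eq0 -linearB vproj_eq0 => xx.
    by exists x1, x2, (x - (x1 + x2)); rewrite addrC subrK.
  - move=> k p q pq; apply/disjoint_typeP.
    rewrite (_ : q = k + 1 - p) ?(pure k p).2 //.
    by rewrite -pq addrAC subrr add0r.
split.
- move=> k l /(opW oT)/subvP kl; apply/subvP => u uW.
  by rewrite -(memv_vcoef (ratr : {rmorphism rat -> C})); apply/kl/mem_vcoef.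
- have [[k k0] _] := opWb oT; exists k; apply/eqP; rewrite -subv0; apply/subvP => u uW.
  rewrite memv0; apply/eqP/(@tcoef_eq0 _ C ratr)/eqP; rewrite -memv0 -k0; exact: mem_vcoef.
- have [_ [k kT]] := opWb oT; exists k; apply/vspaceP => u.
  by rewrite -(memv_vcoef (ratr : {rmorphism rat -> C})) -/(WC H k) [WC H k]kT !memvf.
- exact: (opF oT).
- by have [_] := opFb oT.
- by have [] := opFb oT.
- move=> k p; split; last by apply/disjoint_typeP/(op_cap oT); rewrite addrC subrK.
  apply/eqP; rewrite eqEsubv; apply/andP; split.
    by rewrite subv_add !limgS // capvS ?subvf.
  apply/subvP => _ /memv_gr[x [_ xW ->]].
  have [|x1 [x2 [x3 [-> [x1F x1W] [x2G x2W] x3W]]]] := op_sum oT (p := p) (q := k + 1 - p) _ xW.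
    by rewrite addrC subrK.
  have v3 : vproj (WC H (k - 1)) x3 = 0 by apply/eqP; rewrite vproj_eq0.
  have -> : vproj (WC H (k - 1)) (x1 + x2 + x3) =
      vproj (WC H (k - 1)) x1 + vproj (WC H (k - 1)) x2.
    by rewrite linearD /= v3 addr0 linearD.
  by rewrite memv_add // gr_mem.
Qed.

End Trifil.

(** A map coming from the integral groups commutes with every change of coefficients. One argument
    thus covers W, with the inclusion of the rationals, and the conjugate of F, with conjugation. *)
Lemma mhs_tcompat n (X Y : mhs R n) (f : mhs_hom X Y) : tcompat (tri X) (tri Y) (tmap C f).
Proof.
have vc (K : fieldType) (s : {rmorphism K -> C}) (U : {vspace tens K X})
      (U' : {vspace tens K Y}) x :
    (forall u, u \in U -> tmap K f u \in U') -> x \in vcoef s U -> tmap C f x \in vcoef s U'.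
  move=> fU xU; have UU : (tmap K f @: U <= U')%VS.
    by apply/subvP => _ /memv_imgP[u /fU uU ->].
  by apply: (subvP (vcoefS s UU)); rewrite vcoef_img memv_img.
case: (mhs_addP f) => fW fF k x.
split; [exact/vc/fW | exact: fF | exact/vc/fF].
Qed.

Section MhsStrictness.
Variables (n : nat) (X Y : mhs R n) (f : mhs_hom X Y).

Lemma mhs_strictF p v : tmap C f v \in fil_F Y p ->
  exists2 u, u \in fil_F X p & tmap C f u = tmap C f v.
Proof.
exact: (strictF ((is_mhsP X).1 (mhsP X)) ((is_mhsP Y).1 (mhsP Y)) (mhs_tcompat f)).
Qed.

(** Strictness holds over C; the image of W_k is the base change of a rational subspace, so
    membership in it descends. *)
Lemma mhs_strictW k v : tmap rat f v \in fil_W Y k ->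
  exists2 u, u \in fil_W X k & tmap rat f u = tmap rat f v.
Proof.
pose s : {rmorphism rat -> C} := ratr.
move=> /(mem_vcoef s); rewrite -tmap_coef.
move=> /(strictW ((is_mhsP X).1 (mhsP X)) ((is_mhsP Y).1 (mhsP Y)) (mhs_tcompat f))[u uW uE].
have : tcoef s (tmap rat f v) \in vcoef s (tmap rat f @: fil_W X k).
  by rewrite -tmap_coef -uE vcoef_img memv_img.
by rewrite memv_vcoef => /memv_imgP[w wW ->]; exists w.
Qed.

Lemma mhs_injF p v : injective f -> (tmap C f v \in fil_F Y p) = (v \in fil_F X p).
Proof.
move=> inj; apply/idP/idP; last exact: (mhs_addP f).2.
by move=> /mhs_strictF[u uF /(tmap_inj (@numDomain_char0 C) inj) <-].
Qed.

Lemma mhs_injW k v : injective f -> (tmap rat f v \in fil_W Y k) = (v \in fil_W X k).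
Proof.
move=> inj; apply/idP/idP; last exact: (mhs_addP f).1.
by move=> /mhs_strictW[u uF /(tmap_inj (@numDomain_char0 rat) inj) <-].
Qed.

Lemma mhs_surjF p w : (forall y, exists x, f x = y) -> w \in fil_F Y p ->
  exists2 v, v \in fil_F X p & tmap C f v = w.
Proof.
move=> sur wF; have [v vE] := tmap_surj sur w.
by move: wF; rewrite -vE => /mhs_strictF.
Qed.

Lemma mhs_surjW k w : (forall y, exists x, f x = y) -> w \in fil_W Y k ->
  exists2 v, v \in fil_W X k & tmap rat f v = w.
Proof.
move=> sur wF; have [v vE] := tmap_surj sur w.
by move: wF; rewrite -vE => /mhs_strictW.
Qed.

End MhsStrictness.

(** By strictness an injective morphism carries the induced filtrations, so a factorisation of the
    underlying groups respects W and F automatically. *)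
Lemma mhs_factor_inj n (X Y Z : mhs R n) (k : mhs_hom X Y) (g : mhs_hom Z Y) :
  injective k -> (forall z, exists x, k x = g z) ->
  exists u : mhs_hom Z X, forall z, k (u z) = g z.
Proof.
move=> inj ex; have [u uE] := additive_factor_inj inj ex.
have kuE (K : fieldType) v : tmap K k (tmap K u v) = tmap K g v.
  rewrite -comp_lfunE -tmap_comp; congr (tmap K _ v); exact: additiveP.
suff uP : mhs_compat u by exists (MhsHom uP).
split=> p v vP; [rewrite -(mhs_injW _ _ inj) | rewrite -(mhs_injF _ _ inj)]; rewrite kuE.
  exact: (mhs_addP g).1.
exact: (mhs_addP g).2.
Qed.

Lemma mhs_factor_surj n (X Y Z : mhs R n) (q : mhs_hom X Y) (g : mhs_hom X Z) :
  (forall y, exists x, q x = y) -> (forall x, q x = 0 -> g x = 0) ->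
  exists u : mhs_hom Y Z, forall x, u (q x) = g x.
Proof.
move=> sur qg; have [u uE] := additive_factor_surj sur qg.
have uqE (K : fieldType) v : tmap K u (tmap K q v) = tmap K g v.
  rewrite -comp_lfunE -tmap_comp; congr (tmap K _ v); exact: additiveP.
suff uP : mhs_compat u by exists (MhsHom uP).
split=> p w.
  by move=> /(mhs_surjW sur)[v vP <-]; rewrite uqE; apply: (mhs_addP g).1.
by move=> /(mhs_surjF sur)[v vP <-]; rewrite uqE; apply: (mhs_addP g).2.
Qed.

Lemma mhs_kernel n (X Y : mhs R n) (f : mhs_hom X Y) :
  exists (K : mhs R n) (k : mhs_hom K X),
    injective k /\ forall x, f x = 0 <-> exists y, k y = x.
Proof.
have [K [k [inj kE]]] := kernel_group f.
pose H := @Filtered R K (fun j => tmap rat k @^-1: fil_W X j)%VS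
  (fun j => tmap C k @^-1: fil_F X j)%VS.
(* Base change commutes with preimages, so the complexified W and the conjugate of F on the kernel
   are again preimages. *)
have triE : tri H = tpreim (tmap C k) (tri X).
  by congr Trifil; apply/funext => j; exact: vcoef_preim.
have oX := (is_mhsP X).1 (mhsP X); have oY := (is_mhsP Y).1 (mhsP Y).
have HP : is_mhs H.
  apply/is_mhsP; rewrite triE; apply: (opposed_ker oX oY (mhs_tcompat f)).
    exact: (tmap_inj (@numDomain_char0 C) inj).
  exact: (tmap_exactP kE).
have HL : level_le H n.
  apply/level_leP => p q pq; rewrite triE; apply: disjoint_type_preim.
  exact: ((level_leP X n).1 (@mhs_level _ _ X)).
have kP : @mhs_compat _ _ (Mhs HP HL) X k by split=> j x; rewrite -memv_preim.
by exists (Mhs HP HL), (MhsHom kP).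
Qed.

Lemma mhs_cokernel n (X Y : mhs R n) (f : mhs_hom X Y) :
  exists (Q : mhs R n) (q : mhs_hom Y Q),
    (forall y, exists x, q x = y) /\ forall y, q y = 0 <-> exists x, f x = y.
Proof.
have [Q [q [sur qE]]] := cokernel_group f.
pose H := @Filtered R Q (fun j => tmap rat q @: fil_W Y j)%VS
  (fun j => tmap C q @: fil_F Y j)%VS.
have triE : tri H = timg (tmap C q) (tri Y).
  by congr Trifil; apply/funext => j; exact: vcoef_img.
have oX := (is_mhsP X).1 (mhsP X); have oY := (is_mhsP Y).1 (mhsP Y).
have surC := tmap_surj (K := C) sur.
have exC := tmap_exactP (K := C) qE.
have HP : is_mhs H.
  by apply/is_mhsP; rewrite triE; exact: (opposed_coker oX oY (mhs_tcompat f) surC exC).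
have HL : level_le H n.
  apply/level_leP => p r pr; rewrite triE.
  apply: (disjoint_type_coker' oX oY (mhs_tcompat f) surC exC) => //.
  exact: ((level_leP Y n).1 (@mhs_level _ _ Y)).
have qP : @mhs_compat _ _ Y (Mhs HP HL) q by split=> j x xP; exact: memv_img.
by exists (Mhs HP HL), (MhsHom qP).
Qed.

Lemma mhs_biprod n (X Y : mhs R n) :
  exists (P : mhs R n) (p1 : mhs_hom P X) (p2 : mhs_hom P Y) (i1 : mhs_hom X P) (i2 : mhs_hom Y P),
  [/\ forall x, p1 (i1 x) = x, forall x, p2 (i2 x) = x,
      forall x, p1 (i2 x) = 0, forall x, p2 (i1 x) = 0
    & forall x, i1 (p1 x) + i2 (p2 x) = x].
Proof.
have [P [p1 [p2 [i1 [i2 bP]]]]] := biprod_group X Y.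
have bpQ := biprod_tmap rat bP; have bpC := biprod_tmap C bP.
pose H := @Filtered R P (fun j => vsum (tmap rat i1) (tmap rat i2) (fil_W X j) (fil_W Y j))%VS
  (fun j => vsum (tmap C i1) (tmap C i2) (fil_F X j) (fil_F Y j))%VS.
have triE : tri H = tsumf (tmap C i1) (tmap C i2) (tri X) (tri Y).
  by congr Trifil; apply/funext => j; rewrite /WC /Fbar /= vcoefD !vcoef_img.
have oX := (is_mhsP X).1 (mhsP X); have oY := (is_mhsP Y).1 (mhsP Y).
have HP : is_mhs H by apply/is_mhsP; rewrite triE; exact: (opposed_sum bpC oX oY).
have HL : level_le H n.
  apply/level_leP => p r pr; rewrite triE; apply: (disjoint_type_sum bpC).
    exact: ((level_leP X n).1 (@mhs_level _ _ X)).
  exact: ((level_leP Y n).1 (@mhs_level _ _ Y)).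
have p1P : @mhs_compat _ _ (Mhs HP HL) X p1.
  by split=> j x; rewrite (memv_vsum bpQ, memv_vsum bpC) => /andP[].
have p2P : @mhs_compat _ _ (Mhs HP HL) Y p2.
  by split=> j x; rewrite (memv_vsum bpQ, memv_vsum bpC) => /andP[].
have i1P : @mhs_compat _ _ X (Mhs HP HL) i1.
  split=> j x xP; rewrite (memv_vsum bpQ, memv_vsum bpC).
    by rewrite (bp11 bpQ) (bp21 bpQ) xP mem0v.
  by rewrite (bp11 bpC) (bp21 bpC) xP mem0v.
have i2P : @mhs_compat _ _ Y (Mhs HP HL) i2.
  split=> j x xP; rewrite (memv_vsum bpQ, memv_vsum bpC).
    by rewrite (bp12 bpQ) (bp22 bpQ) xP mem0v.
  by rewrite (bp12 bpC) (bp22 bpC) xP mem0v.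
by exists (Mhs HP HL), (MhsHom p1P), (MhsHom p2P), (MhsHom i1P), (MhsHom i2P).
Qed.

End MixedHodgeTheory.

(** * Formal Hodge structures *)

Section LfunFactor.
Variables (K : fieldType) (U V W : vectType K).

Lemma lfun_factor_inj (k : 'Hom(U, V)) (g : 'Hom(W, V)) :
  (forall w, exists u, k u = g w) -> forall w, k ((k^-1 \o g)%VF w) = g w.
Proof.
by move=> ex w; have [u uE] := ex w; rewrite comp_lfunE limg_lfunVK // -uE memv_img ?memvf.
Qed.

Lemma lfun_factor_surj (q : 'Hom(U, V)) (g : 'Hom(U, W)) :
  (forall u, q u = 0 -> g u = 0) -> forall u, (g \o q^-1)%VF (q u) = g u.
Proof.
move=> qg u; rewrite comp_lfunE; apply/eqP; rewrite -subr_eq0 -linearB /=; apply/eqP/qg.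
by rewrite linearB /= limg_lfunVK ?subrr // memv_img ?memvf.
Qed.

Definition lker_incl (f : 'Hom(V, W)) : 'Hom(subvs_of (lker f), V) := linfun vsval.

Lemma lker_incl_inj (f : 'Hom(V, W)) : injective (lker_incl f).
Proof. by move=> x y; rewrite !lfunE /=; exact: subvs_inj. Qed.

Lemma lker_inclP (f : 'Hom(V, W)) v : f v = 0 <-> exists u, lker_incl f u = v.
Proof.
split=> [/eqP|[u <-]].
  by rewrite -memv_ker => vK; exists (Subvs vK); rewrite lfunE.
by rewrite lfunE /=; apply/eqP; rewrite -memv_ker; exact: subvsP.
Qed.

Lemma vproj_limgP (f : 'Hom(V, W)) w : vproj (limg f) w = 0 <-> exists v, f v = w.
Proof.
split=> [/eqP|[v <-]]; first by rewrite vproj_eq0 => /memv_imgP[v _ ->]; exists v.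
by apply/eqP; rewrite vproj_eq0 memv_img ?memvf.
Qed.

End LfunFactor.

Section FormalHodgeTheory.
Variable R : realType.
Local Notation C := (Cplx R).

Section QuoF.
Variables (n : nat) (X Y Z : mhs R n) (i : int).

Lemma quoF_map_inj (f : mhs_hom X Y) : injective f -> injective (quoF_map f i).
Proof.
move=> inj; suff f0 y : quoF_map f i y = 0 -> y = 0.
  by move=> x y xy; apply/eqP; rewrite -subr_eq0; apply/eqP/f0; rewrite linearB /= xy subrr.
have [v <-] := vproj_surj y; rewrite quoF_mapE => /eqP; rewrite vproj_eq0 (mhs_injF _ _ inj).
by rewrite -vproj_eq0 => /eqP.
Qed.

Lemma quoF_map_surj (f : mhs_hom X Y) :
  (forall y, exists x, f x = y) -> forall y, exists x, quoF_map f i x = y.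
Proof.
move=> sur y; have [w <-] := vproj_surj y; have [v <-] := tmap_surj sur w.
by exists (vproj (fil_F X i) v); rewrite quoF_mapE.
Qed.

(** If g w is in F^i, strictness gives u in F^i with g u = g w. Then w - u represents the same class
    as w and comes from X by exactness of the tensor product. *)
Lemma quoF_map_exact (f : mhs_hom X Y) (g : mhs_hom Y Z) :
  (forall y, g y = 0 <-> exists x, f x = y) ->
  forall y, quoF_map g i y = 0 <-> exists x, quoF_map f i x = y.
Proof.
move=> fg y; have fgC := tmap_exactP (K := C) fg; split=> [|[x <-]].
  have [w <-] := vproj_surj y; rewrite quoF_mapE => /eqP; rewrite vproj_eq0.
  move=> /mhs_strictF[u uF /eqP]; rewrite -subr_eq0 -linearB => /eqP/fgC[v vE].
  exists (- vproj (fil_F X i) v); rewrite linearN /= quoF_mapE vE linearB /=.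
  by rewrite opprB (_ : vproj _ u = 0) ?subr0 //; apply/eqP; rewrite vproj_eq0.
have [v <-] := vproj_surj x; rewrite !quoF_mapE (fgC _).2 ?linear0 //.
by exists v.
Qed.

End QuoF.

Variables (n : nat) (n_gt0 : (0 < n)%N).
Local Notation fhs := (fhs R n_gt0).
Implicit Types X Y Z : fhs.

(** Linearity is forgotten in [fcar] so that the three kinds of component share one type;
    injectivity, surjectivity and exactness concern only the underlying groups. *)
Inductive fcomp := Fo | Fet | Fv of idx n.

Definition fcar (X : fhs) (c : fcomp) : zmodType :=
  match c with Fo => fhs_o X | Fet => fhs_et X | Fv i => fhs_vec X i end.

Definition fmor (X Y : fhs) (f : fhs_hom X Y) (c : fcomp) : fcar X c -> fcar Y c :=
  match c return fcar X c -> fcar Y c with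
  | Fo => fhs_fo f | Fet => fhs_fet f | Fv i => fhs_phi f i end.

Lemma fmorB X Y (f : fhs_hom X Y) c : {morph fmor f (c := c) : x y / x - y}.
Proof. by case: c => [||i] x y; exact: raddfB. Qed.

Lemma fmor0 X Y (f : fhs_hom X Y) c : fmor f (0 : fcar X c) = 0.
Proof. by rewrite -(subrr 0) fmorB subrr. Qed.

Lemma fmorP X Y (f g : fhs_hom X Y) :
  (forall c (x : fcar X c), fmor f x = fmor g x) -> f = g.
Proof.
move=> fg; apply: fhs_homP.
- by apply/lfunP => x; exact: (fg Fo).
- by apply/mhs_homP/additiveP => x; exact: (fg Fet).
- by apply: vec_homP => i; apply/lfunP => x; exact: (fg (Fv i)).
Qed.

Lemma fmor_comp X Y Z (g : fhs_hom Y Z) (f : fhs_hom X Y) c (x : fcar X c) :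
  fmor (fhs_comp g f) x = fmor g (fmor f x).
Proof. by case: c x => [||i] x //=; exact: comp_lfunE. Qed.

Lemma fmor_id X c (x : fcar X c) : fmor (fhs_id X) x = x.
Proof. by case: c x => [||i] x //=; exact: id_lfunE. Qed.

Lemma fmor_zero X Y c (x : fcar X c) : fmor (0 : fhs_hom X Y) x = 0.
Proof. by case: c x => [||i] x //=; exact: zero_lfunE. Qed.

Lemma fmorD X Y (f g : fhs_hom X Y) c (x : fcar X c) :
  fmor (f + g) x = fmor f x + fmor g x.
Proof. by case: c x => [||i] x //=; exact: add_lfunE. Qed.

Lemma fhs_phi_piE X Y (f : fhs_hom X Y) (i : idx n) v :
  fhs_pi Y i (fhs_phi f i v) = quoF_map (fhs_fet f) i (fhs_pi X i v).
Proof. by rewrite -!comp_lfunE fhs_phi_pi. Qed.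

Lemma fhs_phi_hoE X Y (f : fhs_hom X Y) v :
  fhs_phi f (top_idx n_gt0) (fhs_ho X v) = fhs_ho Y (fhs_fo f v).
Proof. by rewrite -!comp_lfunE fhs_phi_ho. Qed.

Lemma vec_linE (V W : vec R n) (f : vec_hom V W) (i j : idx n) (e : j = i.+1 :> nat) v :
  f i (vec_map V e v) = vec_map W e (f j v).
Proof. by rewrite -!comp_lfunE vec_linP. Qed.

Lemma fhs_piE X (i j : idx n) (e : j = i.+1 :> nat) v :
  fhs_pi X i (vec_map (fhs_vec X) e v) = quoF_proj (fhs_et X) i j (fhs_pi X j v).
Proof. by rewrite -!comp_lfunE fhs_piP. Qed.

Lemma quoF_proj_map (X Y : mhs R n) (f : mhs_hom X Y) (i j : idx n) (e : j = i.+1 :> nat) v :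
  quoF_map f i (quoF_proj X i j v) = quoF_proj Y i j (quoF_map f j v).
Proof. exact: (vec_linE (mhs_vec_hom f) e). Qed.

Lemma quoF_map_can (X Y : mhs R n) (f : mhs_hom X Y) (i : int) x :
  quoF_map f i (quoF_can i x) = quoF_can i (f x).
Proof. by rewrite /quoF_can quoF_mapE tmap_can. Qed.

Definition finj X Y (f : fhs_hom X Y) := forall c, injective (fmor f (c := c)).
Definition fsurj X Y (f : fhs_hom X Y) := forall c (y : fcar Y c), exists x, fmor f x = y.
Definition fexact X Y Z (f : fhs_hom X Y) (g : fhs_hom Y Z) :=
  forall c (y : fcar Y c), fmor g y = 0 <-> exists x, fmor f x = y.

(** Each compatibility of u is checked after composing with an injective map. For pi_i this map is
    the one induced by k on the quotients by F^i, injective by strictness. *)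
Lemma fhs_factor_inj X Y Z (k : fhs_hom X Y) (g : fhs_hom Z Y) :
  finj k -> (forall c (z : fcar Z c), exists x, fmor k x = fmor g z) ->
  exists u : fhs_hom Z X, fhs_comp k u = g.
Proof.
move=> inj ex.
pose uo := ((fhs_fo k)^-1 \o fhs_fo g)%VF.
have uoE x : fhs_fo k (uo x) = fhs_fo g x := lfun_factor_inj (ex Fo) x.
clearbody uo.
have [ue ueE] := mhs_factor_inj (inj Fet) (ex Fet).
pose uv i := ((fhs_phi k i)^-1 \o fhs_phi g i)%VF.
have uvE i x : fhs_phi k i (uv i x) = fhs_phi g i x := lfun_factor_inj (ex (Fv i)) x.
clearbody uv.
have uvP (i j : idx n) (e : j = i.+1 :> nat) :
    (uv i \o vec_map (fhs_vec Z) e = vec_map (fhs_vec X) e \o uv j)%VF.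
  apply/lfunP => x; rewrite [LHS]comp_lfunE [RHS]comp_lfunE; apply: (inj (Fv i)) => /=.
  by rewrite vec_linE !uvE vec_linE.
pose uV := VecHom uvP.
have keE i v : quoF_map (fhs_fet k) i (quoF_map ue i v) = quoF_map (fhs_fet g) i v.
  rewrite -comp_lfunE -quoF_map_comp; congr (quoF_map _ _ v).
  by apply/mhs_homP/additiveP => x; exact: ueE.
have P1 (i : idx n) : (fhs_pi X i \o uV i = quoF_map ue i \o fhs_pi Z i)%VF.
  apply/lfunP => x; rewrite [LHS]comp_lfunE [RHS]comp_lfunE; apply: (quoF_map_inj (inj Fet)).
  by rewrite keE -!fhs_phi_piE uvE.
have P2 : (uV (top_idx n_gt0) \o fhs_ho Z = fhs_ho X \o uo)%VF.
  apply/lfunP => x; rewrite [LHS]comp_lfunE [RHS]comp_lfunE; apply: (inj (Fv _)) => /=.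
  by rewrite uvE !fhs_phi_hoE uoE.
have P3 x : uV (top_idx n_gt0) (fhs_het Z x) = fhs_het X (ue x).
  by apply: (inj (Fv _)) => /=; rewrite uvE !fhs_phi_het ueE.
exists (FhsHom P1 P2 P3); apply: fmorP => c x; rewrite fmor_comp.
case: c x => [||i] x /=; [exact: uoE | exact: ueE | exact: uvE].
Qed.

Lemma fhs_factor_surj X Y Z (q : fhs_hom X Y) (g : fhs_hom X Z) :
  fsurj q -> (forall c (x : fcar X c), fmor q x = 0 -> fmor g x = 0) ->
  exists u : fhs_hom Y Z, fhs_comp u q = g.
Proof.
move=> sur qg.
pose uo := (fhs_fo g \o (fhs_fo q)^-1)%VF.
have uoE x : uo (fhs_fo q x) = fhs_fo g x := lfun_factor_surj (@qg Fo) x.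
clearbody uo.
have [ue ueE] := mhs_factor_surj (@sur Fet) (@qg Fet).
pose uv i := (fhs_phi g i \o (fhs_phi q i)^-1)%VF.
have uvE i x : uv i (fhs_phi q i x) = fhs_phi g i x := lfun_factor_surj (@qg (Fv i)) x.
clearbody uv.
have uvP (i j : idx n) (e : j = i.+1 :> nat) :
    (uv i \o vec_map (fhs_vec Y) e = vec_map (fhs_vec Z) e \o uv j)%VF.
  apply/lfunP => y; rewrite [LHS]comp_lfunE [RHS]comp_lfunE; have [x <-] := sur (Fv j) y.
  by rewrite /= -vec_linE !uvE vec_linE.
pose uV := VecHom uvP.
have qeE i v : quoF_map ue i (quoF_map (fhs_fet q) i v) = quoF_map (fhs_fet g) i v.
  rewrite -comp_lfunE -quoF_map_comp; congr (quoF_map _ _ v).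
  by apply/mhs_homP/additiveP => x; exact: ueE.
have P1 (i : idx n) : (fhs_pi Z i \o uV i = quoF_map ue i \o fhs_pi Y i)%VF.
  apply/lfunP => y; rewrite [LHS]comp_lfunE [RHS]comp_lfunE; have [x <-] := sur (Fv i) y.
  by rewrite /= uvE !fhs_phi_piE qeE.
have P2 : (uV (top_idx n_gt0) \o fhs_ho Y = fhs_ho Z \o uo)%VF.
  apply/lfunP => y; rewrite [LHS]comp_lfunE [RHS]comp_lfunE; have [x <-] := sur Fo y.
  by rewrite /= -fhs_phi_hoE uvE fhs_phi_hoE uoE.
have P3 y : uV (top_idx n_gt0) (fhs_het Y y) = fhs_het Z (ue y).
  have [x <-] := sur Fet y.
  by rewrite /= -fhs_phi_het uvE fhs_phi_het ueE.
exists (FhsHom P1 P2 P3); apply: fmorP => c x; rewrite fmor_comp.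
case: c x => [||i] x /=; [exact: uoE | exact: ueE | exact: uvE].
Qed.

Lemma fhs_kernel X Y (f : fhs_hom X Y) :
  exists (K : fhs) (k : fhs_hom K X), finj k /\ fexact k f.
Proof.
have [E [ke [kinj kE]]] := mhs_kernel (fhs_fet f).
pose jo := lker_incl (fhs_fo f); pose jv i := lker_incl (fhs_phi f i).
have jv_inj i : injective (jv i) by exact: lker_incl_inj.
have jvK i u : fhs_phi f i (jv i u) = 0 by apply/lker_inclP; exists u.
have jvP i v : fhs_phi f i v = 0 -> exists u, jv i u = v by move=> /lker_inclP.
pose V := @Vec R n (fun i => subvs_of (lker (fhs_phi f i)))
  (fun i j e => (jv i)^-1 \o (vec_map (fhs_vec X) e \o jv j))%VF.
have jV (i j : idx n) (e : j = i.+1 :> nat) u :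
    jv i (vec_map V e u) = vec_map (fhs_vec X) e (jv j u).
  rewrite lfun_factor_inj => [|w]; first exact: comp_lfunE.
  apply: jvP.
  by rewrite comp_lfunE vec_linE jvK linear0.
(* pi_i of X sends ker phi_i into the kernel of the map induced by f on the quotients by F^i. By
   [quoF_map_exact] this is the image of the quotient of [E], on which the generalised inverse is a
   section. *)
pose p (i : idx n) : 'Hom(V i, quoF E i) := ((quoF_map ke i)^-1 \o (fhs_pi X i \o jv i))%VF.
have pE (i : idx n) u : quoF_map ke i (p i u) = fhs_pi X i (jv i u).
  rewrite lfun_factor_inj => [|w]; first exact: comp_lfunE.
  apply: (quoF_map_exact kE _).1.
  by rewrite (comp_lfunE (fhs_pi X i)) -fhs_phi_piE jvK linear0.
clearbody p.
have pP (i j : idx n) (e : j = i.+1 :> nat) :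
    (p i \o vec_map V e = quoF_proj E i j \o p j)%VF.
  apply/lfunP => u; rewrite [LHS]comp_lfunE [RHS]comp_lfunE; apply: (quoF_map_inj kinj).
  by rewrite pE jV quoF_proj_map // pE fhs_piE.
pose t := top_idx n_gt0.
pose ho : 'Hom(subvs_of (lker (fhs_fo f)), V t) := ((jv t)^-1 \o (fhs_ho X \o jo))%VF.
have hoE u : jv t (ho u) = fhs_ho X (jo u).
  rewrite lfun_factor_inj => [|w]; first exact: comp_lfunE.
  apply: jvP.
  rewrite comp_lfunE fhs_phi_hoE (_ : fhs_fo f _ = 0) ?linear0 //.
  by apply/lker_inclP; exists w.
clearbody ho.
have [he heE] : exists he : {additive E -> V t}, forall x, jv t (he x) = fhs_het X (ke x).
  apply: (additive_factor_inj (jv_inj t) (g := fhs_het X \o ke)) => x; apply: jvP.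
  by rewrite /= fhs_phi_het (kE _).2 ?raddf0 //; exists x.
have heP x : p t (he x) = quoF_can n x.
  apply: (quoF_map_inj kinj); rewrite pE heE quoF_map_can; exact: fhs_hetP.
pose K := Fhs pP ho heP.
have kvP (i j : idx n) (e : j = i.+1 :> nat) :
    (jv i \o vec_map V e = vec_map (fhs_vec X) e \o jv j)%VF.
  by apply/lfunP => u; rewrite [LHS]comp_lfunE [RHS]comp_lfunE jV.
have P1 (i : idx n) : (fhs_pi X i \o VecHom kvP i = quoF_map ke i \o fhs_pi K i)%VF.
  by apply/lfunP => u; rewrite [LHS]comp_lfunE [RHS]comp_lfunE pE.
have P2 : (VecHom kvP t \o fhs_ho K = fhs_ho X \o jo)%VF.
  by apply/lfunP => u; rewrite [LHS]comp_lfunE [RHS]comp_lfunE hoE.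
have P3 x : VecHom kvP t (fhs_het K x) = fhs_het X (ke x) by exact: heE.
exists K, (@FhsHom _ _ _ K X jo ke (VecHom kvP) P1 P2 P3); split=> [[||i]|[||i] y] /=.
- exact: lker_incl_inj.
- exact: kinj.
- exact: jv_inj.
- exact: lker_inclP.
- exact: kE.
- exact: lker_inclP.
Qed.

Lemma fhs_cokernel X Y (f : fhs_hom X Y) :
  exists (Q : fhs) (q : fhs_hom Y Q), fsurj q /\ fexact f q.
Proof.
have [E [qe [qsur qE]]] := mhs_cokernel (fhs_fet f).
pose jo := vproj (limg (fhs_fo f)); pose jv i := vproj (limg (fhs_phi f i)).
have jv_sur i y : exists x, jv i x = y by exact: vproj_surj.
have jvP i v : jv i v = 0 <-> exists u, fhs_phi f i u = v by exact: vproj_limgP.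
pose V := @Vec R n (fun i => vquot (limg (fhs_phi f i)))
  (fun i j e => (jv i \o vec_map (fhs_vec Y) e) \o (jv j)^-1)%VF.
have jV (i j : idx n) (e : j = i.+1 :> nat) v :
    vec_map V e (jv j v) = jv i (vec_map (fhs_vec Y) e v).
  rewrite lfun_factor_surj => [|w /jvP[u <-]]; first exact: comp_lfunE.
  by rewrite comp_lfunE -vec_linE; apply/jvP; exists (vec_map (fhs_vec X) e u).
(* pi_i of Y sends the image of phi_i into the image of the map induced by f on the quotients by
   F^i. This is killed by [quoF_map qe i], so the composite descends. *)
pose p (i : idx n) : 'Hom(V i, quoF E i) := ((quoF_map qe i \o fhs_pi Y i) \o (jv i)^-1)%VF.
have pE (i : idx n) v : p i (jv i v) = quoF_map qe i (fhs_pi Y i v).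
  rewrite lfun_factor_surj => [|w /jvP[u <-]]; first exact: comp_lfunE.
  rewrite (comp_lfunE _ (fhs_pi Y i)) fhs_phi_piE; apply: (quoF_map_exact qE _).2.
  by exists (fhs_pi X i u).
clearbody p.
have pP (i j : idx n) (e : j = i.+1 :> nat) :
    (p i \o vec_map V e = quoF_proj E i j \o p j)%VF.
  apply/lfunP => y; rewrite [LHS]comp_lfunE [RHS]comp_lfunE; have [v <-] := jv_sur j y.
  by rewrite jV !pE -quoF_proj_map // fhs_piE.
pose t := top_idx n_gt0.
pose ho : 'Hom(vquot (limg (fhs_fo f)), V t) := ((jv t \o fhs_ho Y) \o jo^-1)%VF.
have hoE v : ho (jo v) = jv t (fhs_ho Y v).
  rewrite lfun_factor_surj => [|w /vproj_limgP[u <-]]; first exact: comp_lfunE.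
  by rewrite comp_lfunE -fhs_phi_hoE; apply/jvP; exists (fhs_ho X u).
clearbody ho.
have [he heE] : exists he : {additive E -> V t}, forall x, he (qe x) = jv t (fhs_het Y x).
  apply: (additive_factor_surj qsur (g := (jv t : _ -> _) \o fhs_het Y)) => x /qE[u <-].
  by rewrite /= -fhs_phi_het; apply/jvP; exists (fhs_het X u).
have heP x : p t (he x) = quoF_can n x.
  have [y <-] := qsur x; rewrite heE pE -quoF_map_can; congr (quoF_map _ _ _); exact: fhs_hetP.
pose Q := Fhs pP ho heP.
have qvP (i j : idx n) (e : j = i.+1 :> nat) :
    (jv i \o vec_map (fhs_vec Y) e = vec_map V e \o jv j)%VF.
  by apply/lfunP => u; rewrite [LHS]comp_lfunE [RHS]comp_lfunE jV.
pose qv := @VecHom R n (fhs_vec Y) V jv qvP.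
have P1 (i : idx n) : (fhs_pi Q i \o qv i = quoF_map qe i \o fhs_pi Y i)%VF.
  by apply/lfunP => u; rewrite [LHS]comp_lfunE [RHS]comp_lfunE pE.
have P2 : (qv t \o fhs_ho Y = fhs_ho Q \o jo)%VF.
  by apply/lfunP => u; rewrite [LHS]comp_lfunE [RHS]comp_lfunE hoE.
have P3 x : qv t (fhs_het Y x) = fhs_het Q (qe x) by rewrite -heE.
exists Q, (@FhsHom _ _ _ Y Q jo qe qv P1 P2 P3); split=> [[||i]|[||i] y] /=.
- exact: vproj_surj.
- exact: qsur.
- exact: jv_sur.
- exact: vproj_limgP.
- exact: qE.
- exact: vproj_limgP.
Qed.

End FormalHodgeTheory.

Arguments Fo {n}.
Arguments Fet {n}.

(** * Direct sums of formal Hodge structures *)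

Section PairLfun.
Variables (K : fieldType) (V W : vectType K).

Definition pairl0 (v : V) : V * W := (v, 0).
Definition pair0r (w : W) : V * W := (0, w).

Fact pairl0_linear : linear pairl0.
Proof. by move=> a x y; congr pair; rewrite /= ?scaler0 ?addr0. Qed.
Fact pair0r_linear : linear pair0r.
Proof. by move=> a x y; congr pair; rewrite /= ?scaler0 ?addr0. Qed.
HB.instance Definition _ := GRing.isLinear.Build K V (V * W)%type _ pairl0 pairl0_linear.
HB.instance Definition _ := GRing.isLinear.Build K W (V * W)%type _ pair0r pair0r_linear.

Definition lfst : 'Hom((V * W)%type, V) := linfun fst.
Definition lsnd : 'Hom((V * W)%type, W) := linfun snd.
Definition linl : 'Hom(V, (V * W)%type) := linfun pairl0.
Definition linr : 'Hom(W, (V * W)%type) := linfun pair0r.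

Lemma biprod_pair : biprod lfst lsnd linl linr.
Proof.
split=> x; rewrite !lfunE //=.
by case: x => v w; congr pair; rewrite /= ?addr0 ?add0r.
Qed.

End PairLfun.

Section BiprodMap.
Variables (K : fieldType) (V1 V2 P W1 W2 Q : vectType K).
Variables (p1 : 'Hom(P, V1)) (p2 : 'Hom(P, V2)) (i1 : 'Hom(V1, P)) (i2 : 'Hom(V2, P)).
Variables (q1 : 'Hom(Q, W1)) (q2 : 'Hom(Q, W2)) (j1 : 'Hom(W1, Q)) (j2 : 'Hom(W2, Q)).
Hypotheses (bP : biprod p1 p2 i1 i2) (bQ : biprod q1 q2 j1 j2).

Lemma biprod_ext x y : p1 x = p1 y -> p2 x = p2 y -> x = y.
Proof. by move=> e1 e2; rewrite -(bpD bP x) -(bpD bP y) e1 e2. Qed.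

Definition biprod_map (f : 'Hom(V1, W1)) (g : 'Hom(V2, W2)) : 'Hom(P, Q) :=
  ((j1 \o (f \o p1)) + (j2 \o (g \o p2)))%VF.

Lemma biprod_mapP (f : 'Hom(V1, W1)) (g : 'Hom(V2, W2)) (h := biprod_map f g) :
  [/\ forall x, q1 (h x) = f (p1 x), forall x, q2 (h x) = g (p2 x),
      forall x, h (i1 x) = j1 (f x) & forall x, h (i2 x) = j2 (g x)].
Proof.
rewrite /h; split=> x; rewrite add_lfunE !comp_lfunE ?linearD /=.
- by rewrite (bp11 bQ) (bp12 bQ) addr0.
- by rewrite (bp22 bQ) (bp21 bQ) add0r.
- by rewrite (bp11 bP) (bp21 bP) !linear0 addr0.
- by rewrite (bp12 bP) (bp22 bP) !linear0 add0r.
Qed.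

End BiprodMap.

Section FormalHodgeCategory.
Variable R : realType.
Local Notation C := (Cplx R).

Lemma quoF_biprod n (X Y P : mhs R n) (p1 : mhs_hom P X) (p2 : mhs_hom P Y)
    (i1 : mhs_hom X P) (i2 : mhs_hom Y P) (i : int) :
  [/\ forall x, p1 (i1 x) = x, forall x, p2 (i2 x) = x,
      forall x, p1 (i2 x) = 0, forall x, p2 (i1 x) = 0
    & forall x, i1 (p1 x) + i2 (p2 x) = x] ->
  biprod (quoF_map p1 i) (quoF_map p2 i) (quoF_map i1 i) (quoF_map i2 i).
Proof.
move=> /(biprod_tmap C) bC.
split=> x; have [v <-] := vproj_surj x; rewrite !quoF_mapE.
- by rewrite (bp11 bC).
- by rewrite (bp22 bC).
- by rewrite (bp12 bC) linear0.
- by rewrite (bp21 bC) linear0.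
- by rewrite -linearD (bpD bC).
Qed.

Variables (n : nat) (n_gt0 : (0 < n)%N).
Local Notation fhs := (fhs R n_gt0).
Local Notation FHS := (FHS R n_gt0).
Implicit Types X Y Z : fhs.

Lemma fhs_biprod X Y : exists (P : fhs) (p1 : fhs_hom P X) (p2 : fhs_hom P Y)
  (i1 : fhs_hom X P) (i2 : fhs_hom Y P),
  [/\ fhs_comp p1 i1 = fhs_id X, fhs_comp p2 i2 = fhs_id Y
    & fhs_comp i1 p1 + fhs_comp i2 p2 = fhs_id P].
Proof.
have [E [p1 [p2 [i1 [i2 bE]]]]] := mhs_biprod (fhs_et X) (fhs_et Y).
have bF i := quoF_biprod i bE.
pose bV i := biprod_pair (fhs_vec X i) (fhs_vec Y i).
pose bo := biprod_pair (fhs_o X) (fhs_o Y).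
pose t := top_idx n_gt0.
pose V := @Vec R n (fun i => (fhs_vec X i * fhs_vec Y i)%type)
  (fun i j e => biprod_map (lfst _ _) (lsnd _ _) (linl _ _) (linr _ _)
    (vec_map (fhs_vec X) e) (vec_map (fhs_vec Y) e)).
have VP (i j : idx n) (e : j = i.+1 :> nat) :=
  biprod_mapP (bV j) (bV i) (vec_map (fhs_vec X) e) (vec_map (fhs_vec Y) e).
(* The source is a literal product, but the target is a direct sum only through the maps
   [quoF_map i1 i] and [quoF_map i2 i]. *)
pose p (i : idx n) : 'Hom(V i, quoF E i) :=
  biprod_map (lfst _ _) (lsnd _ _) (quoF_map i1 i) (quoF_map i2 i) (fhs_pi X i) (fhs_pi Y i).
have pP (i : idx n) := biprod_mapP (bV i) (bF i) (fhs_pi X i) (fhs_pi Y i).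
pose o : 'Hom((fhs_o X * fhs_o Y)%type, V t) :=
  biprod_map (lfst _ _) (lsnd _ _) (linl _ _) (linr _ _) (fhs_ho X) (fhs_ho Y).
have oP := biprod_mapP bo (bV t) (fhs_ho X) (fhs_ho Y).
rewrite -/o in oP; clearbody o.
have piP (i j : idx n) (e : j = i.+1 :> nat) :
    (p i \o vec_map V e = quoF_proj E i j \o p j)%VF.
  have [m1 m2 _ _] := VP _ _ e; have [pi1 pi2 _ _] := pP i; have [pj1 pj2 _ _] := pP j.
  apply/lfunP => u; rewrite [LHS]comp_lfunE [RHS]comp_lfunE; apply: (biprod_ext (bF i)).
    by rewrite quoF_proj_map // [LHS]pi1 m1 fhs_piE pj1.
  by rewrite quoF_proj_map // [LHS]pi2 m2 fhs_piE pj2.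
have [x y|he heE] := @additive_of E (V t)
    (fun x => linl _ _ (fhs_het X (p1 x)) + linr _ _ (fhs_het Y (p2 x))).
  by rewrite !raddfB opprD addrACA.
have heP x : p t (he x) = quoF_can n x.
  have [_ _ pt1 pt2] := pP t.
  rewrite heE linearD /= [X in X + _]pt1 [X in _ + X]pt2 !fhs_hetP !quoF_map_can.
  by case: bE => _ _ _ _ bE; rewrite -[in RHS](bE x) raddfD.
pose P := Fhs piP o heP.
have c1 (i j : idx n) (e : j = i.+1 :> nat) :
    (lfst _ _ \o vec_map V e = vec_map (fhs_vec X) e \o lfst _ _)%VF.
  by apply/lfunP => u; rewrite [LHS]comp_lfunE [RHS]comp_lfunE; case: (VP _ _ e) => ->.
have c2 (i j : idx n) (e : j = i.+1 :> nat) :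
    (lsnd _ _ \o vec_map V e = vec_map (fhs_vec Y) e \o lsnd _ _)%VF.
  by apply/lfunP => u; rewrite [LHS]comp_lfunE [RHS]comp_lfunE; case: (VP _ _ e) => _ ->.
have d1 (i j : idx n) (e : j = i.+1 :> nat) :
    (linl _ _ \o vec_map (fhs_vec X) e = vec_map V e \o linl _ _)%VF.
  by apply/lfunP => u; rewrite [LHS]comp_lfunE [RHS]comp_lfunE; case: (VP _ _ e) => _ _ ->.
have d2 (i j : idx n) (e : j = i.+1 :> nat) :
    (linr _ _ \o vec_map (fhs_vec Y) e = vec_map V e \o linr _ _)%VF.
  by apply/lfunP => u; rewrite [LHS]comp_lfunE [RHS]comp_lfunE; case: (VP _ _ e) => _ _ _ ->.
pose F1 := @VecHom R n V (fhs_vec X) (fun i => lfst _ _) c1.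
pose F2 := @VecHom R n V (fhs_vec Y) (fun i => lsnd _ _) c2.
pose J1 := @VecHom R n (fhs_vec X) V (fun i => linl _ _) d1.
pose J2 := @VecHom R n (fhs_vec Y) V (fun i => linr _ _) d2.
have F1pi (i : idx n) : (fhs_pi X i \o F1 i = quoF_map p1 i \o fhs_pi P i)%VF.
  by apply/lfunP => u; rewrite [LHS]comp_lfunE [RHS]comp_lfunE; case: (pP i) => ->.
have F2pi (i : idx n) : (fhs_pi Y i \o F2 i = quoF_map p2 i \o fhs_pi P i)%VF.
  by apply/lfunP => u; rewrite [LHS]comp_lfunE [RHS]comp_lfunE; case: (pP i) => _ ->.
have J1pi (i : idx n) : (fhs_pi P i \o J1 i = quoF_map i1 i \o fhs_pi X i)%VF.
  by apply/lfunP => u; rewrite [LHS]comp_lfunE [RHS]comp_lfunE; case: (pP i) => _ _ ->.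
have J2pi (i : idx n) : (fhs_pi P i \o J2 i = quoF_map i2 i \o fhs_pi Y i)%VF.
  by apply/lfunP => u; rewrite [LHS]comp_lfunE [RHS]comp_lfunE; case: (pP i) => _ _ _ ->.
have F1o : (F1 t \o fhs_ho P = fhs_ho X \o lfst _ _)%VF.
  by apply/lfunP => u; rewrite [LHS]comp_lfunE [RHS]comp_lfunE; case: oP => ->.
have F2o : (F2 t \o fhs_ho P = fhs_ho Y \o lsnd _ _)%VF.
  by apply/lfunP => u; rewrite [LHS]comp_lfunE [RHS]comp_lfunE; case: oP => _ ->.
have J1o : (J1 t \o fhs_ho X = fhs_ho P \o linl _ _)%VF.
  by apply/lfunP => u; rewrite [LHS]comp_lfunE [RHS]comp_lfunE; case: oP => _ _ ->.
have J2o : (J2 t \o fhs_ho Y = fhs_ho P \o linr _ _)%VF.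
  by apply/lfunP => u; rewrite [LHS]comp_lfunE [RHS]comp_lfunE; case: oP => _ _ _ ->.
have [b11 b22 b12 b21 bD] := bE.
have F1e x : F1 t (fhs_het P x) = fhs_het X (p1 x).
  by rewrite /= heE linearD /= (bp11 (bV t)) (bp12 (bV t)) addr0.
have F2e x : F2 t (fhs_het P x) = fhs_het Y (p2 x).
  by rewrite /= heE linearD /= (bp21 (bV t)) (bp22 (bV t)) add0r.
have J1e x : J1 t (fhs_het X x) = fhs_het P (i1 x).
  by rewrite /= heE b11 b21 raddf0 linear0 addr0.
have J2e x : J2 t (fhs_het Y x) = fhs_het P (i2 x).
  by rewrite /= heE b12 b22 raddf0 linear0 add0r.
exists P, (@FhsHom _ _ _ P X (lfst _ _) p1 F1 F1pi F1o F1e),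
  (@FhsHom _ _ _ P Y (lsnd _ _) p2 F2 F2pi F2o F2e),
  (@FhsHom _ _ _ X P (linl _ _) i1 J1 J1pi J1o J1e),
  (@FhsHom _ _ _ Y P (linr _ _) i2 J2 J2pi J2o J2e).
split; apply: fmorP => c x; rewrite ?fmorD !fmor_comp fmor_id.
- case: c x => [||i] x /=; [exact: (bp11 bo) | exact: b11 | exact: (bp11 (bV i))].
- case: c x => [||i] x /=; [exact: (bp22 bo) | exact: b22 | exact: (bp22 (bV i))].
- case: c x => [||i] x /=; [exact: (bpD bo) | exact: bD | exact: (bpD (bV i))].
Qed.

End FormalHodgeCategory.

Local Notation hom := Defs.hom.

(** * From componentwise exactness to the categorical statements *)

Section KernelUniqueness.
Variables (D : preadditive).

Lemma kernel_unique (A B K K' : D) (k : hom K A) (k' : hom K' A) (f : hom A B) :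
  is_kernel k f -> is_kernel k' f ->
  exists (u : hom K' K) (v : hom K K'),
    [/\ k \c u = k', k' \c v = k, u \c v = idm K & v \c u = idm K'].
Proof.
move=> [fk kU] [fk' kU'].
have [u [uE _]] := kU _ _ fk'; have [v [vE _]] := kU' _ _ fk.
exists u, v; split=> //.
  have [w [_ wU]] := kU _ _ fk.
  by apply: (etrans (esym (wU _ _)) (wU _ _)); rewrite ?compm1 // Defs.compA uE vE.
have [w [_ wU]] := kU' _ _ fk'.
by apply: (etrans (esym (wU _ _)) (wU _ _)); rewrite ?compm1 // Defs.compA vE uE.
Qed.

Lemma cokernel_unique (A B Q Q' : D) (q : hom B Q) (q' : hom B Q') (f : hom A B) :
  is_cokernel q f -> is_cokernel q' f ->
  exists (u : hom Q Q') (v : hom Q' Q),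
    [/\ u \c q = q', v \c q' = q, v \c u = idm Q & u \c v = idm Q'].
Proof.
move=> [fq qU] [fq' qU'].
have [u [uE _]] := qU _ _ fq'; have [v [vE _]] := qU' _ _ fq.
exists u, v; split=> //.
  have [w [_ wU]] := qU _ _ fq.
  by apply: (etrans (esym (wU _ _)) (wU _ _)); rewrite ?comp1m // -Defs.compA uE vE.
have [w [_ wU]] := qU' _ _ fq'.
by apply: (etrans (esym (wU _ _)) (wU _ _)); rewrite ?comp1m // -Defs.compA vE uE.
Qed.

End KernelUniqueness.

Section Conclusion.
Variable R : realType.
Local Notation C := (Cplx R).
Variables (n : nat) (n_gt0 : (0 < n)%N).
Local Notation fhs := (fhs R n_gt0).
Local Notation FHS := (FHS R n_gt0).
Implicit Types X Y Z K Q : fhs.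

(** The kernel constructed in [fhs_kernel] has the componentwise properties, and any other kernel is
    isomorphic to it over X, so it inherits them. *)
Lemma is_kernelP K X Y (k : fhs_hom K X) (f : fhs_hom X Y) :
  @is_kernel FHS X Y K k f <-> finj k /\ fexact k f.
Proof.
have easy L (l : fhs_hom L X) : finj l -> fexact l f -> @is_kernel FHS X Y L l f.
  move=> inj ex; split.
    apply: fmorP => c x; rewrite [LHS]fmor_comp fmor_zero.
    by apply/ex; exists x.
  move=> Z g fg; have [c z|u uE] := @fhs_factor_inj _ _ _ _ _ _ l g inj.
    by apply/ex; rewrite -fmor_comp [fhs_comp _ _]fg fmor_zero.
  exists u; split=> // v vE; apply: fmorP => c x; apply: (inj c).
  by rewrite -!fmor_comp uE -[fhs_comp l v]/(Defs.comp (l : @hom FHS L X) v) vE.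
split=> [kerk|[]]; last exact: easy.
have [L [l [inj ex]]] := fhs_kernel f.
have [u [v [uE vE uv vu]]] := kernel_unique kerk (easy _ _ inj ex).
have kE c (x : fcar K c) : fmor k x = fmor l (fmor v x) by rewrite -fmor_comp -vE.
have lE c (x : fcar L c) : fmor l x = fmor k (fmor u x) by rewrite -fmor_comp -uE.
have uvE c (x : fcar K c) : fmor u (fmor v x) = x.
  by rewrite -fmor_comp -[RHS]fmor_id -[fhs_id _]uv.
split=> [c x y|c y].
  by rewrite !kE => /inj e; rewrite -(uvE c x) e uvE.
split=> [/ex[x <-]|[x <-]]; first by exists (fmor u x); rewrite lE.
by rewrite kE; apply/ex; exists (fmor v x).
Qed.

Lemma is_cokernelP X Y Q (f : fhs_hom X Y) (q : fhs_hom Y Q) :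
  @is_cokernel FHS X Y Q q f <-> fsurj q /\ fexact f q.
Proof.
have easy L (l : fhs_hom Y L) : fsurj l -> fexact f l -> @is_cokernel FHS X Y L l f.
  move=> sur ex; split.
    apply: fmorP => c x; rewrite [LHS]fmor_comp fmor_zero.
    by apply/ex; exists x.
  move=> Z g fg; have [c z|u uE] := @fhs_factor_surj _ _ _ _ _ _ l g sur.
    by move=> /ex[x <-]; rewrite -fmor_comp [fhs_comp _ _]fg fmor_zero.
  exists u; split=> // v vE; apply: fmorP => c y; have [x <-] := sur c y.
  by rewrite -!fmor_comp uE -[fhs_comp v l]/(Defs.comp (v : @hom FHS L Z) l) vE.
split=> [kerk|[]]; last exact: easy.
have [L [l [sur ex]]] := fhs_cokernel f.
have [u [v [uE vE vu uv]]] := cokernel_unique kerk (easy _ _ sur ex).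
have qE c (x : fcar Y c) : fmor q x = fmor v (fmor l x) by rewrite -fmor_comp -vE.
have lE c (x : fcar Y c) : fmor l x = fmor u (fmor q x) by rewrite -fmor_comp -uE.
have vuE c (x : fcar Q c) : fmor v (fmor u x) = x.
  by rewrite -fmor_comp -[RHS]fmor_id -[fhs_id _]vu.
split=> [c y|c y].
  by have [x xE] := sur c (fmor u y); exists x; rewrite qE xE vuE.
split=> [q0|[x <-]]; first by apply/ex; rewrite lE q0 fmor0.
by rewrite qE (ex c _).2 ?fmor0 //; exists x.
Qed.

Lemma short_exactP X Y Z (f : fhs_hom X Y) (g : fhs_hom Y Z) :
  @short_exact FHS X Y Z f g <-> [/\ finj f, fexact f g & fsurj g].
Proof.
rewrite /short_exact; split=> [[/is_kernelP[? ?] /is_cokernelP[? ?]] //|[? ? ?]].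
by split; [apply/is_kernelP | apply/is_cokernelP].
Qed.

Lemma finj0 X Y (f : fhs_hom X Y) : (forall c (x : fcar X c), fmor f x = 0 -> x = 0) -> finj f.
Proof.
move=> f0 c x y xy; apply/eqP; rewrite -subr_eq0; apply/eqP/f0.
by rewrite fmorB xy subrr.
Qed.

Lemma fhs_zero_object : exists Z, @zero_object FHS Z.
Proof.
pose V := @Vec R n (fun=> 'rV[C]_0) (fun _ _ _ => 0).
have Z0 c (x : fcar (vec_fhs n_gt0 V) c) : x = 0 by case: c x => [||i] x; exact: thinmx0.
exists (vec_fhs n_gt0 V); split=> X f; apply: fmorP => c x; rewrite fmor_zero.
  exact: Z0.
by rewrite (Z0 c x) fmor0.
Qed.

(** Kernels and cokernels share the condition [fexact]. Hence a monomorphism, injective because its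
    kernel is zero, is the kernel of its cokernel, and dually. *)
Lemma fhs_abelian : abelian_category FHS.
Proof.
split.
- exact: fhs_zero_object.
- move=> X Y; have [P [p1 [p2 [i1 [i2 [e1 e2 e3]]]]]] := fhs_biprod X Y.
  by exists P, p1, p2, i1, i2.
- move=> X Y f; split.
    by have [K [k kP]] := fhs_kernel f; exists K, k; apply/is_kernelP.
  by have [Q [q [qs qe]]] := fhs_cokernel f; exists Q, q; apply/is_cokernelP.
- move=> X Y f fmono.
  have [K [k [kinj kex]]] := fhs_kernel f.
  have [fk _] : @is_kernel FHS X Y K k f by apply/is_kernelP.
  have k0 : k = 0.
    apply: fmono; rewrite fk; apply: fmorP => c x.
    by rewrite fmor_zero [RHS]fmor_comp fmor_zero fmor0.
  have finj_f : finj f by apply: finj0 => c x /kex[y <-]; rewrite k0 fmor_zero.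
  have [Q [q [qs qe]]] := fhs_cokernel f.
  by exists Q, q; apply/is_kernelP.
- move=> X Y f fepi.
  have [Q [q [qs qex]]] := fhs_cokernel f.
  have [qf _] : @is_cokernel FHS X Y Q q f by apply/is_cokernelP.
  have q0 : q = 0.
    apply: fepi; rewrite qf; apply: fmorP => c x.
    by rewrite fmor_zero [RHS]fmor_comp fmor_zero.
  have fsurj_f : fsurj f by move=> c y; apply/qex; rewrite q0 fmor_zero.
  have [K [k [kinj kex]]] := fhs_kernel f.
  by exists K, k; apply/is_cokernelP.
Qed.

Lemma formal_groups_short_exact (A B D : formal_group R)
    (f : @hom (FormalGroups R) A B) (g : @hom (FormalGroups R) B D) :
  injective f.1 -> injective f.2 ->
  (forall y, g.1 y = 0 <-> exists x, f.1 x = y) ->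
  (forall y, g.2 y = 0 <-> exists x, f.2 x = y) ->
  (forall y, exists x, g.1 x = y) -> (forall y, exists x, g.2 x = y) ->
  short_exact f g.
Proof.
move=> inj1 inj2 ex1 ex2 sur1 sur2.
have gf : g \c f = 0.
  congr pair; last by apply: additiveP => x; apply/ex2; exists x.
  by apply/lfunP => x; rewrite comp_lfunE zero_lfunE; apply/ex1; exists x.
split; split=> // Z h hE.
- have h1 z : g.1 (h.1 z) = 0.
    by rewrite -comp_lfunE -[(_ \o _)%VF]/((g \c h).1) hE zero_lfunE.
  have h2 z : g.2 (h.2 z) = 0 by rewrite -[LHS]/((g \c h).2 z) hE.
  pose u1 := ((f.1)^-1 \o h.1)%VF.
  have u1E z : f.1 (u1 z) = h.1 z by apply: lfun_factor_inj => w; apply/ex1.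
  have [z|u2 u2E] := additive_factor_inj inj2 (g := h.2); first exact/ex2.
  have uE : f \c (u1, u2) = h.
    case: h hE h1 h2 u1 u1E u2E => h1 h2 /= _ _ _ u1 u1E u2E.
    congr pair; last exact: additiveP.
    by apply/lfunP => x; rewrite comp_lfunE u1E.
  exists (u1, u2); split=> // -[v1 v2] vE; congr pair.
    apply/lfunP => x; apply: inj1.
    by rewrite u1E -vE [LHS]comp_lfunE.
  by apply: additiveP => x; apply: inj2; rewrite u2E -vE.
- have h1 x : h.1 (f.1 x) = 0.
    by rewrite -comp_lfunE -[(_ \o _)%VF]/((h \c f).1) hE zero_lfunE.
  have h2 x : h.2 (f.2 x) = 0 by rewrite -[LHS]/((h \c f).2 x) hE.
  pose u1 := (h.1 \o (g.1)^-1)%VF.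
  have u1E x : u1 (g.1 x) = h.1 x by apply: lfun_factor_surj => w /ex1[y <-].
  have [z /ex2[x <-] //|u2 u2E] := additive_factor_surj sur2 (g := h.2).
  have uE : ((u1, u2) : @hom (FormalGroups R) D Z) \c g = h.
    case: h hE h1 h2 u1 u1E u2E => h1 h2 /= _ _ _ u1 u1E u2E.
    congr pair; last exact: additiveP.
    by apply/lfunP => x; rewrite comp_lfunE u1E.
  exists (u1, u2); split=> // -[v1 v2] vE; congr pair.
    apply/lfunP => y; have [x <-] := sur1 y.
    by rewrite u1E -vE [LHS]comp_lfunE.
  by apply: additiveP => y; have [x <-] := sur2 y; rewrite u2E -vE.
Qed.

Lemma vec_short_exact (A B D : vec R n)
    (f : @hom (VecCat R n) A B) (g : @hom (VecCat R n) B D) :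
  (forall i, injective (vec_lin f i)) ->
  (forall i y, vec_lin g i y = 0 <-> exists x, vec_lin f i x = y) ->
  (forall i y, exists x, vec_lin g i x = y) -> short_exact f g.
Proof.
move=> inj ex sur.
have gf : g \c f = 0.
  apply: vec_homP => i; apply/lfunP => x; rewrite [LHS]comp_lfunE zero_lfunE.
  by apply/ex; exists x.
split; split=> // Z h hE.
- have gh i z : vec_lin g i (vec_lin h i z) = 0.
    by rewrite -comp_lfunE -[(_ \o _)%VF]/(vec_lin (g \c h) i) hE zero_lfunE.
  pose u i := ((vec_lin f i)^-1 \o vec_lin h i)%VF.
  have uE i z : vec_lin f i (u i z) = vec_lin h i z.
    by apply: lfun_factor_inj => w; apply/ex.
  clearbody u.
  have uP (i j : idx n) (e : j = i.+1 :> nat) : (u i \o vec_map Z e = vec_map A e \o u j)%VF.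
    apply/lfunP => z; rewrite [LHS]comp_lfunE [RHS]comp_lfunE; apply: (inj i).
    by rewrite vec_linE !uE vec_linE.
  exists (VecHom uP); split.
    by apply: vec_homP => i; apply/lfunP => x; rewrite [LHS]comp_lfunE uE.
  move=> v vE; apply: vec_homP => i; apply/lfunP => x; apply: (inj i).
  by rewrite uE -vE [LHS]comp_lfunE.
- have hf i x : vec_lin h i (vec_lin f i x) = 0.
    by rewrite -comp_lfunE -[(_ \o _)%VF]/(vec_lin (h \c f) i) hE zero_lfunE.
  pose u i := (vec_lin h i \o (vec_lin g i)^-1)%VF.
  have uE i z : u i (vec_lin g i z) = vec_lin h i z.
    by apply: lfun_factor_surj => w /ex[x <-].
  clearbody u.
  have uP (i j : idx n) (e : j = i.+1 :> nat) : (u i \o vec_map D e = vec_map Z e \o u j)%VF.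
    apply/lfunP => y; rewrite [LHS]comp_lfunE [RHS]comp_lfunE; have [x <-] := sur j y.
    by rewrite -vec_linE !uE vec_linE.
  exists (VecHom uP); split.
    by apply: vec_homP => i; apply/lfunP => x; rewrite [LHS]comp_lfunE uE.
  move=> v vE; apply: vec_homP => i; apply/lfunP => y; have [x <-] := sur i y.
  by rewrite uE -vE [LHS]comp_lfunE.
Qed.

Lemma forget_group_exact : exact_functor (forget_group R n_gt0).
Proof.
split=> // X Y Z f g /short_exactP[inj ex sur].
by apply: formal_groups_short_exact; [exact: (inj Fo) | exact: (inj Fet)
  | exact: (ex Fo) | exact: (ex Fet) | exact: (sur Fo) | exact: (sur Fet)].
Qed.

Lemma forget_vec_exact : exact_functor (forget_vec R n_gt0).
Proof.
split=> // X Y Z f g /short_exactP[inj ex sur].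
by apply: vec_short_exact => i; [exact: (inj (Fv i)) | exact: (ex (Fv i)) | exact: (sur (Fv i))].
Qed.

(** The inverse comes from factoring the identity of Y through f; strictness, hidden in
    [fhs_factor_inj], makes it respect W and F. *)
Lemma fhs_bij_iso X Y (f : fhs_hom X Y) : finj f -> fsurj f -> @isomorphic FHS Y X.
Proof.
move=> inj sur; have [c y|g gE] := fhs_factor_inj (g := fhs_id Y) inj.
  by have [x <-] := sur c y; exists x; rewrite fmor_id.
have gf : fhs_comp g f = fhs_id X.
  apply: fmorP => c x; apply: (inj c).
  by rewrite !fmor_comp fmor_id -(fmor_comp f g) gE fmor_id.
by exists g, f.
Qed.

Definition fhs_pi_bij X := (forall x : fhs_o X, x = 0) /\
  forall i : idx n, injective (fhs_pi X i) /\ forall y, exists x, fhs_pi X i x = y.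

(** If H^o = 0, the axioms of a formal Hodge structure say exactly that (0, id, pi) is a morphism to
    the structure built from H_et; it is an isomorphism once the pi_i are bijective. Conversely,
    pi_i = id in the source lets an isomorphism express pi_i of X through bijections. *)
Lemma mhs_essential_image X : essential_image (mhs_embedding R n_gt0) X <-> fhs_pi_bij X.
Proof.
split=> [[A [f [g [gf fg]]]]|[o0 bij]].
  have fgE c (x : fcar X c) : fmor f (fmor g x) = x.
    by rewrite -fmor_comp -[RHS]fmor_id -[fhs_id _]fg.
  have gfE c (x : fcar (mhs_fhs n_gt0 A) c) : fmor g (fmor f x) = x.
    by rewrite -fmor_comp -[RHS]fmor_id -[fhs_id _]gf.
  have qgf (i : idx n) y : quoF_map (fhs_fet g) i (quoF_map (fhs_fet f) i y) = y.
    rewrite -[RHS]id_lfunE -quoF_map_id -comp_lfunE -quoF_map_comp.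
    by congr (quoF_map _ _ y); apply/mhs_homP/additiveP => x; exact: (gfE Fet).
  have qfg (i : idx n) y : quoF_map (fhs_fet f) i (quoF_map (fhs_fet g) i y) = y.
    rewrite -[RHS]id_lfunE -quoF_map_id -comp_lfunE -quoF_map_comp.
    by congr (quoF_map _ _ y); apply/mhs_homP/additiveP => x; exact: (fgE Fet).
  have piE (i : idx n) y : fhs_pi X i (fhs_phi f i y) = quoF_map (fhs_fet f) i y.
    by rewrite fhs_phi_piE id_lfunE.
  split=> [x|i].
    by rewrite -(fgE Fo x) (_ : fmor g (x : fcar X Fo) = 0) ?fmor0 //; exact: thinmx0.
  split=> [x y|y].
    rewrite -(fgE (Fv i) x) -(fgE (Fv i) y) /= !piE => /(congr1 (quoF_map (fhs_fet g) i)).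
    by rewrite !qgf => ->.
  by exists (fhs_phi f i (quoF_map (fhs_fet g) i y)); rewrite piE qfg.
exists (fhs_et X).
have P0 (i j : idx n) (e : j = i.+1 :> nat) :
    (fhs_pi X i \o vec_map (fhs_vec X) e = vec_map (mhs_vec (fhs_et X)) e \o fhs_pi X j)%VF.
  exact: fhs_piP.
pose V := @VecHom R n (fhs_vec X) (mhs_vec (fhs_et X)) (fhs_pi X) P0.
have P1 (i : idx n) : (fhs_pi (mhs_fhs n_gt0 (fhs_et X)) i \o V i =
    quoF_map (mhs_id (fhs_et X)) i \o fhs_pi X i)%VF.
  by rewrite quoF_map_id.
have P2 : (V (top_idx n_gt0) \o fhs_ho X = fhs_ho (mhs_fhs n_gt0 (fhs_et X)) \o 0)%VF.
  by apply/lfunP => x; rewrite [x]o0 !linear0.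
have P3 x : V (top_idx n_gt0) (fhs_het X x) = fhs_het (mhs_fhs n_gt0 (fhs_et X)) (mhs_id _ x).
  exact: fhs_hetP.
apply: (@fhs_bij_iso X (mhs_fhs n_gt0 (fhs_et X))
  (@FhsHom _ _ _ X (mhs_fhs n_gt0 (fhs_et X)) 0 (mhs_id _) V P1 P2 P3)).
- move=> [||i] x y //=; [by rewrite [x]o0 [y]o0 | exact: (bij i).1].
- move=> [||i] y /=; [by exists 0; rewrite linear0 [y]thinmx0 | by exists y | exact: (bij i).2].
Qed.

(** The pi_i map the exact sequence of the V_i to that of the quotients by F^i, which is exact by
    [quoF_map_exact]. Each case is a chase in the style of the five lemma. *)
Lemma mhs_embedding_thick : thick (mhs_embedding R n_gt0).
Proof.
split.
- move=> A B K k f /mhs_essential_image[oA pA] /mhs_essential_image[oB pB] /is_kernelP[inj ex].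
  apply/mhs_essential_image; split=> [x|i]; first by apply: (inj Fo); rewrite [LHS]oA [RHS]oA.
  split=> [x y xy|y].
    by apply: (inj (Fv i)) => /=; apply: (pA i).1; rewrite !fhs_phi_piE xy.
  have [a aE] := (pA i).2 (quoF_map (fhs_fet k) i y).
  have [|x xE] := (ex (Fv i) a).1.
    apply: (pB i).1; rewrite /= fhs_phi_piE aE linear0.
    by apply/(quoF_map_exact (ex Fet)); exists y.
  exists x; apply: (quoF_map_inj (inj Fet)).
  by rewrite -aE -xE -fhs_phi_piE.
- move=> A B Q q f /mhs_essential_image[oA pA] /mhs_essential_image[oB pB] /is_cokernelP[sur ex].
  apply/mhs_essential_image; split=> [y|i].
    by have [x <-] := sur Fo y; rewrite [x]oB fmor0.
  split=> [|z].
    suff p0 z : fhs_pi Q i z = 0 -> z = 0.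
      by move=> x y xy; apply/eqP; rewrite -subr_eq0; apply/eqP/p0; rewrite linearB /= xy subrr.
    have [b <-] := sur (Fv i) z; rewrite /= fhs_phi_piE.
    move=> /(quoF_map_exact (ex Fet))[a' a'E]; have [a aE] := (pA i).2 a'.
    apply/(ex (Fv i)); exists a; apply: (pB i).1.
    by rewrite /= fhs_phi_piE aE a'E.
  have [b' <-] := quoF_map_surj (sur Fet) z; have [b <-] := (pB i).2 b'.
  by exists (fhs_phi q i b); rewrite fhs_phi_piE.
- move=> A B Q f g /mhs_essential_image[oA pA] /mhs_essential_image[oQ pQ].
  move=> /short_exactP[inj ex sur].
  apply/mhs_essential_image; split=> [b|i].
    by have [a <-] := (ex Fo b).1 (oQ _); rewrite [a]oA fmor0.
  split=> [|z].
    suff p0 z : fhs_pi B i z = 0 -> z = 0.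
      by move=> x y xy; apply/eqP; rewrite -subr_eq0; apply/eqP/p0; rewrite linearB /= xy subrr.
    move=> z0; have [|a aE] := (ex (Fv i) z).1.
      by apply: (pQ i).1; rewrite /= fhs_phi_piE z0 !linear0.
    rewrite -aE (_ : a = 0) ?fmor0 //; apply: (pA i).1.
    apply: (quoF_map_inj (inj Fet)).
    by rewrite -fhs_phi_piE -/(fmor f (c := Fv i) a) aE z0 !linear0.
  (* Surjectivity for an extension: lift the image of z in the quotient to b. The error z - pi_i b
     then comes from the quotient by F^i of A, where pi_i is onto. *)
  have [c cE] := (pQ i).2 (quoF_map (fhs_fet g) i z); have [b bE] := sur (Fv i) c.
  have [|a' a'E] := (quoF_map_exact (i := i) (ex Fet) (z - fhs_pi B i b)).1.
    by rewrite linearB /= -fhs_phi_piE -/(fmor g (c := Fv i) b) bE cE subrr.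
  have [a aE] := (pA i).2 a'.
  exists (b + fhs_phi f i a); rewrite linearD /= fhs_phi_piE aE a'E.
  by rewrite addrC subrK.
Qed.

Definition fhs_group0 X := (forall x : fhs_o X, x = 0) /\ (forall x : fhs_et X, x = 0).

Lemma vec_essential_image X : essential_image (vec_embedding R n_gt0) X <-> fhs_group0 X.
Proof.
split=> [[V [f [g [gf fg]]]]|[o0 e0]].
  have fgE c (x : fcar X c) : fmor f (fmor g x) = x.
    by rewrite -fmor_comp -[RHS]fmor_id -[fhs_id _]fg.
  split=> x.
    by rewrite -(fgE Fo x) (_ : fmor g (x : fcar X Fo) = 0) ?fmor0 //; exact: thinmx0.
  by rewrite -(fgE Fet x) (_ : fmor g (x : fcar X Fet) = 0) ?fmor0 //; exact: thinmx0.
exists (fhs_vec X).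
have P1 (i : idx n) : (fhs_pi (vec_fhs n_gt0 (fhs_vec X)) i \o (vec_id (fhs_vec X)) i =
    quoF_map (0 : mhs_hom (fhs_et X) (mhs0 R n)) i \o fhs_pi X i)%VF.
  by rewrite quoF_map0 comp_lfun0l comp_lfun0l.
have P2 : (vec_id (fhs_vec X) (top_idx n_gt0) \o fhs_ho X =
    fhs_ho (vec_fhs n_gt0 (fhs_vec X)) \o 0)%VF.
  by apply/lfunP => x; rewrite [x]o0 !linear0.
have P3 x : vec_id (fhs_vec X) (top_idx n_gt0) (fhs_het X x) =
    fhs_het (vec_fhs n_gt0 (fhs_vec X)) ((0 : mhs_hom (fhs_et X) (mhs0 R n)) x).
  by rewrite [x]e0 raddf0 linear0.
apply: (@fhs_bij_iso X (vec_fhs n_gt0 (fhs_vec X))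
  (@FhsHom _ _ _ X (vec_fhs n_gt0 (fhs_vec X)) 0 0 (vec_id _) P1 P2 P3)).
- move=> [||i] x y /=; [by rewrite [x]o0 [y]o0 | by rewrite [x]e0 [y]e0 | by rewrite !id_lfunE].
- move=> [||i] y /=; [by exists 0; rewrite linear0 [y]thinmx0 | by exists 0; rewrite [y]thinmx0 |].
  by exists y; rewrite id_lfunE.
Qed.

Lemma vec_embedding_thick : thick (vec_embedding R n_gt0).
Proof.
split.
- move=> A B K k f /vec_essential_image[oA eA] _ /is_kernelP[inj _].
  apply/vec_essential_image; split=> x.
    by apply: (inj Fo); rewrite [LHS]oA [RHS]oA.
  by apply: (inj Fet); rewrite [LHS]eA [RHS]eA.
- move=> A B Q q f _ /vec_essential_image[oB eB] /is_cokernelP[sur _].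
  apply/vec_essential_image; split=> y.
    by have [x <-] := sur Fo y; rewrite [x]oB fmor0.
  by have [x <-] := sur Fet y; rewrite [x]eB fmor0.
- move=> A B Q f g /vec_essential_image[oA eA] /vec_essential_image[oQ eQ] /short_exactP[_ ex _].
  apply/vec_essential_image; split=> y.
    by have [x <-] := (ex Fo y).1 (oQ _); rewrite [x]oA fmor0.
  by have [x <-] := (ex Fet y).1 (eQ _); rewrite [x]eA fmor0.
Qed.

(** Since pi_i is the identity on both sides, compatibility with it forces phi_i to be the map
    induced by f_et. *)
Lemma mhs_embedding_full : full (mhs_embedding R n_gt0).
Proof.
move=> A B g; exists (fhs_fet g); apply: fhs_homP => //=; first exact: rV0_lfunP.
apply: vec_homP => i; have := fhs_phi_pi g i.
by rewrite comp_lfun1l comp_lfun1r => ->.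
Qed.

Lemma vec_embedding_full : full (vec_embedding R n_gt0).
Proof.
move=> V W g; exists (fhs_phi g); apply: fhs_homP => //=; first exact: rV0_lfunP.
exact: mhs0_homP.
Qed.

Lemma mhs_embedding_faithful : faithful (mhs_embedding R n_gt0).
Proof. by move=> A B f g /(congr1 (fun h : fhs_hom _ _ => fhs_fet h)). Qed.

Lemma vec_embedding_faithful : faithful (vec_embedding R n_gt0).
Proof. by move=> A B f g /(congr1 (fun h : fhs_hom _ _ => fhs_phi h)). Qed.

End Conclusion.

Theorem proposition1p7 (R : realType) (n : nat) (n_gt0 : (0 < n)%N) :
  [/\ abelian_category (FHS R n_gt0),
      exact_functor (forget_group R n_gt0) /\
        exact_functor (forget_vec R n_gt0),
      full_thick_embedding (mhs_embedding R n_gt0)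
    & full_thick_embedding (vec_embedding R n_gt0)].
Proof.
split.
- exact: fhs_abelian.
- by split; [exact: forget_group_exact | exact: forget_vec_exact].
- split; [exact: mhs_embedding_full | exact: mhs_embedding_faithful |].
  exact: mhs_embedding_thick.
- split; [exact: vec_embedding_full | exact: vec_embedding_faithful |].
  exact: vec_embedding_thick.
Qed.
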